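(* Let $B\subset W$ be a good lattice, $l=l(B)$, and $A$ a self-dual lattice with $B\subset A\subset B^*$. (i) The Hilbert space $\mathcal{H}^A_\psi$ is the Hilbert sum of the subspaces $\mathcal{E}^B_{n,j}$, $n\in\mathbb{N}$, $j=0,1,2$. The subspace $\mathcal{E}^B_{0,0}$ is non-zero. The subspaces $\mathcal{E}^{B,\pm}_{n,0}$, $n\ge1$, and $\mathcal{E}^{B,\pm}_{n,2}$, $n\geq0$, are non-zero if and only if $l>0$. The subspaces $\mathcal{E}^{B,\pm}_{n,1}$, $n\ge0$, are non-zero if and only if $l<r$. (ii) When non-zero, the subspaces $\mathcal{E}^B_{0,0}$, $\mathcal{E}^{B,\pm}_{n,0}$ ($n\ge1$), $\mathcal{E}^{B,\pm}_{n,j}$ ($n\ge0$, $j=1,2$) are invariant and irreducible under the representation $M_A$ restricted to $P_B$. Denote by $M^B_{0,0}$, $M^{B,\pm}_{n,0}$ ($n\ge1$), $M^{B,\pm}_{n,j}$ ($n\ge0$, $j=1,2$) the resulting representations of $P_B$. They are pairwise inequivalent and monomial. Moreover $M^B_{0,0}$ is the trivial representation and $$M^{B,\pm}_{n,0}=\mathrm{Ind}_{\tilde P_{B,v}}^{P_B}\chi^\pm_{B,v},\quad v\in\varpi^{-n}A\setminus\varpi^{-n}B,\ n\ge1;$$ $$M^{B,\pm}_{n,2}=\mathrm{Ind}_{\tilde P_{B,v}}^{P_B}\chi^\pm_{B,v},\quad v\in\varpi^{-n}B^*\setminus\varpi^{-n}A,\ n\ge0;$$ $$M^{B,\pm}_{n,1}=\mathrm{Ind}_{\tilde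 P_{B,v}}^{P_B}\chi^\pm_{B,v},\quad v\in\varpi^{-(n+1)}B\setminus\varpi^{-n}B^*,\ n\ge0.$$ (iii) When non-zero, the same subspaces are invariant and irreducible under the restriction of the metaplectic (Weil) representation $S^A_\psi$ to $P_B$. Denote by $S^B_{0,0}$, $S^{B,\pm}_{n,0}$ ($n\ge1$), $S^{B,\pm}_{n,j}$ ($n\ge0$, $j=1,2$) the resulting representations of $P_B$. They are pairwise inequivalent, $S^B_{0,0}=\zeta$, and $$S^{B,\pm}_{n,0}=\mathrm{Ind}_{\tilde P_{B,v}}^{P_B}\zeta\chi^\pm_{B,v},\quad v\in\varpi^{-n}A\setminus\varpi^{-n}B,\ n\ge1;$$ $$S^{B,\pm}_{n,2}=\mathrm{Ind}_{\tilde P_{B,v}}^{P_B}\zeta\chi^\pm_{B,v},\quad v\in\varpi^{-n}B^*\setminus\varpi^{-n}A,\ n\ge0;$$ $$S^{B,\pm}_{n,1}=\mathrm{Ind}_{\tilde P_{B,v}}^{P_B}\zeta\chi^\pm_{B,v},\quad v\in\varpi^{-(n+1)}B\setminus\varpi^{-n}B^*,\ n\ge0.$$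
   Context: $k$ is a non-archimedean local field of characteristic $0$ with ring of integers $\mathcal{O}$, uniformizer $\varpi$, residue field $\mathbb{F}_q$ of characteristic $p\neq2$; $\psi$ is a non-trivial unitary character of $(k,+)$ with conductor $\lambda_\psi$ (trivial on $\varpi^{\lambda_\psi}\mathcal{O}$, not on $\varpi^{\lambda_\psi-1}\mathcal{O}$). $(W,\beta)$ is a symplectic $k$-space of dimension $2r>0$. A lattice is a compact open $\mathcal{O}$-submodule; $B^*=\{v\in W:\beta(v,b)\in\varpi^{\lambda_\psi}\mathcal{O}\ \forall b\in B\}$; $B$ is good if $\varpi B^*\subset B\subset B^*$, self-dual if $B=B^*$. $K_B$ is the stabilizer of $B$ in $Sp(W)$. $\dim_{\mathbb{F}_q}B^*/B=2l(B)$. $P_B=K_A\cap K_B$ is the stabilizer of $A$ in $K_B$. $\mathcal{H}^A_\psi$ is the Hilbert space of functions $\varphi:W\to\mathbb{C}$ with $\varphi(a+w)=\psi(\frac12\beta(w,a))\varphi(w)$ ($a\in A$) and $\int_{W/A}|\varphi|^2<\infty$. For $g\in P_B$, $M_A(g)\varphi(w)=\varphi(g^{-1}w)$. $\zeta$ is the character of $P_B$ with $\zeta(p)=\left(\frac{\det(p\,|\,A/B)}{q}\right)$ (determinant of $p$ on the $\mathbb{F}_q$-space $A/B$; $\left(\frac{\cdot}{q}\right)$ is the quadratic character of $\mathbb{F}_q^\times$). The maximal compact group $K_B$ is lifted to the metaplectic group $Mp(W)$, and with this lift the Weil representation $S_\psi^A$ of $Mp(W)$ on $\mathcal{H}_\psi^A$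 satisfies $S^A_\psi(p)=\zeta(p)M_A(p)$ for $p\in P_B$. $\delta_0$ is the indicator function of $A$. Subspaces of $\mathcal{H}_\psi^A$: $\mathcal{E}^B_{0,0}=\mathbb{C}\delta_0$; $\mathcal{E}^B_{n,0}=\{f:\mathrm{Supp} f\subset\varpi^{-n}A\setminus\varpi^{-n}B\}$ for $n\ge1$; $\mathcal{E}^B_{n,2}=\{f:\mathrm{Supp} f\subset\varpi^{-n}B^*\setminus\varpi^{-n}A\}$ and $\mathcal{E}^B_{n,1}=\{f:\mathrm{Supp} f\subset\varpi^{-(n+1)}B\setminus\varpi^{-n}B^*\}$ for $n\ge0$. $\mathcal{E}^+$ (resp. $\mathcal{E}^-$) denotes the subspace of even (resp. odd) functions of $\mathcal{E}$. For $v\in W\setminus A$: $P_{B,v}$ is the stabilizer in $P_B$ of $v+A\in W/A$, $\tilde P_{B,v}=\{\pm\mathrm{Id}\}P_{B,v}$ (with $-\mathrm{Id}\notin P_{B,v}$), $\chi_{B,v}(g)=\psi(\frac12\beta(gv,v))$ is a character of $P_{B,v}$, and $\chi_{B,v}^\pm$ is its extension to $\tilde P_{B,v}$ with $\chi_{B,v}^\pm(-\mathrm{Id})=\pm1$; $\zeta\chi^\pm_{B,v}$ is the product with $\zeta_{|\tilde P_{B,v}}$. Monomial means induced from a one-dimensional character; equalities of representations mean equivalence. *)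

(* Defs.v *)
From HB Require Import structures.
From mathcomp Require Import all_boot all_order all_algebra.
From mathcomp Require Import all_classical all_reals all_analysis.
From mathcomp Require Import complex.

Set Implicit Arguments.
Unset Strict Implicit.
Unset Printing Implicit Defensive.

Import Order.TTheory GRing.Theory Num.Theory.
Import numFieldNormedType.Exports.

Local Open Scope classical_set_scope.
Local Open Scope ring_scope.
Local Open Scope complex_scope.

(* [v x >= N], with the convention [v 0 = +oo]: the value of [v] at 0 is junk *)
Definition val_ge (K : zmodType) (v : K -> int) (N : int) (x : K) : Prop :=
  x = 0 \/ N <= v x.

(* Non-archimedean local fields: fields that are complete for a normalized    *)
(* discrete valuation [nav], with finite residue field [residue], and carry   *)
(* the valuation topology. [red] is the reduction map on the ring of integers *)
(* (junk outside).                                                            *)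
HB.mixin Record isNALocalField (K : Type) of GRing.Field K & Topological K := {
  nav : K -> int;
  navM : forall x y : K, x != 0 -> y != 0 -> nav (x * y) = nav x + nav y;
  navD : forall x y : K, x != 0 -> y != 0 -> x + y != 0 ->
    Num.min (nav x) (nav y) <= nav (x + y);
  nav_surj : exists x : K, x != 0 /\ nav x = 1;
  nav_nbhs : forall (x : K) (U : set K),
    nbhs x U <-> exists N : int, forall y, val_ge nav N (y - x) -> U y;
  nav_complete : forall u : nat -> K,
    (forall N : int, exists m : nat, forall i j : nat,
       (m <= i)%N -> (m <= j)%N -> val_ge nav N (u i - u j)) ->
    exists a : K, forall N : int, exists m : nat, forall i : nat,
       (m <= i)%N -> val_ge nav N (u i - a);
  residue : finFieldType;
  red : K -> residue;
  red1 : red 1 = 1;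
  redD : forall x y : K, val_ge nav 0 x -> val_ge nav 0 y ->
    red (x + y) = red x + red y;
  redM : forall x y : K, val_ge nav 0 x -> val_ge nav 0 y ->
    red (x * y) = red x * red y;
  red_surj : forall a : residue, exists2 x : K, val_ge nav 0 x & red x = a;
  red_ker : forall x : K, val_ge nav 0 x -> (red x = 0 <-> val_ge nav 1 x)
}.

#[short(type="naLocalFieldType")]
HB.structure Definition NALocalField :=
  {K of GRing.Field K & Topological K & isNALocalField K}.

Arguments residue : clear implicits.

Section LocalField.
Variable k : naLocalFieldType.

Definition integers : set k := [set x | val_ge nav 0 x].

Definition uniformizer (varpi : k) := varpi != 0 /\ nav varpi = 1.

(* varpi ^ N O *)
Definition frac_ideal (varpi : k) (N : int) : set k :=
  [set varpi ^ N * x | x in integers].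

Definition quadratic_character (R : realType) (x : residue k) : R[i] :=
  if x == 0 then 0 else if [exists y, y ^+ 2 == x] then 1 else -1.

Definition unitary_character (R : realType) (psi : k -> R[i]) :=
  [/\ forall x y, psi (x + y) = psi x * psi y,
      forall x, `|psi x| = 1 &
      continuous (psi : k -> R[i]^o)].

Definition has_conductor (R : realType) (varpi : k) (psi : k -> R[i])
    (lambda : int) :=
  (forall x, frac_ideal varpi lambda x -> psi x = 1) /\
  (exists2 x, frac_ideal varpi (lambda - 1) x & psi x <> 1).

End LocalField.

Arguments integers : clear implicits.

Section Lattices.
Variables (k : naLocalFieldType) (n : nat).
Local Notation W := 'cV[k]_n.
Implicit Types (X Y : set W) (beta : W -> W -> k).

Definition symplectic_form beta :=
  [/\ forall (a : k) u u' v, beta (a *: u + u') v = a * beta u v + beta u' v,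
      forall (a : k) u v v', beta u (a *: v + v') = a * beta u v + beta u v',
      forall u, beta u u = 0 &
      forall u, (forall v, beta u v = 0) -> u = 0].

Definition lattice X :=
  [/\ X 0,
      forall x y, X x -> X y -> X (x + y),
      forall c x, integers k c -> X x -> X (c *: x),
      compact X &
      open X].

Definition scale_set (c : k) X : set W := [set c *: x | x in X].

Definition dual_lattice beta (varpi : k) (lambda : int) X : set W :=
  [set v | forall b, X b -> frac_ideal varpi lambda (beta v b)].

Definition good_lattice beta varpi lambda X :=
  [/\ lattice X,
      scale_set varpi (dual_lattice beta varpi lambda X) `<=` X &
      X `<=` dual_lattice beta varpi lambda X].

Definition self_dual_lattice beta varpi lambda X :=
  lattice X /\ X = dual_lattice beta varpi lambda X.

(* For lattices Y <= X with varpi X <= Y: [b] induces a basis of the vector   *)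
(* space X / Y over the residue field.                                        *)
Definition quot_basis X Y (d : nat) (b : 'I_d -> W) :=
  [/\ forall i, X (b i),
      forall x, X x -> exists c : 'I_d -> k,
        (forall i, integers k (c i)) /\ Y (x - \sum_i c i *: b i) &
      forall c : 'I_d -> k, (forall i, integers k (c i)) ->
        Y (\sum_i c i *: b i) -> forall i, red (c i) = 0].

Definition quot_dim X Y (d : nat) := exists b : 'I_d -> W, quot_basis X Y b.

(* the determinant of the endomorphism of X / Y induced by [g] *)
Definition is_quot_det X Y (g : 'M[k]_n) (D : residue k) :=
  exists (d : nat) (b : 'I_d -> W) (M : 'M[k]_d),
    [/\ quot_basis X Y b,
        forall i j, integers k (M i j),
        forall j, Y (g *m b j - \sum_i M i j *: b i) &
        D = \det (map_mx (red : k -> residue k) M)].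

Definition quot_det X Y (g : 'M[k]_n) : residue k :=
  xget 0 [set D | is_quot_det X Y g D].

(* GL(W) acts on column vectors from the left *)
Definition Sp beta : set 'M[k]_n :=
  [set g | forall u v, beta (g *m u) (g *m v) = beta u v].

Definition stab beta X : set 'M[k]_n :=
  [set g | Sp beta g /\ [set g *m x | x in X] = X].

End Lattices.

Section Summation.
Variables (R : realType) (T : choiceType).
Local Notation C := R[i].

Definition real_sum (D : set T) (f : T -> R) : R :=
  fine (\esum_(x in D) (Num.max (f x) 0)%:E) -
  fine (\esum_(x in D) (Num.max (- f x) 0)%:E).

Definition complex_sum (D : set T) (f : T -> C) : C :=
  real_sum D (fun x => complex.Re (f x)) +i*
  real_sum D (fun x => complex.Im (f x)).

(* one point in each class of the equivalence relation [e] on [D] *)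
Definition transversal (x0 : T) (D : set T) (e : T -> T -> Prop) : set T :=
  [set xget x0 [set y | D y /\ e x y] | x in D].

Definition square_summable (D : set T) (f : T -> C) :=
  (\esum_(x in D) (complex.Re (`|f x| ^+ 2))%:E < +oo)%E.

Definition l2_form (D : set T) (f g : T -> C) : C :=
  complex_sum D (fun x => f x * (g x)^*).

End Summation.

Section HilbertSum.
Variables (R : realType) (X : Type).
Local Notation C := R[i].
Implicit Types (form : (X -> C) -> (X -> C) -> C) (V F : set (X -> C)).

Definition fsubspace F :=
  F (fun=> 0) /\
  forall (a : C) f g, F f -> F g -> F (fun x => a * f x + g x).

Definition nonzero_space F := exists2 f, F f & f <> (fun=> 0).

Definition dist2 form (f g : X -> C) : R :=
  complex.Re (form (fun x => f x - g x) (fun x => f x - g x)).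

Definition form_closed form V F :=
  forall f, V f ->
    (forall e : R, 0 < e -> exists2 g, F g & dist2 form f g < e) -> F f.

Definition hilbert_sum form V (I : Type) (E : I -> set (X -> C)) :=
  [/\ forall i, [/\ E i `<=` V, fsubspace (E i) & form_closed form V (E i)],
      forall i j, i <> j -> forall f g, E i f -> E j g -> form f g = 0 &
      forall f, V f -> forall e : R, 0 < e ->
        exists (s : seq I) (g : I -> X -> C),
          (forall i, E i (g i)) /\
          dist2 form f (fun x => \sum_(i <- s) g i x) < e].

End HilbertSum.

(* A representation on a space of complex functions on [rep_pt]; [rep_form]   *)
(* and [rep_act] are only relevant on [rep_space].                            *)
Record hrep (R : realType) (gT : Type) := HRep {
  rep_pt : Type;
  rep_space : set (rep_pt -> R[i]);
  rep_form : (rep_pt -> R[i]) -> (rep_pt -> R[i]) -> R[i];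
  rep_act : gT -> (rep_pt -> R[i]) -> (rep_pt -> R[i])
}.

Arguments rep_space {R gT} r _ : rename.

Section Representations.
Variables (R : realType) (gT : Type).
Local Notation C := R[i].
Local Notation hrep := (hrep R gT).
Variable G : set gT.

Definition rep_invariant (X : Type) (act : gT -> (X -> C) -> (X -> C))
    (F : set (X -> C)) :=
  forall g f, G g -> F f -> F (act g f).

Definition rep_irreducible (r : hrep) :=
  nonzero_space (rep_space r) /\
  forall F : set (rep_pt r -> C),
    F `<=` rep_space r -> fsubspace F ->
    form_closed (@rep_form _ _ r) (rep_space r) F ->
    rep_invariant (@rep_act _ _ r) F ->
    F = [set (fun=> 0)] \/ F = rep_space r.

Definition rep_equivalent (r1 r2 : hrep) :=
  exists T : (rep_pt r1 -> C) -> (rep_pt r2 -> C),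
    [/\ forall (a : C) f g, rep_space r1 f -> rep_space r1 g ->
          T (fun x => a * f x + g x) = (fun y => a * T f y + T g y),
        forall f g, rep_space r1 f -> rep_space r1 g ->
          rep_form (T f) (T g) = rep_form f g,
        [set T f | f in rep_space r1] = rep_space r2 &
        forall g f, G g -> rep_space r1 f ->
          T (rep_act g f) = rep_act g (T f)].

Definition one_dim_rep (chi : gT -> C) : hrep :=
  @HRep R gT unit setT (fun x y => x tt * (y tt)^*) (fun g x t => chi g * x t).

End Representations.

Section Induction.
Variables (R : realType) (k : naLocalFieldType) (n : nat).
Local Notation C := R[i].
Local Notation gT := 'M[k]_n.
Variable G : set gT.

Definition matrix_subgroup (H : set gT) :=
  [/\ H 1%:M,
      forall g h, H g -> H h -> H (g *m h) &
      forall g, H g -> g \in unitmx /\ H (invmx g)].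

Definition group_character (H : set gT) (chi : gT -> C) :=
  [/\ forall g h, H g -> H h -> chi (g *m h) = chi g * chi h,
      forall g, H g -> `|chi g| = 1 &
      {within H, continuous (chi : gT -> R[i]^o)}].

Definition left_cosets (H : set gT) : set gT :=
  transversal 0 G (fun x y => H (invmx x *m y)).

(* Unitary induction from an open subgroup [H] of [G], so that G / H is       *)
(* discrete: functions on [G] (extended by 0) with f(gh) = chi(h)^-1 f(g),    *)
(* square-summable on G / H, on which [G] acts by left translation.           *)
Definition Ind (H : set gT) (chi : gT -> C) : hrep R gT :=
  @HRep R gT gT
    [set f | [/\ forall g, ~ G g -> f g = 0,
                 forall g h, G g -> H h -> f (g *m h) = (chi h)^-1 * f g &
                 square_summable (left_cosets H) f]]
    (l2_form (left_cosets H))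
    (fun g f x => f (invmx g *m x)).

Definition rep_monomial (r : hrep R gT) :=
  exists (H : set gT) (chi : gT -> C),
    [/\ matrix_subgroup H,
        H `<=` G /\ (exists2 U : set gT, open U & H = G `&` U),
        group_character H chi &
        rep_equivalent G r (Ind H chi)].

End Induction.

Inductive layer_index := j0 | j1 | j2.

(* [Lpm n j s]: the even ([s = true]) or odd ([s = false]) part of E_{n,j} *)
Inductive label := L00 | Lpm of nat & layer_index & bool.

Definition valid_label (x : label) : bool :=
  match x with
  | Lpm n j0 _ => (0 < n)%N
  | _ => true
  end.

Section LatticeModel.
Variables (R : realType) (k : naLocalFieldType) (n : nat).
Local Notation C := R[i].
Local Notation W := 'cV[k]_n.
Variables (varpi : k) (lambda : int) (psi : k -> C) (beta : W -> W -> k).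
Variables (A B : set W).

Local Notation Bs := (dual_lattice beta varpi lambda B).

Definition cosets : set W := transversal 0 setT (fun x y : W => A (y - x)).

(* W / A is discrete, hence integration over it is summation, up to a factor *)
Definition Hform : (W -> C) -> (W -> C) -> C := l2_form cosets.

Definition Hspace : set (W -> C) :=
  [set phi | (forall a w, A a ->
                phi (a + w) = psi (2^-1 * beta w a) * phi w) /\
             square_summable cosets phi].

Definition M_ (g : 'M[k]_n) (phi : W -> C) : W -> C :=
  fun w => phi (invmx g *m w).

Definition P_B : set 'M[k]_n := stab beta A `&` stab beta B.

Definition zeta (g : 'M[k]_n) : C := quadratic_character R (quot_det A B g).

(* The lattice model of the Heisenberg representation, restricted to W. It is *)
(* induced from the character (a, t) |-> psi t of A x k, for the product      *)
(* (w, t) (w', t') = (w + w', t + t' + beta w w' / 2).                        *)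
Definition heisenberg (v : W) (phi : W -> C) : W -> C :=
  fun w => psi (2^-1 * beta w v) * phi (w + v).

Definition unitary_operator (U : (W -> C) -> (W -> C)) :=
  [/\ forall (a : C) f g, Hspace f -> Hspace g ->
        U (fun w => a * f w + g w) = (fun w => a * U f w + U g w),
      forall f g, Hspace f -> Hspace g -> Hform (U f) (U g) = Hform f g &
      [set U f | f in Hspace] = Hspace].

(* The metaplectic group, as the group of pairs (g, U) with U a unitary       *)
(* operator implementing g on the Heisenberg representation; the Weil         *)
(* representation is (g, U) |-> U.                                            *)
Definition metaplectic (g : 'M[k]_n) (U : (W -> C) -> (W -> C)) :=
  [/\ Sp beta g,
      unitary_operator U &
      forall v phi, Hspace phi ->
        U (heisenberg v phi) = heisenberg (g *m v) (U phi)].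

(* [S] is the Weil representation composed with a lift g |-> (g, S g) of the  *)
(* stabilizer of B to the metaplectic group, for which S = zeta M_A on P_B.   *)
Definition weil_lift (S : 'M[k]_n -> (W -> C) -> (W -> C)) :=
  [/\ forall g, stab beta B g -> metaplectic g (S g),
      forall g h phi, stab beta B g -> stab beta B h -> Hspace phi ->
        S (g *m h) phi = S g (S h phi) &
      forall p phi, P_B p -> Hspace phi ->
        S p phi = (fun w => zeta p * M_ p phi w)].

(* W is the union of A and of the [layer m j], (m, j) <> (0, 0) *)
Definition layer (m : nat) (j : layer_index) : set W :=
  match j with
  | j0 => scale_set (varpi ^- m) A `\` scale_set (varpi ^- m) B
  | j1 => scale_set (varpi ^- m.+1) B `\` scale_set (varpi ^- m) Bs
  | j2 => scale_set (varpi ^- m) Bs `\` scale_set (varpi ^- m) A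
  end.

Definition delta0 : W -> C := fun w => (w \in A)%:R.

Definition E_ (m : nat) (j : layer_index) : set (W -> C) :=
  match m, j with
  | 0%N, j0 => [set f | exists c : C, f = (fun w => c * delta0 w)]
  | _, _ => [set f | Hspace f /\ (forall w, f w != 0 -> layer m j w)]
  end.

Definition sgn (s : bool) : C := if s then 1 else -1.

Definition Epm (m : nat) (j : layer_index) (s : bool) : set (W -> C) :=
  [set f | E_ m j f /\ forall w, f (- w) = sgn s * f w].

Definition label_space (x : label) : set (W -> C) :=
  match x with
  | L00 => E_ 0 j0
  | Lpm m j s => Epm m j s
  end.

Definition subrep (act : 'M[k]_n -> (W -> C) -> (W -> C)) (x : label) :=
  @HRep R 'M[k]_n W (label_space x) Hform act.

Definition P_v (v : W) : set 'M[k]_n := [set g | P_B g /\ A (g *m v - v)].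

Definition Ptilde_v (v : W) : set 'M[k]_n :=
  [set g | P_v v g \/ P_v v (- g)].

Definition chi_v (v : W) (g : 'M[k]_n) : C := psi (2^-1 * beta (g *m v) v).

Definition chi_pm (v : W) (s : bool) (g : 'M[k]_n) : C :=
  if `[< P_v v g >] then chi_v v g else sgn s * chi_v v (- g).

End LatticeModel.

(* Main.v *)
Require Import Defs.
From mathcomp Require Import all_boot all_order all_algebra.
From mathcomp Require Import all_classical all_reals all_analysis.
From mathcomp Require Import complex.
From mathcomp Require Import perm zify ring lra.

(* The chain A, B^*, varpi^-1 B, varpi^-1 A, ... exhausts W by P_B-stable     *)
(* lattices, and its successive differences ("levels") are the supports of    *)
(* the spaces E_{n,j}. Two facts about a level give everything.               *)
(*                                                                            *)
(* Transitivity: if v, v' are in the same level, there is b in a suitable     *)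
(* lattice with beta(v, b) and beta(v', b) of the same minimal valuation, and *)
(* an explicit isometry (a unipotent times a dilation, fixing the line of b)  *)
(* moves v to v' and preserves A and B.                                       *)
(*                                                                            *)
(* Separation: if v' is not in v + A nor in -v + A, choose u in A with        *)
(* beta(v - v', u) and beta(v + v', u) both outside varpi^lambda O. A         *)
(* transvection w + t beta(w, u) u then lies in P_{B,v} and P_{B,v'}, and     *)
(* chi_v / chi_v' takes on it the value psi(-t beta(v-v',u) beta(v+v',u) / 2),*)
(* which differs from 1 for some t.                                           *)
(*                                                                            *)
(* By separation, a function on which P_{B,v} acts by chi_v is supported on   *)
(* the two cosets of v and -v. Averaging over the (finite) twisted P_{B,v}-   *)
(* orbit of a function not vanishing at v thus isolates these two cosets,     *)
(* and transitivity gives irreducibility; inequivalence follows in the same   *)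
(* way. For the Weil representation, unitarity and multiplicativity on        *)
(* delta_0 show that zeta is a sign character, so that the twist by zeta      *)
(* changes nothing.                                                           *)

Set Implicit Arguments.
Unset Strict Implicit.
Unset Printing Implicit Defensive.

Import Order.TTheory GRing.Theory Num.Theory.

Local Open Scope classical_set_scope.
Local Open Scope ring_scope.

(** * Valuations and balls *)

Section Valuation.
Variable k : naLocalFieldType.
Implicit Types (x y : k) (M N : int).

(** Every function of the lattice model is the sum of its restrictions to the levels, the successive
    differences of the chain A, B^*, varpi^-1 B, varpi^-1 A, ... . Levels are unions of cosets of A,
    so these restrictions stay in the model and are mutually orthogonal ([model_hilbert_sum]). A
    level meets only finitely many cosets, and its space of functions is non-zero exactly when the
    level is non-empty. That is a question about lattices: by duality A = B, and likewise A = B^*,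
    only if B = B^*; and B = varpi B^* exactly when B^*/B has the full dimension 2r
    ([quot_basis_dim]).

    On the even or odd functions of one level above the first, P_B permutes transitively the pairs
    of cosets of v and -v ([level_trans]), and equivariance under A makes P_{B,v} act on the value
    at v through chi_v ([M_Pv]). The space is therefore induced from the character chi^+ or chi^- of
    the stabilizer of the pair; the isometry is f |-> (x |-> sqrt 2 z(x) f(x v)), see
    [induced_equivalent].

    Irreducibility and inequivalence follow Mackey's criterion in concrete form. By [separation],
    chi_v and chi_w differ on the common stabilizer unless w lies in the coset of v or of -v. Hence
    the chi_v-eigenvectors of P_{B,v} live on that pair of cosets ([twisted_concentrated]), every
    invariant subspace contains one ([isolate]), its translates span ([space_irreducible]), and an
    intertwiner must preserve both level and parity ([space_inequivalent]).

    The representations M_A and S are treated together as actions z(g) M_A(g), with z = 1 or z =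
    zeta. *)

Definition ideal N : set k := val_ge nav N.

Lemma nav1 : nav (1 : k) = 0.
Proof.
by have := @navM k 1 1 (oner_neq0 _) (oner_neq0 _); rewrite mulr1; lia.
Qed.

Lemma navV x : x != 0 -> nav x^-1 = - nav x.
Proof.
move=> x0; have := navM _ _ x0 (invr_neq0 x0).
by rewrite divff // nav1 => e; apply/eqP; rewrite -addr_eq0 addrC -e.
Qed.

Lemma ideal0 N : ideal N 0. Proof. by left. Qed.

Lemma ideal_nz N x : x != 0 -> ideal N x <-> N <= nav x.
Proof. by move=> x0; split=> [[/eqP|//]|]; [rewrite (negPf x0)|right]. Qed.

Lemma idealPn N x : ~ ideal N x -> x != 0 /\ nav x < N.
Proof.
move=> h; have x0 : x != 0 by apply/eqP => e; apply: h; left.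
by split=> //; rewrite ltNge; apply/negP => le; apply: h; right.
Qed.

Lemma ideal_le M N x : M <= N -> ideal N x -> ideal M x.
Proof. by move=> le [->|h]; [left|right; exact: le_trans h]. Qed.

Lemma idealD N x y : ideal N x -> ideal N y -> ideal N (x + y).
Proof.
move=> [->|hx]; first by rewrite add0r.
move=> [->|hy]; first by rewrite addr0; right.
have [->|x0] := eqVneq x 0; first by rewrite add0r; right.
have [->|y0] := eqVneq y 0; first by rewrite addr0; right.
have [->|s0] := eqVneq (x + y) 0; first by left.
by right; apply: le_trans (navD _ _ x0 y0 s0); rewrite le_min hx.
Qed.

Lemma idealM M N x y : ideal M x -> ideal N y -> ideal (M + N) (x * y).
Proof.
move=> [->|hx]; first by rewrite mul0r; left.
move=> [->|hy]; first by rewrite mulr0; left.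
have [->|x0] := eqVneq x 0; first by rewrite mul0r; left.
have [->|y0] := eqVneq y 0; first by rewrite mulr0; left.
by right; rewrite navM // lerD.
Qed.

Lemma navN1 : nav (-1 : k) = 0.
Proof.
have n0 : (-1 : k) != 0 by rewrite oppr_eq0 oner_neq0.
by have := navM _ _ n0 n0; rewrite mulrNN mulr1 nav1; lia.
Qed.

Lemma ideal1 : ideal 0 1. Proof. by right; rewrite nav1. Qed.

Lemma idealMl N x y : ideal 0 x -> ideal N y -> ideal N (x * y).
Proof. by move=> hx hy; rewrite -[N]add0r; exact: idealM. Qed.

Lemma idealN N x : ideal N x -> ideal N (- x).
Proof. by rewrite -mulN1r; apply: idealMl; right; rewrite navN1. Qed.

Lemma idealB N x y : ideal N x -> ideal N y -> ideal N (x - y).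
Proof. by move=> hx hy; apply: idealD => //; exact: idealN. Qed.

Lemma ideal_sum (J : Type) (s : seq J) (P : pred J) (F : J -> k) N :
  (forall i, P i -> ideal N (F i)) -> ideal N (\sum_(i <- s | P i) F i).
Proof. by move=> h; elim/big_ind: _ => //; [exact: ideal0|exact: idealD]. Qed.

Lemma idealV N x s : s != 0 -> nav s = N -> ideal N x -> ideal 0 (x / s).
Proof.
by move=> s0 <- hx; rewrite -(subrr (nav s)) -navV //; apply: idealM => //; right.
Qed.

Lemma navX x (n : nat) : x != 0 -> nav (x ^+ n) = nav x * n%:Z.
Proof.
move=> x0; elim: n => [|n IH]; first by rewrite expr0 nav1 mulr0.
by rewrite exprS navM ?expf_neq0 // IH; lia.
Qed.

Lemma navXz x N : x != 0 -> nav (x ^ N) = nav x * N.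
Proof.
move=> x0; case: N => n; first exact: navX.
by rewrite NegzE -exprnN navV ?expf_neq0 // navX // mulrN.
Qed.

Lemma frac_idealE varpi N : uniformizer varpi -> frac_ideal varpi N = ideal N.
Proof.
move=> [p0 p1]; have q0 := expfz_neq0 N p0.
have qN : nav (varpi ^ N) = N by rewrite navXz // p1 mul1r.
apply/seteqP; split=> [_ [x hx <-]|x hx].
  by rewrite mulrC; apply: idealMl => //; right; rewrite qN.
exists (x / varpi ^ N); first exact: idealV hx.
by rewrite mulrC divfK.
Qed.

(** [red] sends 2 to 1 + 1, which is nonzero in odd residue characteristic, so 2 is integral but not
    in the maximal ideal. *)
Lemma two_unit : 2%N \notin [pchar (residue k)] ->
  (2 : k) != 0 /\ nav (2 : k) = 0.
Proof.
move=> h; have i2 : ideal 0 2 by apply: idealD; exact: ideal1.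
have r2 : red (2 : k) != 0.
  rewrite (_ : 2 = 1 + 1) // redD ?red1; [|exact: ideal1|exact: ideal1].
  by apply: contra h => /eqP e; rewrite inE /= (_ : 2%:R = 1 + 1) // e.
have n1 : ~ ideal 1 2 by move=> /(red_ker _ i2) e; rewrite e eqxx in r2.
have [n0 n1'] := idealPn n1; split=> //.
by have /ideal_nz := i2 => /(_ n0); lia.
Qed.

Lemma ideal_half N x : 2%N \notin [pchar (residue k)] ->
  ideal N x -> ideal N (2^-1 * x).
Proof.
move=> /two_unit [n0 n1]; apply: idealMl.
by right; rewrite navV // n1.
Qed.

Lemma red0 : red (0 : k) = 0.
Proof. by apply/(red_ker _ (ideal0 0)); left. Qed.

Lemma redB (x y : k) : ideal 0 x -> ideal 0 y -> red (x - y) = red x - red y.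
Proof.
move=> hx hy; apply/eqP; rewrite eq_sym subr_eq -redD ?subrK //.
exact: idealB.
Qed.

Lemma red_sum (J : Type) (s : seq J) (F : J -> k) :
  (forall i, ideal 0 (F i)) -> red (\sum_(i <- s) F i) = \sum_(i <- s) red (F i).
Proof.
move=> h; elim: s => [|i s IH]; first by rewrite !big_nil red0.
by rewrite !big_cons redD ?IH //; [exact: h|apply: ideal_sum].
Qed.

End Valuation.

Section Balls.
Variables (k : naLocalFieldType).

Definition ball_mx (m n : nat) (N : int) : set 'M[k]_(m, n) :=
  [set w | forall i j, ideal N (w i j)].

Lemma nbhs_ball_mx (m n : nat) (x : 'M[k]_(m, n)) (U : set 'M[k]_(m, n)) :
  nbhs x U <-> exists N, forall y, ball_mx N (y - x) -> U y.
Proof.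
split=> [[P hP sPU]|[N h]].
  have /(_ _ _)/(nav_nbhs _ _)/cid hN i j := hP i j.
  pose f (i : 'I_m) (j : 'I_n) := projT1 (hN i j).
  have [N0 hN0] : exists N0 : int, forall i j, f i j <= N0.
    (* The sum of all absolute values is a common upper bound for the finitely many radii. *)
    exists (\sum_i \sum_j `|f i j|) => i j.
    rewrite (bigD1 i) //= (bigD1 j) //= -!addrA.
    apply: le_trans (ler_norm _) _; rewrite lerDl addr_ge0 //.
      by apply: sumr_ge0.
    by apply: sumr_ge0 => ? _; apply: sumr_ge0.
  exists N0 => y hy; apply: sPU => i j; apply: (projT2 (hN i j)).
  by have := hy i j; rewrite !mxE; apply: ideal_le; exact: hN0.
exists (fun i j => [set z | ideal N (z - x i j)]).
  by move=> i j; apply/nav_nbhs; exists N.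
by move=> y hy; apply: h => i j; rewrite !mxE; exact: hy.
Qed.

Lemma ball_mx_le (m n : nat) M N (w : 'M[k]_(m, n)) :
  M <= N -> ball_mx N w -> ball_mx M w.
Proof. by move=> le h i j; apply: ideal_le (h i j). Qed.

Lemma ball_mxD (m n : nat) N (v w : 'M[k]_(m, n)) :
  ball_mx N v -> ball_mx N w -> ball_mx N (v + w).
Proof. by move=> hv hw i j; rewrite mxE; apply: idealD. Qed.

Lemma ball_mxM (m n p : nat) M N (v : 'M[k]_(m, n)) (w : 'M[k]_(n, p)) :
  ball_mx M v -> ball_mx N w -> ball_mx (M + N) (v *m w).
Proof. by move=> hv hw i j; rewrite mxE; apply: ideal_sum => q _;
  apply: idealM. Qed.

Lemma ball_mx_ex (m n : nat) (v : 'M[k]_(m, n)) : exists N, ball_mx N v.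
Proof.
exists (- \sum_i \sum_j `|nav (v i j)|) => i j; right.
rewrite lerNl (bigD1 i) //= (bigD1 j) //= -!addrA.
apply: le_trans (_ : `|nav (v i j)| <= _); first by rewrite -normrN ler_norm.
rewrite lerDl addr_ge0 //; first by apply: sumr_ge0.
by apply: sumr_ge0 => ? _; apply: sumr_ge0.
Qed.

Lemma lattice_ball (n : nat) (X : set 'cV[k]_n) :
  lattice X -> exists N, ball_mx N `<=` X.
Proof.
move=> [X0 _ _ _]; rewrite openE => /(_ 0 X0) /nbhs_ball_mx [N h].
by exists N => w hw; apply: h; rewrite subr0.
Qed.

(** The balls of index [- N] grow with [N], and each point has a neighbourhood inside one of them;
    compactness gives one [N] for all of [X]. *)
Lemma lattice_bounded (n : nat) (X : set 'cV[k]_n) :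
  lattice X -> exists N, X `<=` ball_mx N.
Proof.
move=> [_ _ _ /compact_near_coveringP cX _].
have [|N _ hN] := cX nat \oo (fun N x => ball_mx (- N%:Z) x) _; last first.
  by exists (- N%:Z) => x Xx; exact: (hN N (leqnn N) x Xx).
move=> x Xx; have [N hN] := ball_mx_ex x.
exists ([set y : 'cV[k]_n | ball_mx N (y - x)], [set M | (`|N| <= M)%N]).
  by split; [apply/nbhs_ball_mx; exists N|exists `|N|%N].
move=> [y M] /= [hy hM]; rewrite -(subrK x y).
by apply: ball_mx_le (ball_mxD hy hN); lia.
Qed.

End Balls.

(** * Bases of lattices *)

Section LatticeBasis.
Variables (k : naLocalFieldType) (n : nat).
Local Notation W := 'cV[k]_n.
Implicit Types (X Y : set W) (g : 'M[k]_n) (N : int).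

Definition omodule X :=
  [/\ X 0, forall x y, X x -> X y -> X (x + y) &
      forall c x, ideal 0 c -> X x -> X (c *: x)].

Lemma omodule_lattice X : lattice X -> omodule X.
Proof. by case. Qed.

Lemma omoduleZ X c x : omodule X -> ideal 0 c -> X x -> X (c *: x).
Proof. by move=> [_ _ h]; exact: h. Qed.

Lemma omoduleN X x : omodule X -> X x -> X (- x).
Proof.
by move=> [_ _ h] Xx; rewrite -scaleN1r; apply: h => //; apply: idealN;
  exact: ideal1.
Qed.

Lemma omoduleB X x y : omodule X -> X x -> X y -> X (x - y).
Proof. by move=> mX Xx Xy; have [_ h _] := mX; apply: h => //; exact: omoduleN. Qed.

Lemma omoduleDl X x y : omodule X -> X x -> X (x + y) <-> X y.
Proof.
move=> mX Xx; split=> [h|]; last by have [_ D _] := mX; exact: D.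
by rewrite -[y](addKr x) addrC; exact: omoduleB.
Qed.

Lemma omodule_sum X (J : Type) (s : seq J) (P : pred J) (F : J -> W) : omodule X ->
  (forall i, P i -> X (F i)) -> X (\sum_(i <- s | P i) F i).
Proof. by move=> [X0 XD _] h; elim/big_ind: _. Qed.

Lemma ideal_prod (J : Type) (s : seq J) (F : J -> k) N :
  (forall i, ideal N (F i)) -> ideal (N * (size s)%:Z) (\prod_(i <- s) F i).
Proof.
move=> h; elim: s => [|i s IH]; first by rewrite big_nil mulr0; exact: ideal1.
rewrite big_cons (_ : N * _ = N + N * (size s)%:Z); first exact: idealM.
by rewrite /=; lia.
Qed.

Lemma ideal_det g N : ball_mx N g -> ideal (N * n%:Z) (\det g).
Proof.
move=> h; apply: ideal_sum => s _; apply: idealMl.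
  by rewrite -signr_odd; case: odd; [apply: idealN|]; exact: ideal1.
have := @ideal_prod _ (enum 'I_n) (fun i => g i (s i)) N.
by rewrite size_enum_ord big_enum; apply=> i.
Qed.

Lemma uniformizer_ex : exists p : k, uniformizer p.
Proof. exact: nav_surj. Qed.

(* Cramer's rule *)
Lemma det_replace_col g (x : W) i : g \in unitmx ->
  \det (\matrix_(a, b) if b == i then x a 0 else g a b)
  = \det g * (invmx g *m x) i 0.
Proof.
move=> ug; rewrite /invmx ug -scalemxAl mxE mulrA divff ?mul1r; last first.
  by rewrite -unitfE.
rewrite (expand_det_col _ i) mxE; apply: eq_bigr => a _.
rewrite !mxE eqxx mulrC; congr (_ * _); rewrite /cofactor; congr (_ * \det _).
by apply/matrixP => b c; rewrite !mxE eq_sym (negPf (neq_lift _ _)).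
Qed.

(** Lattices are free. Among the invertible matrices with columns in [X], take [g] with determinant
    of least valuation. Replacing column [i] by [x] in [X] multiplies the determinant by the [i]-th
    coordinate of [x] in the basis [g], so minimality makes that coordinate integral. *)
Lemma lattice_basis X : omodule X -> (exists N, ball_mx N `<=` X) ->
  (exists N, X `<=` ball_mx N) ->
  exists2 g, g \in unitmx & forall x, X x <-> ball_mx 0 (invmx g *m x).
Proof.
move=> mX [N hN] [M hM]; have [X0 XD XZ] := mX.
pose Q g := g \in unitmx /\ forall j, X (col j g).
have QM g : Q g -> M * n%:Z <= nav (\det g).
  move=> [ug hg]; have d0 : \det g != 0 by rewrite -unitfE.
  by apply/ideal_nz => //; apply: ideal_det => i j; have := hM _ (hg j) i 0;
    rewrite mxE.
(* Boundedness of [X] bounds these valuations below by [M * n]; subtracting the bound turns the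
   minimum into one over natural numbers. *)
pose P d := `[< exists2 g, Q g & nav (\det g) - M * n%:Z = d%:Z >].
have exP : exists d, P d.
  have [p [p0 p1]] := uniformizer_ex.
  pose g : 'M[k]_n := (p ^ N)%:M.
  have Qg : Q g.
    split; first by rewrite unitmxE det_scalar unitfE expf_neq0 // expfz_neq0.
    move=> j; apply: hN => i j'; rewrite !mxE; case: eqP => _;
      rewrite ?mulr0n ?mulr1n; last by left.
    by right; rewrite navXz // p1 mul1r.
  exists (absz (nav (\det g) - M * n%:Z)%R); apply/asboolP; exists g => //.
  by have := QM _ Qg; lia.
have [d /asboolP [g Qg gd] dmin] := ex_minnP exP.
have {dmin} gmin g' : Q g' -> nav (\det g) <= nav (\det g').
  move=> Qg'; have /dmin : P (absz (nav (\det g') - M * n%:Z)%R).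
    by apply/asboolP; exists g' => //; have := QM _ Qg'; lia.
  by have := QM _ Qg'; lia.
have [ug hg] := Qg; exists g => // x; split=> [Xx i j|h].
  apply: contrapT; rewrite ord1 => /idealPn [y0 yn].
  pose g' : 'M[k]_n := \matrix_(a, b) if b == i then x a 0 else g a b.
  have d' : \det g' = \det g * (invmx g *m x) i 0 by apply: det_replace_col.
  have d0 : \det g != 0 by rewrite -unitfE.
  have Qg' : Q g'.
    split; first by rewrite unitmxE d' unitfE mulf_neq0.
    move=> j'; have [e|ne] := eqVneq j' i.
      by rewrite (_ : col _ _ = x) //; apply/colP => a; rewrite !mxE e eqxx.
    rewrite (_ : col _ _ = col j' g) //; apply/colP => a.
    by rewrite !mxE (negPf ne).
  have := gmin _ Qg'; rewrite d' navM // lerDl leNgt yn //.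
rewrite -(mulKVmx ug x); set y := invmx g *m x in h *.
have -> : g *m y = \sum_j y j 0 *: col j g.
  by apply/colP => a; rewrite mxE summxE; apply: eq_bigr => j _; rewrite !mxE mulrC.
by apply: omodule_sum => // j _; apply: XZ.
Qed.

(* [red] of a vector, junk outside the integral ones *)
Definition redv m (x : 'cV[k]_m) : 'cV[residue k]_m := map_mx red x.

Lemma redvB m (x y : 'cV[k]_m) : ball_mx 0 x -> ball_mx 0 y ->
  redv (x - y) = redv x - redv y.
Proof. by move=> hx hy; apply/colP => i; rewrite !mxE redB. Qed.

(** A basis of [X] identifies X / pX with the [n]-dimensional space over the residue field. As pX
    lies in [Y], the reductions of [b] are independent there ([inj]), so [d <= n], with equality
    exactly when they span X / pX. Since [b] spans X modulo [Y], this happens exactly when [Y] lies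
    in pX. *)
Lemma quot_basis_dim X Y (p : k) d (b : 'I_d -> W) : uniformizer p ->
  omodule X -> (exists N, ball_mx N `<=` X) -> (exists N, X `<=` ball_mx N) ->
  omodule Y -> scale_set p X `<=` Y -> Y `<=` X -> quot_basis X Y b ->
  (d < n)%N <-> ~ (Y `<=` scale_set p X).
Proof.
move=> [p0 p1] mX bX bX' mY pXY YX [Xb bgen bfree].
have [g ug gX] := lattice_basis mX bX bX'.
pose c i := invmx g *m b i.
have ic i : ball_mx 0 (c i) by apply/gX.
have ec i : invmx g *m b i = c i by [].
clearbody c.
pose C : 'M[residue k]_(n, d) := \matrix_(i, j) red (c j i 0).
have pXE x : scale_set p X x <-> ball_mx 1 (invmx g *m x).
  split=> [[y /gX hy <-] i j|h].
    rewrite -scalemxAr mxE; rewrite -[1]addr0; apply: idealM => //.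
    by right; rewrite p1.
  exists (p^-1 *: x); last by rewrite scalerA divff // scale1r.
  apply/gX => i j; rewrite -scalemxAr mxE mulrC.
  exact: idealV (h i j).
have redC (a : 'I_d -> k) : (forall i, ideal 0 (a i)) ->
    redv (invmx g *m \sum_i a i *: b i) = C *m \col_i red (a i).
  move=> ha; apply/colP => i; rewrite /redv [LHS]mxE [RHS]mxE mulmx_sumr.
  under eq_bigr do rewrite -scalemxAr ec.
  rewrite summxE red_sum; last by move=> j; rewrite mxE; apply: idealMl;
    [exact: ha|exact: ic].
  apply: eq_bigr => j _; rewrite !mxE mulrC redM //.
    exact: (ic j i 0).
  exact: (ha j).
have red1P (x : W) : ball_mx 0 x -> redv x = 0 <-> ball_mx 1 x.
  move=> hx; split=> [e i j|h]; last first.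
    by apply/colP => i; rewrite !mxE; apply/red_ker;
      [exact: (hx i 0)|exact: (h i 0)].
  apply/red_ker; first exact: (hx i j).
  by rewrite ord1; have := congr1 (fun z : 'cV_n => z i 0) e; rewrite !mxE.
have lift (a : 'cV[residue k]_d) : exists2 a' : 'I_d -> k,
    (forall i, ideal 0 (a' i)) & a = \col_i red (a' i).
  have h i := cid2 (red_surj (a i 0)).
  exists (fun i => s2val (h i)); first by move=> i; exact: (s2valP (h i)).
  by apply/colP => i; rewrite mxE (s2valP' (h i)).
have inj (a : 'cV[residue k]_d) : C *m a = 0 -> a = 0.
  have [a' ha ->] := lift a; rewrite -redC // => /red1P h.
  apply/colP => i; rewrite !mxE; apply: bfree i => //.
  apply: pXY; apply/pXE; apply: h; apply/gX.
  by apply: omodule_sum => // i _; have [_ _ Z] := mX; apply: Z.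
have rC : \rank C = d.
  rewrite -mxrank_tr; apply/eqP; rewrite -/(row_free _) -kermx_eq0.
  apply/eqP/row_matrixP => i; rewrite row0; apply: trmx_inj; rewrite trmx0.
  apply: inj; apply: trmx_inj; rewrite trmx_mul trmxK trmx0.
  by apply/sub_kermxP; exact: row_sub.
have dn : (d <= n)%N by rewrite -rC; exact: rank_leq_row.
have surj : row_full C^T <-> d = n.
  by rewrite /row_full mxrank_tr rC; split=> [/eqP|/eqP].
split=> [lt YpX|h].
  suff /surj e : row_full C^T by rewrite e ltnn in lt.
  rewrite -sub1mx; apply/row_subP => i.
  have [y yO yi] : exists2 y : W, ball_mx 0 y & redv y = (row i 1%:M)^T.
    exists ((row i 1%:M)^T).
      move=> a b'; rewrite !mxE; case: eqP => _; last by left.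
      by rewrite mulr1n; exact: ideal1.
    by apply/colP => a; rewrite !mxE; case: eqP => _; rewrite ?red1 ?red0.
  have Xgy : X (g *m y) by apply/gX; rewrite mulKmx.
  have [a [ha Ya]] := bgen _ Xgy.
  have /YpX/pXE/red1P := Ya; rewrite mulmxBr mulKmx //.
  have hs : ball_mx 0 (invmx g *m (\sum_i a i *: b i)).
    by apply/gX; apply: omodule_sum => // j _; have [_ _ Z] := mX; apply: Z;
      [exact: (ha j)|].
  have hd : ball_mx 0 (y - invmx g *m (\sum_i a i *: b i)).
    by apply: (ball_mxD yO) => a' b'; rewrite mxE; apply: idealN; exact: (hs a' b').
  move=> /(_ hd) e.
  have {}e : redv y = redv (invmx g *m (\sum_i a i *: b i)).
    by apply/eqP; rewrite -subr_eq0 -redvB ?e.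
  rewrite redC // yi in e; apply/submxP; exists (\col_i red (a i))^T.
  by apply: trmx_inj; rewrite e trmx_mul !trmxK.
(* If [d = n], an element [y] of [Y] is congruent modulo pX to a combination of [b]. That
   combination lies in [Y] as well, so its coefficients reduce to 0 and [y] is in pX. *)
rewrite ltn_neqAle dn andbT; apply/eqP => /surj full; apply: h => y Yy.
have hy : ball_mx 0 (invmx g *m y) by apply/gX/YX.
have : ((redv (invmx g *m y))^T <= C^T)%MS by apply: submx_full.
move=> /submxP [a ea]; have [a' ha ea'] := lift a^T.
have e : redv (invmx g *m y) = redv (invmx g *m \sum_i a' i *: b i).
  by rewrite redC // -ea'; apply: trmx_inj; rewrite ea trmx_mul trmxK.
have Xs : X (\sum_i a' i *: b i).
  by apply: omodule_sum => // j _; have [_ _ Z] := mX; apply: Z.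
have hs : ball_mx 0 (invmx g *m (\sum_i a' i *: b i)) by apply/gX.
have Yd : Y (\sum_i a' i *: b i - y).
  apply: pXY; apply/pXE; rewrite mulmxBr; apply/red1P.
    by move=> i j; rewrite !mxE; apply: idealB; [have := hs i j|have := hy i j];
      rewrite mxE.
  by rewrite redvB // e subrr.
have Ys : Y (\sum_i a' i *: b i).
  by rewrite -(subrK y (\sum_i _)); have [_ D _] := mY; apply: D.
have a0 := bfree _ ha Ys.
apply/pXE/red1P => //; rewrite e redC // (_ : \col_i _ = 0) ?mulmx0 //.
by apply/colP => i; rewrite !mxE.
Qed.

End LatticeBasis.

(** * Symplectic maps *)

Section Symplectic.
Variables (k : naLocalFieldType) (n : nat).
Local Notation W := 'cV[k]_n.
Variable beta : W -> W -> k.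
Hypothesis beta_sympl : symplectic_form beta.
Implicit Types (u v w b : W) (g h : 'M[k]_n).

Lemma betaDl u v w : beta (u + v) w = beta u w + beta v w.
Proof. by have [h _ _ _] := beta_sympl; have := h 1 u v w;
  rewrite scale1r mul1r. Qed.

Lemma betaDr u v w : beta w (u + v) = beta w u + beta w v.
Proof. by have [_ h _ _] := beta_sympl; have := h 1 w u v;
  rewrite scale1r mul1r. Qed.

Lemma beta0l w : beta 0 w = 0.
Proof. by have := betaDl 0 0 w; rewrite addr0 => /eqP;
  rewrite -subr_eq0 opprD addNKr oppr_eq0 => /eqP. Qed.

Lemma beta0r w : beta w 0 = 0.
Proof. by have := betaDr 0 0 w; rewrite addr0 => /eqP;
  rewrite -subr_eq0 opprD addNKr oppr_eq0 => /eqP. Qed.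

Lemma betaZl a u w : beta (a *: u) w = a * beta u w.
Proof. by have [h _ _ _] := beta_sympl; have := h a u 0 w;
  rewrite addr0 beta0l addr0. Qed.

Lemma betaZr a u w : beta w (a *: u) = a * beta w u.
Proof. by have [_ h _ _] := beta_sympl; have := h a w u 0;
  rewrite addr0 beta0r addr0. Qed.

Lemma betaNl u w : beta (- u) w = - beta u w.
Proof. by rewrite -scaleN1r betaZl mulN1r. Qed.

Lemma betaNr u w : beta w (- u) = - beta w u.
Proof. by rewrite -scaleN1r betaZr mulN1r. Qed.

Lemma betavv u : beta u u = 0. Proof. by have [_ _ h _] := beta_sympl. Qed.

Lemma betaC u v : beta u v = - beta v u.
Proof.
have := betavv (u + v); rewrite betaDl !betaDr !betavv add0r addr0 => /eqP.
by rewrite addr_eq0 => /eqP.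
Qed.

Definition betaE :=
  (betaDl, betaDr, betaNl, betaNr, betaZl, betaZr, betavv, beta0l, beta0r).

(** Nondegeneracy of [beta] makes its Gram matrix [J] invertible. *)
Lemma beta_represents (phi : 'rV[k]_n) : exists u, forall w, beta w u = (phi *m w)
  0 0.
Proof.
pose J : 'M[k]_n := \matrix_(i, j) beta (delta_mx i 0) (delta_mx j 0).
have betaJ v w : beta v w = (v^T *m J *m w) 0 0.
  have dec (x : W) : x = \sum_i x i 0 *: delta_mx i 0.
    by rewrite {1}(matrix_sum_delta x); apply: eq_bigr => i _; rewrite big_ord1.
  have suml (I : Type) (s : seq I) (F : I -> W) x :
      beta (\sum_(i <- s) F i) x = \sum_(i <- s) beta (F i) x.
    by elim: s => [|i s IH]; rewrite ?big_nil ?betaE // !big_cons betaDl IH.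
  have sumr (I : Type) (s : seq I) (F : I -> W) x :
      beta x (\sum_(i <- s) F i) = \sum_(i <- s) beta x (F i).
    by elim: s => [|i s IH]; rewrite ?big_nil ?betaE // !big_cons betaDr IH.
  rewrite {1}(dec w) sumr mxE; apply: eq_bigr => j _.
  rewrite betaZr mulrC; congr (_ * _); rewrite {1}(dec v) suml mxE.
  by apply: eq_bigr => i _; rewrite betaZl !mxE.
have uJ : J \in unitmx.
  rewrite -row_free_unit -kermx_eq0; apply/eqP/row_matrixP => i; rewrite row0.
  have [_ _ _ nd] := beta_sympl; apply: trmx_inj; rewrite trmx0; apply: nd => w.
  rewrite betaJ trmxK (_ : row i (kermx J) *m J = 0) ?mul0mx ?mxE //.
  by apply/sub_kermxP; exact: row_sub.
exists (invmx J *m phi^T) => w; rewrite betaJ -mulmxA mulKVmx //.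
by rewrite -[phi *m w]trmxK trmx_mul [RHS]mxE.
Qed.

Definition colmx (f : W -> W) : 'M[k]_n := \matrix_(i, j) f (delta_mx j 0) i 0.

Lemma colmxE f w : (forall a u v, f (a *: u + v) = a *: f u + f v) ->
  colmx f *m w = f w.
Proof.
move=> lf; have f0 : f 0 = 0.
  have := lf 1 0 0; rewrite !scale1r addr0 => /eqP.
  by rewrite -subr_eq0 opprD addNKr oppr_eq0 => /eqP.
have fs (I : Type) (s : seq I) (F : I -> k) (x : I -> W) :
    f (\sum_(i <- s) F i *: x i) = \sum_(i <- s) F i *: f (x i).
  by elim: s => [|i s IH]; rewrite ?big_nil // !big_cons lf IH.
have {2}-> : w = \sum_i w i 0 *: delta_mx i 0.
  by rewrite {1}(matrix_sum_delta w); apply: eq_bigr => i _; rewrite big_ord1.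
rewrite fs; apply/colP => i; rewrite mxE summxE; apply: eq_bigr => j _.
by rewrite !mxE mulrC.
Qed.

Lemma Sp_unit g : Sp beta g -> g \in unitmx.
Proof.
move=> hg; rewrite -unitmx_tr -row_free_unit -kermx_eq0.
apply/eqP/row_matrixP => i; rewrite row0.
have [_ _ _ nd] := beta_sympl; apply: trmx_inj; rewrite trmx0; apply: nd => w.
rewrite -hg -[g in beta (g *m _)]trmxK -trmx_mul (_ : row i _ *m g^T = 0).
  by rewrite trmx0 beta0l.
by apply/sub_kermxP; exact: row_sub.
Qed.

(* The isometry moving [v] to [v'] inside the parabolic fixing the line of [b]. *)
Definition shear v v' b w : W :=
  w + (beta w b / beta v b) *: (v' - v)
    + (beta w (v' - v) / beta v' b
       - beta w b / beta v b * (beta v v' / beta v' b)) *: b.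

Definition transvection (t : k) u w : W := w + (t * beta w u) *: u.

Lemma shear_linear v v' b a u w :
  shear v v' b (a *: u + w) = a *: shear v v' b u + shear v v' b w.
Proof.
rewrite /shear !betaE; apply/colP => i; rewrite !mxE; ring.
Qed.

Lemma shear_id v v' b : beta v b != 0 -> beta v' b != 0 -> shear v v' b v = v'.
Proof.
move=> s0 s0'; rewrite /shear !betaE; apply/colP => i; rewrite !mxE; field.
by rewrite s0 s0'.
Qed.

Lemma shear_Sp v v' b u w : beta v b != 0 -> beta v' b != 0 ->
  beta (shear v v' b u) (shear v v' b w) = beta u w.
Proof.
move=> s0 s0'; rewrite /shear !betaE.
rewrite (betaC b w) (betaC b v) (betaC b v') (betaC v' v) (betaC v w) (betaC v' w).
by field; rewrite s0 s0'.
Qed.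

Lemma shearK v v' b w : beta v b != 0 -> beta v' b != 0 ->
  shear v' v b (shear v v' b w) = w.
Proof.
move=> s0 s0'; rewrite /shear !betaE.
rewrite (betaC b v) (betaC b v') (betaC v' v).
apply/colP => i; rewrite !mxE; field; by rewrite s0 s0'.
Qed.

Lemma transvection_linear t x a u w :
  transvection t x (a *: u + w) = a *: transvection t x u + transvection t x w.
Proof. rewrite /transvection !betaE; apply/colP => i; rewrite !mxE; ring. Qed.

Lemma transvection_Sp t x u w :
  beta (transvection t x u) (transvection t x w) = beta u w.
Proof. rewrite /transvection !betaE (betaC x w); ring. Qed.

Lemma transvectionK t x w : transvection (- t) x (transvection t x w) = w.
Proof. rewrite /transvection !betaE; apply/colP => i; rewrite !mxE; ring. Qed.

End Symplectic.

(** * The chain of lattices and the action of P_B *)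

Record lattice_setting (k : naLocalFieldType) (n : nat) (varpi : k)
    (lambda : int) (beta : 'cV[k]_n -> 'cV[k]_n -> k) (A B : set 'cV[k]_n) :
    Prop := LatticeSetting {
  set_char2 : 2%N \notin [pchar (residue k)];
  set_unif : uniformizer varpi;
  set_sympl : symplectic_form beta;
  set_B : good_lattice beta varpi lambda B;
  set_A : self_dual_lattice beta varpi lambda A;
  set_BA : B `<=` A;
  set_ABs : A `<=` dual_lattice beta varpi lambda B }.

Section Geometry.
Variables (k : naLocalFieldType) (n : nat) (varpi : k) (lambda : int).
Local Notation W := 'cV[k]_n.
Variables (beta : W -> W -> k) (A B : set W).
Local Notation Bs := (dual_lattice beta varpi lambda B).
Hypothesis H : lattice_setting varpi lambda beta A B.
Implicit Types (u v w b : W) (g h : 'M[k]_n).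

Let bE := betaE (set_sympl H).
Let bC := betaC (set_sympl H).

Lemma dualE (X : set W) v : dual_lattice beta varpi lambda X v <->
  forall b, X b -> ideal lambda (beta v b).
Proof. by rewrite /dual_lattice /= (frac_idealE _ (set_unif H)). Qed.

Lemma dual_omodule (X : set W) : omodule (dual_lattice beta varpi lambda X).
Proof.
split=> [|x y /dualE hx /dualE hy|c x hc /dualE hx]; apply/dualE => b Xb;
  rewrite !bE.
- exact: ideal0.
- by apply: idealD; [exact: hx|exact: hy].
- by apply: idealMl => //; exact: hx.
Qed.

Lemma A_omod : omodule A.
Proof. by have [/omodule_lattice] := set_A H. Qed.

Lemma B_omod : omodule B.
Proof. by have [/omodule_lattice] := set_B H. Qed.

Lemma AP v : A v <-> forall a, A a -> ideal lambda (beta v a).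
Proof. by have [_ {1}->] := set_A H; exact: dualE. Qed.

Lemma betaAA u v : A u -> A v -> ideal lambda (beta u v).
Proof. by move=> /AP h; exact: h. Qed.

Lemma betaBsB u v : Bs u -> B v -> ideal lambda (beta u v).
Proof. by move=> /dualE h; exact: h. Qed.

Lemma betaBBs u v : B u -> Bs v -> ideal lambda (beta u v).
Proof. by move=> hu hv; rewrite bC; apply: idealN; exact: betaBsB. Qed.

Lemma BA u : B u -> A u. Proof. exact: (set_BA H). Qed.
Lemma ABs u : A u -> Bs u. Proof. exact: (set_ABs H). Qed.

Lemma BsB u : Bs u -> B (varpi *: u).
Proof. by move=> hu; have [_ h _] := set_B H; apply: (h (varpi *: u));
  exists u. Qed.

Lemma varpi_ideal : ideal 1 varpi.
Proof. by right; have [_ ->] := set_unif H. Qed.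

Lemma varpi_neq0 : varpi != 0. Proof. by have [] := set_unif H. Qed.

Lemma ideal1_varpi c : ideal 1 c -> exists2 d, ideal 0 d & c = d * varpi.
Proof.
move=> hc; have [p0 p1] := set_unif H; exists (c / varpi); last by rewrite divfK.
exact: idealV hc.
Qed.

Lemma scale_BsB c u : ideal 1 c -> Bs u -> B (c *: u).
Proof.
move=> /ideal1_varpi [d hd ->] hu; rewrite -scalerA.
by have [_ _ Z] := B_omod; apply: Z => //; exact: BsB.
Qed.

(** In a basis of [B], varpi^lambda times a coordinate is a linear form, and the vector [u]
    representing it lies in B^*. Pairing [v] with these vectors tests the integrality of its
    coordinates. *)
Lemma B_bidual v : (forall b, Bs b -> ideal lambda (beta v b)) -> B v.
Proof.
move=> hv; have [lB _ _] := set_B H.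
have [g ug gB] := lattice_basis B_omod (lattice_ball lB) (lattice_bounded lB).
apply/gB => i j; rewrite ord1; have [p0 p1] := set_unif H.
have [u hu] := beta_represents (set_sympl H) (varpi ^ lambda *: row i (invmx g)).
have qN : nav (varpi ^ lambda) = lambda by rewrite navXz // p1 mul1r.
have uE w : beta w u = varpi ^ lambda * (invmx g *m w) i 0.
  by rewrite hu -scalemxAl mxE -row_mul mxE.
have Bu : Bs u.
  apply/dualE => b /gB hb; rewrite bC uE; apply: idealN; rewrite mulrC.
  by apply: idealMl => //; right; rewrite qN.
have := hv _ Bu; rewrite uE => h.
have q0 := expfz_neq0 lambda p0.
by have := idealV q0 qN h; rewrite mulrC mulKf.
Qed.

Lemma A_ball : exists N, ball_mx N `<=` A.
Proof. by have [/lattice_ball] := set_A H. Qed.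

Lemma Bs_ball : exists N, ball_mx N `<=` Bs.
Proof. by have [N h] := A_ball; exists N => x /h /ABs. Qed.

Lemma Bs_bounded : exists N, Bs `<=` ball_mx N.
Proof.
have [lB _ _] := set_B H; have [N h] := lattice_bounded lB.
have [p0 p1] := set_unif H; exists (N - 1) => x /BsB /h hx i j.
have := hx i j; rewrite mxE => hxi.
have -> : x i j = varpi^-1 * (varpi * x i j) by rewrite mulKf.
by rewrite addrC; apply: idealM => //; right; rewrite navV // p1.
Qed.

Lemma quot_dim_gt0 l : quot_dim Bs B (2 * l) -> (0 < l)%N <-> ~ (Bs `<=` B).
Proof.
move=> [b [hb bgen bfree]]; split=> [l0 h|].
  have l0' : (0 < 2 * l)%N by rewrite muln_gt0.
  have := bfree (fun=> 1) (fun=> ideal1 k) _ (Ordinal l0').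
  rewrite red1 => e; have /eqP := oner_neq0 (residue k); apply; apply: e.
  apply: omodule_sum; first exact: B_omod.
  by move=> i _; rewrite scale1r; apply: h.
case: l b hb bgen bfree => // b hb bgen _ h; exfalso; apply: h => x /bgen [c [_]].
by rewrite big1 ?subr0 // => -[].
Qed.

(** If [A] lies in [B], then B^* lies in the dual of [A], which is [A], hence in [B]. *)
Lemma AB_gt0 l : quot_dim Bs B (2 * l) -> (0 < l)%N <-> ~ (A `<=` B).
Proof.
move=> /quot_dim_gt0 ->; split=> h AB; apply: h => x hx; last exact/AB/ABs.
by apply: (AB x); apply/AP => a /AB; exact: betaBsB.
Qed.

Lemma BsA_gt0 l : quot_dim Bs B (2 * l) -> (0 < l)%N <-> ~ (Bs `<=` A).
Proof.
move=> /quot_dim_gt0 ->; split=> h BsA; apply: h => x hx; last exact/BA/BsA.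
by apply: B_bidual => b /BsA; exact: betaAA (BsA _ hx).
Qed.

(** This is [quot_basis_dim] for the inclusions of varpi B^* in [B] and of [B] in B^*. *)
Lemma B_lt l : quot_dim Bs B (2 * l) -> (2 * l < n)%N <->
  ~ (B `<=` scale_set varpi Bs).
Proof.
move=> [b hb]; apply: quot_basis_dim hb; first exact: set_unif H.
- exact: dual_omodule.
- exact: Bs_ball.
- exact: Bs_bounded.
- exact: B_omod.
- by move=> _ [x hx <-]; exact: BsB.
- by move=> x /BA/ABs.
Qed.

Lemma P_B_Sp g : P_B beta A B g -> Sp beta g. Proof. by case=> -[]. Qed.

Lemma P_B_unit g : P_B beta A B g -> g \in unitmx.
Proof. by move=> /P_B_Sp; exact: Sp_unit (set_sympl H) _. Qed.

Lemma stab1 (X : set W) : stab beta X 1%:M.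
Proof.
split; first by move=> u v; rewrite !mul1mx.
by apply/seteqP; split=> [_ [x Xx <-]|x Xx]; [rewrite mul1mx|exists x;
  rewrite ?mul1mx].
Qed.

Lemma stabM (X : set W) g h : stab beta X g -> stab beta X h ->
  stab beta X (g *m h).
Proof.
move=> [sg eg] [sh eh]; split; first by move=> u v; rewrite -!mulmxA sg sh.
apply/seteqP; split=> [_ [x Xx <-]|x].
  by rewrite -mulmxA -eg; exists (h *m x) => //; rewrite -eh; exists x.
by rewrite -{1}eg => -[y]; rewrite -{1}eh => -[z Xz <-] <-; exists z => //;
  rewrite mulmxA.
Qed.

Lemma stabV (X : set W) g : stab beta X g -> stab beta X (invmx g).
Proof.
move=> [sg eg]; have ug := Sp_unit (set_sympl H) sg.
split; first by move=> u v; rewrite -[LHS]sg !mulKVmx.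
apply/seteqP; split=> [_ [x + <-]|x Xx].
  by rewrite -{1}eg => -[y Xy <-]; rewrite mulKmx.
by exists (g *m x); [rewrite -eg; exists x|rewrite mulKmx].
Qed.

Lemma stabN (X : set W) g : omodule X -> stab beta X g -> stab beta X (- g).
Proof.
move=> mX [sg eg]; split; first by move=> u v; rewrite !mulNmx !bE opprK sg.
rewrite -{2}eg; apply/seteqP; split=> [_ [x Xx <-]|_ [x Xx <-]].
  by exists (- x); rewrite ?mulmxN ?mulNmx //; exact: omoduleN.
by exists (- x); rewrite ?mulmxN ?mulNmx ?opprK //; exact: omoduleN.
Qed.

Lemma P_B1 : P_B beta A B 1%:M. Proof. by split; exact: stab1. Qed.

Lemma P_BM g h : P_B beta A B g -> P_B beta A B h -> P_B beta A B (g *m h).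
Proof. by move=> [? ?] [? ?]; split; exact: stabM. Qed.

Lemma P_BV g : P_B beta A B g -> P_B beta A B (invmx g).
Proof. by move=> [? ?]; split; exact: stabV. Qed.

Lemma P_BN g : P_B beta A B g -> P_B beta A B (- g).
Proof. by move=> [? ?]; split; apply: stabN => //;
  [exact: A_omod|exact: B_omod]. Qed.

Lemma stabP (X : set W) g w : stab beta X g -> X (g *m w) <-> X w.
Proof.
move=> [sg eg]; split=> h; last by rewrite -eg; exists w.
move: h; rewrite -{1}eg => -[y Xy].
by move=> /(congr1 (mulmx (invmx g)));
  rewrite !mulKmx ?(Sp_unit (set_sympl H) sg) // => <-.
Qed.

Lemma P_B_A g w : P_B beta A B g -> A (g *m w) <-> A w.
Proof. by move=> [h _]; exact: stabP. Qed.

Lemma P_B_B g w : P_B beta A B g -> B (g *m w) <-> B w.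
Proof. by move=> [_ h]; exact: stabP. Qed.

Lemma P_B_Bs g w : P_B beta A B g -> Bs (g *m w) <-> Bs w.
Proof.
move=> hg; have sg := P_B_Sp hg; have ug := P_B_unit hg.
split=> /dualE h; apply/dualE => b Bb.
  by rewrite -sg; apply: h; apply/P_B_B.
rewrite -(mulKVmx ug b) sg; apply: h; apply/(P_B_B _ hg).
by rewrite mulKVmx.
Qed.

Lemma P_B_colmx (f f' : W -> W) :
  (forall a u v, f (a *: u + v) = a *: f u + f v) ->
  (forall u v, beta (f u) (f v) = beta u v) ->
  cancel f' f -> (forall w, A w -> A (f w)) -> (forall w, B w -> B (f w)) ->
  (forall w, A w -> A (f' w)) -> (forall w, B w -> B (f' w)) ->
  P_B beta A B (colmx f).
Proof.
move=> lf sf ff' fA fB fA' fB'.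
have st (X : set W) : (forall w, X w -> X (f w)) -> (forall w, X w -> X (f' w)) ->
    stab beta X (colmx f).
  move=> fX fX'; split; first by move=> u v; rewrite !colmxE.
  apply/seteqP; split=> [_ [x Xx <-]|x Xx]; first by rewrite colmxE //; exact: fX.
  by exists (f' x); [exact: fX'|rewrite colmxE].
by split; apply: st.
Qed.

(** * Transitivity of [P_B] inside A, B^* and B *)

Lemma avoid_two (Z : set W) N v v' : omodule Z ->
  (exists2 z, Z z & ~ ideal N (beta v z)) ->
  (exists2 z, Z z & ~ ideal N (beta v' z)) ->
  exists z, [/\ Z z, ~ ideal N (beta v z) & ~ ideal N (beta v' z)].
Proof.
move=> [_ ZD _] [z hz nz] [z' hz' nz'].
have [h|h] := pselect (ideal N (beta v' z)); last by exists z.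
have [h'|h'] := pselect (ideal N (beta v z')); last by exists z'.
(* A group is not the union of two proper subgroups: [z] works for [v] only and [z'] for [v'] only,
   so their sum works for both. *)
exists (z + z'); split; first exact: ZD.
  by rewrite !bE => e; apply: nz; rewrite -(addrK (beta v z') (beta v z));
    exact: idealB.
by rewrite !bE addrC => e; apply: nz'; rewrite -(addrK (beta v' z) (beta v' z'));
  exact: idealB.
Qed.

Lemma shear_mem (X : set W) v v' b w : omodule X -> X w ->
  X ((beta w b / beta v b) *: (v' - v)) ->
  X ((beta w (v' - v) / beta v' b) *: b) ->
  X ((beta w b / beta v b * (beta v v' / beta v' b)) *: b) ->
  X (shear beta v v' b w).
Proof.
move=> mX hw h1 h2 h3; have [_ XD _] := mX; rewrite /shear.
by apply: (XD _ _ (XD _ _ hw h1)); rewrite scalerBl; exact: omoduleB.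
Qed.

(** The inverse of a shear is the shear with [v] and [v'] exchanged ([shearK]). Stability is
    therefore asked for all pairs [x], [x'], which covers the map and its inverse at once. *)
Lemma shear_P_B (X : set W) v v' b : X v -> X v' ->
  beta v b != 0 -> beta v' b != 0 ->
  (forall w x x', X x -> X x' -> beta x b != 0 -> nav (beta x b) = lambda ->
     beta x' b != 0 -> nav (beta x' b) = lambda ->
     (A w -> A (shear beta x x' b w)) /\ (B w -> B (shear beta x x' b w))) ->
  nav (beta v b) = lambda -> nav (beta v' b) = lambda ->
  exists2 g, P_B beta A B g & g *m v = v'.
Proof.
move=> Xv Xv' s0 s0' hX sl sl'; have sy := set_sympl H.
exists (colmx (shear beta v v' b)); last first.
  by rewrite colmxE; [exact: shear_id|exact: shear_linear].
apply: (P_B_colmx (f' := shear beta v' v b)).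
- exact: shear_linear.
- by move=> u w; apply: shear_Sp.
- by move=> w; apply: shearK.
- by move=> w; have [] := hX w _ _ Xv Xv' s0 sl s0' sl'.
- by move=> w; have [] := hX w _ _ Xv Xv' s0 sl s0' sl'.
- by move=> w; have [] := hX w _ _ Xv' Xv s0' sl' s0 sl.
- by move=> w; have [] := hX w _ _ Xv' Xv s0' sl' s0 sl.
Qed.

Lemma nav_eq N (x : k) : ideal N x -> ~ ideal (N + 1) x -> x != 0 /\ nav x = N.
Proof.
move=> hx /idealPn [x0 lt]; split=> //; have /ideal_nz := hx => /(_ x0) le.
by apply/eqP; rewrite eq_le le andbT; move: lt; rewrite -ltzD1 addrC.
Qed.

Lemma idealM_varpi N (x : k) : ~ ideal N x -> ~ ideal (N + 1) (varpi * x).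
Proof.
move=> h e; apply: h; have [p0 p1] := set_unif H.
rewrite -(mulKf p0 x) (_ : N = -1 + (N + 1)); last by lia.
by apply: idealM => //; right; rewrite navV // p1.
Qed.

(** The vector [b = varpi y] lies in [B], and [v], [v'] pair with it in valuation exactly [lambda],
    the least possible between A and B. The shear coefficients are then integral on [A]. On [B] the
    coefficient of [v' - v] gains a factor [varpi], and varpi A lies in B. *)
Lemma trans_A v v' : A v -> ~ B v -> A v' -> ~ B v' ->
  exists2 g, P_B beta A B g & g *m v = v'.
Proof.
have ex v0 : ~ B v0 -> exists2 z, Bs z & ~ ideal lambda (beta v0 z).
  move=> nB; apply: contrapT => h; apply: nB; apply: B_bidual => b Bb.
  by apply: contrapT => nb; apply: h; exists b.
move=> Av /ex zv Av' /ex zv'.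
have [y [By h h']] := avoid_two (dual_omodule B) zv zv'.
pose b := varpi *: y; have Bb : B b by exact: BsB.
have nE v0 : A v0 -> ~ ideal lambda (beta v0 y) ->
    beta v0 b != 0 /\ nav (beta v0 b) = lambda.
  move=> Av0 /idealM_varpi nv; apply: nav_eq; first exact: betaAA Av0 (BA Bb).
  by rewrite /b !bE.
have [s0 sl] := nE _ Av h; have [s0' sl'] := nE _ Av' h'.
apply: (shear_P_B (X := A)) Av Av' s0 s0' _ sl sl' => w x x' Ax Ax' x0 xl x0' xl'.
have Ad : A (x' - x) by apply: omoduleB => //; exact: A_omod.
have O1 u c : A u -> beta c b != 0 -> nav (beta c b) = lambda ->
    ideal 0 (beta u b / beta c b).
  by move=> Au c0 cl; apply: (idealV c0 cl); exact: betaAA Au (BA Bb).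
have O2 u u' c : A u -> A u' -> beta c b != 0 -> nav (beta c b) = lambda ->
    ideal 0 (beta u u' / beta c b).
  by move=> Au Au' c0 cl; apply: (idealV c0 cl); exact: betaAA.
have BZ c : ideal 0 c -> B (c *: b) by move=> hc; exact: (omoduleZ B_omod).
split=> hw.
  apply: shear_mem => //; first exact: A_omod.
  - by apply: (omoduleZ A_omod) => //; exact: O1.
  - by apply: BA; apply: BZ; exact: O2.
  - by apply: BA; apply: BZ; apply: idealMl; [exact: O1|exact: O2].
have Aw := BA hw.
apply: shear_mem => //; first exact: B_omod.
- apply: scale_BsB; last exact: ABs.
  rewrite /b !bE -mulrA -[1]addr0; apply: idealM; first exact: varpi_ideal.
  have -> : varpi * beta x y = beta x b by rewrite /b !bE.
  by apply: (idealV x0 xl); exact: betaBBs.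
- by apply: BZ; exact: O2.
- by apply: BZ; apply: idealMl; [exact: O1|exact: O2].
Qed.

(** Now [y] is found in [A], and [b = varpi y] is again in [B]. Pairings with [v' - v] or between
    [v] and [v'] may drop to valuation [lambda - 1]. The loss is made up by the factor [varpi] in
    beta(w, b) for [w] in [A], or by moving the [varpi] of [b] into the coefficient and keeping [y]
    in [A]. *)
Lemma trans_Bs v v' : Bs v -> ~ A v -> Bs v' -> ~ A v' ->
  exists2 g, P_B beta A B g & g *m v = v'.
Proof.
have ex v0 : ~ A v0 -> exists2 z, A z & ~ ideal lambda (beta v0 z).
  move=> nB; apply: contrapT => h; apply: nB; apply/AP => b Bb.
  by apply: contrapT => nb; apply: h; exists b.
move=> Av /ex zv Av' /ex zv'.
have [y [By h h']] := avoid_two A_omod zv zv'.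
pose b := varpi *: y; have Bb : B b by exact/BsB/ABs.
have bl u : Bs u -> ideal lambda (beta u b) by move=> hu; exact: betaBsB.
have nE v0 : Bs v0 -> ~ ideal lambda (beta v0 y) ->
    beta v0 b != 0 /\ nav (beta v0 b) = lambda.
  move=> Av0 /idealM_varpi nv; apply: nav_eq; first exact: bl.
  by rewrite /b !bE.
have [s0 sl] := nE _ Av h; have [s0' sl'] := nE _ Av' h'.
apply: (shear_P_B (X := Bs)) Av Av' s0 s0' _ sl sl' => w x x' Ax Ax' x0 xl x0' xl'.
have Ad : Bs (x' - x) by exact: (omoduleB (dual_omodule B) Ax' Ax).
have O1 : A w -> ideal 1 (beta w b / beta x b).
  have e : beta w b = varpi * beta w y by rewrite bE.
  move=> Aw; rewrite e -mulrA -[1]addr0.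
  by apply: idealM; [exact: varpi_ideal|apply: (idealV x0 xl); exact: betaAA].
have O2 : ideal (-1) (beta x x' / beta x' b).
  rewrite -(mulKf varpi_neq0 (_ / _)) -[-1]addr0; apply: idealM.
    by right; rewrite navV ?varpi_neq0 //; have [_ ->] := set_unif H.
  rewrite mulrA; apply: (idealV x0' xl').
  by rewrite -betaZr; [exact: betaBsB Ax (BsB Ax')|exact: (set_sympl H)].
have BZ c : ideal 0 c -> B (c *: b) by move=> hc; exact: (omoduleZ B_omod).
have T1 : A w -> B ((beta w b / beta x b) *: (x' - x)).
  by move=> Aw; apply: scale_BsB => //; exact: O1.
have T3 : A w -> B ((beta w b / beta x b * (beta x x' / beta x' b)) *: b).
  by move=> Aw; apply: BZ; rewrite -(subrr 1); apply: idealM => //; exact: O1.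
split=> hw.
  apply: shear_mem => //; [exact: A_omod|exact/BA/T1| |exact/BA/T3].
  have -> : (beta w (x' - x) / beta x' b) *: b = (varpi * beta w (x' - x) / beta x'
    b) *: y.
    by rewrite {2}/b scalerA mulrC mulrA.
  apply: (omoduleZ A_omod) => //.
  apply: (idealV x0' xl'); rewrite -betaZr; last exact: (set_sympl H).
  by apply: betaAA => //; exact/BA/BsB.
have Aw := BA hw.
apply: shear_mem => //; [exact: B_omod|exact: T1| |exact: T3].
by apply: BZ; apply: (idealV x0' xl'); exact: betaBBs.
Qed.

(** Outside varpi B^*, a vector of [B] pairs with some [b] in [B] in valuation exactly [lambda]. All
    correction terms of the shear then lie in [B], even for [w] in [A]. *)
Lemma trans_B v v' : B v -> ~ Bs (varpi^-1 *: v) -> B v' -> ~ Bs (varpi^-1 *: v') ->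
  exists2 g, P_B beta A B g & g *m v = v'.
Proof.
have ex v0 : ~ Bs (varpi^-1 *: v0) ->
  exists2 z, B z & ~ ideal (lambda + 1) (beta v0 z).
  move=> nB; apply: contrapT => h; apply: nB; apply/dualE => b Bb.
  apply: contrapT => nb; apply: h; exists b => //.
  by move: nb => /idealM_varpi; rewrite bE mulVKf // varpi_neq0.
move=> Av /ex zv Av' /ex zv'.
have [b [Bb h h']] := avoid_two B_omod zv zv'.
have bl u : A u -> ideal lambda (beta u b) by move=> hu; exact: betaBsB (ABs hu) Bb.
have [s0 sl] := nav_eq (bl _ (BA Av)) h.
have [s0' sl'] := nav_eq (bl _ (BA Av')) h'.
apply: (shear_P_B (X := B)) Av Av' s0 s0' _ sl sl' => w x x' Ax Ax' x0 xl x0' xl'.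
have Ad : B (x' - x) by apply: omoduleB => //; exact: B_omod.
have BZ c u : ideal 0 c -> B u -> B (c *: u) by move=> hc; exact: (omoduleZ B_omod).
have T1 : A w -> B ((beta w b / beta x b) *: (x' - x)).
  by move=> Aw; apply: BZ => //; apply: (idealV x0 xl); exact: bl.
have T2 : A w -> B ((beta w (x' - x) / beta x' b) *: b).
  by move=> Aw; apply: BZ => //; apply: (idealV x0' xl');
    exact: betaBsB (ABs Aw) Ad.
have T3 : A w -> B ((beta w b / beta x b * (beta x x' / beta x' b)) *: b).
  move=> Aw; apply: BZ => //; apply: idealMl;
    [apply: (idealV x0 xl)|apply: (idealV x0' xl')]; first exact: bl.
  exact: betaAA (BA Ax) (BA Ax').
split=> hw; first by apply: shear_mem => //;
  [exact: A_omod|exact/BA/T1|exact/BA/T2|exact/BA/T3].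
have Aw := BA hw.
by apply: shear_mem => //; [exact: B_omod|exact: T1|exact: T2|exact: T3].
Qed.

(* [A], [B^*], [varpi^-1 B], [varpi^-1 A], ... *)
Definition chain (i : nat) : set W :=
  [set w | match (i %% 3)%N with
           | 0%N => A (varpi ^+ (i %/ 3) *: w)
           | 1%N => Bs (varpi ^+ (i %/ 3) *: w)
           | _ => B (varpi ^+ (i %/ 3).+1 *: w)
           end].

Lemma chain0 m w : chain (3 * m) w = A (varpi ^+ m *: w).
Proof. by rewrite /chain /= mulnC modnMl mulnK. Qed.

Lemma chain1 m w : chain (3 * m).+1 w = Bs (varpi ^+ m *: w).
Proof. by rewrite /chain /= -addn1 mulnC modnMDl divnMDl // addn0. Qed.

Lemma chain2 m w : chain (3 * m).+2 w = B (varpi ^+ m.+1 *: w).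
Proof. by rewrite /chain /= -addn2 mulnC modnMDl divnMDl // addn0. Qed.

Lemma chain_ind (P : nat -> Prop) : (forall m, P (3 * m)%N) ->
  (forall m, P (3 * m).+1) -> (forall m, P (3 * m).+2) -> forall i, P i.
Proof.
move=> P0 P1 P2 i; rewrite (divn_eq i 3) mulnC.
have : (i %% 3 < 3)%N by rewrite ltn_mod.
by case: (i %% 3)%N => [|[|[|]]] // _; rewrite ?addn0 ?addn1 ?addn2.
Qed.

Lemma omodule_scaled (X : set W) c : omodule X -> omodule [set w | X (c *: w)].
Proof.
move=> [X0 XD XZ]; split=> /=; first by rewrite scaler0.
  by move=> x y; rewrite scalerDr; exact: XD.
by move=> a x ha; rewrite scalerA mulrC -scalerA; exact: XZ.
Qed.

Lemma chain_omod i : omodule (chain i).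
Proof.
move: i; apply: chain_ind => m.
- rewrite (_ : chain _ = [set w | A (varpi ^+ m *: w)]).
    by apply: omodule_scaled; exact: A_omod.
  by apply/funext => w; exact: chain0.
- rewrite (_ : chain _ = [set w | Bs (varpi ^+ m *: w)]).
    by apply: omodule_scaled; exact: dual_omodule.
  by apply/funext => w; exact: chain1.
- rewrite (_ : chain _ = [set w | B (varpi ^+ m.+1 *: w)]).
    by apply: omodule_scaled; exact: B_omod.
  by apply/funext => w; exact: chain2.
Qed.

Lemma chainS i : chain i `<=` chain i.+1.
Proof.
move: i; apply: chain_ind => m w.
- by rewrite chain0 chain1; exact: ABs.
- by rewrite chain1 chain2 exprS -scalerA; exact: BsB.
- by rewrite chain2 -addn3 -mulnSr chain0; exact: BA.
Qed.

Lemma chain_le i j : (i <= j)%N -> chain i `<=` chain j.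
Proof.
move=> /subnK <-; elim: (j - i)%N => [|d IH] //= w /IH.
by rewrite addSn; exact: chainS.
Qed.

Lemma A_chain i : A `<=` chain i.
Proof.
by move=> w Aw; apply: (chain_le (leq0n i));
  rewrite -(muln0 3) chain0 expr0 scale1r.
Qed.

Lemma chain_P_B i g w : P_B beta A B g -> chain i (g *m w) <-> chain i w.
Proof.
move=> hg; move: i; apply: chain_ind => m;
  rewrite ?(chain0, chain1, chain2) scalemxAr.
- exact: P_B_A.
- exact: P_B_Bs.
- exact: P_B_B.
Qed.

Lemma nav_varpiX m : nav (varpi ^+ m) = m%:Z.
Proof. by have [p0 p1] := set_unif H; rewrite navX // p1 mul1r. Qed.

Lemma varpiX_neq0 m : varpi ^+ m != 0.
Proof. by rewrite expf_neq0 // varpi_neq0. Qed.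

Lemma chain_bounded i : exists N, chain i `<=` ball_mx N.
Proof.
have [N hN] := Bs_bounded; exists (N - i%:Z) => w hw.
have : chain (3 * i).+1 w by apply: chain_le hw; lia.
rewrite chain1 => /hN h a b.
have -> : w a b = (varpi ^+ i)^-1 * (varpi ^+ i *: w) a b.
  by rewrite mxE mulKf // varpiX_neq0.
rewrite addrC; apply: idealM; last exact: h.
by right; rewrite navV ?varpiX_neq0 // nav_varpiX.
Qed.

Lemma chain_exhaust w : exists i, chain i w.
Proof.
have [N hN] := A_ball; have [M hM] := ball_mx_ex w.
exists (3 * absz (N - M)%R)%N; rewrite chain0; apply: hN => i j; rewrite mxE.
apply: (@ideal_le _ _ ((absz (N - M)%R)%:Z + M)); first by lia.
by apply: idealM => //; right; rewrite nav_varpiX.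
Qed.

(** * Levels of the chain *)

Definition level (i : nat) : set W :=
  chain i `\` (if i is i'.+1 then chain i' else set0).

Lemma level0 : level 0 = A.
Proof.
rewrite /level setD0; apply/funext => w.
by rewrite -(muln0 3) chain0 expr0 scale1r.
Qed.

Lemma level_ex w : exists i, level i w.
Proof.
have exP : exists i, `[< chain i w >].
  by have [i hi] := chain_exhaust w; exists i; apply/asboolP.
have [i /asboolP hi imin] := ex_minnP exP; exists i; split=> //.
case: i imin {hi} => [|i] imin; first by [].
by move=> /asboolP /imin; rewrite ltnn.
Qed.

Lemma level_inj i j w : level i w -> level j w -> i = j.
Proof.
have half (a b : nat) : level a w -> level b w -> (a <= b)%N.
  move=> [_ ha] [hb _]; rewrite leqNgt; apply/negP => lt.
  by case: a ha lt => // a ha lt; apply: ha; apply: chain_le hb.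
by move=> hi hj; apply/eqP; rewrite eqn_leq !half.
Qed.

Lemma level_A i a w : A a -> level i (a + w) <-> level i w.
Proof.
move=> Aa; have c j : chain j (a + w) <-> chain j w.
  by apply: omoduleDl; [exact: chain_omod|exact: A_chain].
by case: i => [|i]; rewrite /level /setD /= ?c.
Qed.

Lemma omoduleNE (X : set W) w : omodule X -> X (- w) <-> X w.
Proof. by move=> mX; split=> /(omoduleN mX); rewrite ?opprK. Qed.

Lemma level_N i w : level i (- w) <-> level i w.
Proof.
have c j : chain j (- w) <-> chain j w by apply: omoduleNE; exact: chain_omod.
by case: i => [|i]; rewrite /level /setD /= ?c.
Qed.

Lemma level_P_B i g w : P_B beta A B g -> level i (g *m w) <-> level i w.
Proof.
move=> hg; have c j : chain j (g *m w) <-> chain j w by apply: chain_P_B.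
by case: i => [|i]; rewrite /level /setD /= ?c.
Qed.

Lemma level_notA i w : (0 < i)%N -> level i w -> ~ A w.
Proof. by case: i => // i _ [_ h] Aw; apply: h; exact: A_chain. Qed.

(** Scaling by powers of [varpi] commutes with [P_B] and reduces every level above 0 to [trans_A],
    [trans_Bs] or [trans_B]. Level 0 is [A] itself, where transitivity holds only modulo [A],
    already by the identity. *)
Lemma level_trans i v v' : level i v -> level i v' ->
  exists2 g, P_B beta A B g & A (g *m v - v').
Proof.
have fin c u u' : c != 0 ->
    (exists2 g, P_B beta A B g & g *m (c *: u) = c *: u') ->
    exists2 g, P_B beta A B g & A (g *m u - u').
  move=> c0 [g hg]; rewrite -scalemxAr => /(can_inj (scalerK c0)) e.
  by exists g => //; rewrite e subrr; have [] := A_omod.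
move: i; apply: chain_ind => m.
- case: m => [|m].
    rewrite muln0 level0 => Av Av'; exists 1%:M; first exact: P_B1.
    by rewrite mul1mx; apply: omoduleB => //; exact: A_omod.
  rewrite mulnSr /level /setD /= !addn3 /=.
  rewrite !chain2 -addn3 -mulnSr !chain0 => -[a b] [a' b'].
  by apply: (fin _ _ _ (varpiX_neq0 m.+1)); exact: trans_A.
- rewrite /level /setD /= !chain1 !chain0 => -[a b] [a' b'].
  by apply: (fin _ _ _ (varpiX_neq0 m)); exact: trans_Bs.
- rewrite /level /setD /= !chain2 !chain1 => -[a b] [a' b'].
  apply: (fin _ _ _ (varpiX_neq0 m.+1)); apply: trans_B => //.
    by rewrite scalerA exprS mulKf // varpi_neq0.
  by rewrite scalerA exprS mulKf // varpi_neq0.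
Qed.

(** The position of E_{m,j} along the chain; [j2] precedes [j1] because B^* comes before varpi^-1
    B. *)
Definition rank (m : nat) (j : layer_index) : nat :=
  match j with j0 => 3 * m | j1 => (3 * m).+2 | j2 => (3 * m).+1 end.

Lemma rank_inj m j m' j' : rank m j = rank m' j' -> m = m' /\ j = j'.
Proof. by case: j; case: j' => /= e; split=> //; lia. Qed.

Lemma scale_setVE c (X : set W) w : c != 0 -> scale_set c^-1 X w <-> X (c *: w).
Proof.
move=> c0; split=> [[x Xx <-]|h]; first by rewrite scalerA divff // scale1r.
by exists (c *: w) => //; rewrite scalerA mulVf // scale1r.
Qed.

Lemma layerE m j : (0 < rank m j)%N ->
  layer varpi lambda beta A B m j = level (rank m j).
Proof.
move=> r0; apply/seteqP.
suff e w : layer varpi lambda beta A B m j w <-> level (rank m j) w by split=> w /e.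
case: j r0 => /=.
- case: m => // m _;
  rewrite mulnSr addn3 /level /setD /= chain2 -addn3 -mulnSr chain0.
  by rewrite !scale_setVE ?varpiX_neq0.
- by rewrite /level /setD /= chain2 chain1 !scale_setVE ?varpiX_neq0.
- by rewrite /level /setD /= chain1 chain0 !scale_setVE ?varpiX_neq0.
Qed.

Lemma scaled_notsubset c (X Y : set W) : c != 0 ->
  (exists w, X (c *: w) /\ ~ Y (c *: w)) <-> ~ (X `<=` Y).
Proof.
move=> c0; split=> [[w [Xw nY]] h|h]; first exact/nY/h.
apply: contrapT => ne; apply: h => x Xx; apply: contrapT => nY; apply: ne.
by exists (c^-1 *: x); rewrite scalerA divff // scale1r.
Qed.

Lemma level_nonempty_j0 l m : quot_dim Bs B (2 * l) ->
  (exists w, level (rank m.+1 j0) w) <-> (0 < l)%N.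
Proof.
move=> /AB_gt0 ->; rewrite -(scaled_notsubset _ _ (varpiX_neq0 m.+1)) /=.
rewrite mulnSr addn3.
by split=> -[w hw]; exists w; move: hw;
  rewrite /level /setD /= chain2 -addn3 -mulnSr chain0.
Qed.

Lemma level_nonempty_j2 l m : quot_dim Bs B (2 * l) ->
  (exists w, level (rank m j2) w) <-> (0 < l)%N.
Proof.
move=> /BsA_gt0 ->; rewrite -(scaled_notsubset _ _ (varpiX_neq0 m)) /=.
by split=> -[w hw]; exists w; move: hw; rewrite /level /setD /= chain1 chain0.
Qed.

Lemma level_nonempty_j1 l m : quot_dim Bs B (2 * l) ->
  (exists w, level (rank m j1) w) <-> (2 * l < n)%N.
Proof.
move=> /B_lt ->; rewrite -(scaled_notsubset _ _ (varpiX_neq0 m.+1)) /=.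
have e (w : W) : scale_set varpi Bs (varpi ^+ m.+1 *: w) <-> Bs (varpi ^+ m *: w).
  rewrite -{1}(invrK varpi) scale_setVE ?invr_eq0 ?varpi_neq0 //.
  by rewrite scalerA exprS mulKf // varpi_neq0.
split=> -[w hw]; exists w; move: hw; rewrite /level /setD /= chain2 chain1.
  by rewrite e.
by rewrite e.
Qed.

(** * Separation of cosets of A by transvections *)

Section Separation.
Variables (R : realType) (psi : k -> R[i]).
Hypothesis psi_char : unitary_character psi.
Hypothesis psi_cond : has_conductor varpi psi lambda.

Lemma psiD x y : psi (x + y) = psi x * psi y.
Proof. by have [h _ _] := psi_char. Qed.

Lemma psi_ideal x : ideal lambda x -> psi x = 1.
Proof. by have [h _] := psi_cond; rewrite -(frac_idealE _ (set_unif H));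
  exact: h. Qed.

Lemma psi0 : psi 0 = 1. Proof. by apply: psi_ideal; exact: ideal0. Qed.

Lemma psi_neq0 x : psi x != 0.
Proof. by have [_ h _] := psi_char; rewrite -normr_eq0 h oner_neq0. Qed.

Lemma psiN x : psi (- x) = (psi x)^-1.
Proof.
by apply: (mulIf (psi_neq0 x)); rewrite mulVf ?psi_neq0 // -psiD addNr psi0.
Qed.

Lemma separation v v' : ~ A (v - v') -> ~ A (v + v') ->
  exists h, [/\ P_v beta A B v h, P_v beta A B v' h & chi_v psi beta v h <> chi_v
    psi beta v' h].
Proof.
move=> nx ny; have [two0 two1] := two_unit (set_char2 H).
have ex x : ~ A x -> exists2 u, A u & ~ ideal lambda (beta x u).
  move=> nA; apply: contrapT => h; apply: nA; apply/AP => a Aa.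
  by apply: contrapT => na; apply: h; exists a.
have [u [Au /idealPn [x0 xl] /idealPn [y0 yl]]] :=
  avoid_two A_omod (ex _ nx) (ex _ ny).
have [e [he psie]] : exists e, ideal (lambda - 1) e /\ psi e <> 1.
  have [_ [e]] := psi_cond; rewrite (frac_idealE _ (set_unif H)) => he pe.
  by exists e.
set X := beta (v - v') u in x0 xl; set Y := beta (v + v') u in y0 yl.
(* With this [t], chi_v / chi_v' takes on the transvection the value psi(- t X Y / 2) = psi(- e),
   which is not 1. *)
pose t := 2 * e / (X * Y).
have O2 : ideal 0 (2 : k) by right; rewrite two1.
(* [X] and [Y] have valuation at most [lambda - 1] and [e] at least that, so [e / X] and [e / Y] are
   integral. As 2 is a unit, the displacements of [v] and [v'] are then integral multiples of
   [u]. *)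
have Oe z : z != 0 -> nav z < lambda -> ideal 0 (e / z).
  move=> z0 zl; apply: (idealV z0 erefl); apply: ideal_le he; lia.
have tX : ideal 0 (t * X).
  have -> : t * X = 2 * (e / Y) by rewrite /t; field; rewrite x0 y0.
  by apply: idealMl => //; exact: Oe.
have tY : ideal 0 (t * Y).
  have -> : t * Y = 2 * (e / X) by rewrite /t; field; rewrite x0 y0.
  by apply: idealMl => //; exact: Oe.
have tl : ideal (1 - lambda) t.
  have -> : t = t * X / X by field.
  rewrite -[1 - lambda]add0r; apply: idealM => //.
  by right; rewrite navV //; lia.
have tv : ideal 0 (t * beta v u).
  have -> : t * beta v u = 2^-1 * (t * X + t * Y).
    by rewrite /X /Y !bE; field.
  by apply: (ideal_half (set_char2 H)); exact: idealD.
have tv' : ideal 0 (t * beta v' u).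
  have -> : t * beta v' u = 2^-1 * (t * Y - t * X).
    by rewrite /X /Y !bE; field.
  by apply: (ideal_half (set_char2 H)); exact: idealB.
(* The transvection moves [A] by multiples of [u] with coefficients in varpi O, so by vectors of
   [B]; both lattices are preserved. *)
have tA t' w : ideal (1 - lambda) t' -> A w -> ideal 1 (t' * beta w u).
  move=> ht hw; rewrite -(subrK lambda 1); apply: idealM => //.
  exact: betaAA.
have mA t' w : ideal (1 - lambda) t' -> A w -> A (transvection beta t' u w).
  move=> ht hw; have [_ D _] := A_omod; apply: D => //; apply: BA.
  by apply: scale_BsB; [exact: tA|exact: ABs].
have mB t' w : ideal (1 - lambda) t' -> B w -> B (transvection beta t' u w).
  move=> ht hw; have [_ D _] := B_omod; apply: D => //.
  by apply: scale_BsB; [apply: tA => //; exact: BA|exact: ABs].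
have ltr := transvection_linear (set_sympl H) t u.
have hP : P_B beta A B (colmx (transvection beta t u)).
  apply: (P_B_colmx (f' := transvection beta (- t) u)) => //.
  - by move=> *; apply: transvection_Sp (set_sympl H) _ _ _ _.
  - by move=> w; rewrite -{1}(opprK t); apply: transvectionK (set_sympl H) _ _ _.
  - by move=> w; apply: mA.
  - by move=> w; apply: mB.
  - by move=> w; apply: mA; exact: idealN.
  - by move=> w; apply: mB; exact: idealN.
exists (colmx (transvection beta t u)); split.
- split=> //; rewrite colmxE // /transvection addrC addKr.
  exact: (omoduleZ A_omod).
- split=> //; rewrite colmxE // /transvection addrC addKr.
  exact: (omoduleZ A_omod).
rewrite /chi_v !colmxE // /transvection !bE !add0r => E.
apply: psie; have -> : e = 2^-1 * (t * beta v' u * beta u v')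
    - 2^-1 * (t * beta v u * beta u v).
  rewrite (bC u v) (bC u v') /t /X /Y !bE; field.
  by rewrite two0 /=; move: x0 y0; rewrite /X /Y !bE => -> ->.
by rewrite psiD psiN E divff // psi_neq0.
Qed.

End Separation.

End Geometry.

(** * Finite covers and square-summable functions *)

Section FiniteCover.
Variable k : naLocalFieldType.

(** The residue field is finite: each step splits a ball according to the next digit of the
    expansion in powers of a uniformizer. *)
Lemma ideal_cover M (d : nat) : exists s : seq k,
  forall x, ideal M x -> exists2 y, y \in s & ideal (M + d%:Z) (x - y).
Proof.
elim: d => [|d [s hs]].
  exists [:: 0] => x hx; exists 0; first exact: mem_head.
  by rewrite !subr0.
have [p [p0 p1]] : exists p : k, uniformizer p by exact: nav_surj.
pose lift (a : residue k) : k := s2val (cid2 (red_surj a)).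
have lift0 a : ideal 0 (lift a) by exact: s2valP.
have liftK a : red (lift a) = a by exact: (s2valP' (cid2 (red_surj a))).
pose q := p ^ (M + d%:Z); have q0 : q != 0 by rewrite expfz_neq0.
have qN : nav q = M + d%:Z by rewrite navXz // p1 mul1r.
exists [seq y + q * lift a | y <- s, a <- enum (residue k)] => x /hs [y ys hy].
have hz := idealV q0 qN hy; set z := _ / q in hz.
exists (y + q * lift (red z)); first by apply: allpairs_f => //; rewrite mem_enum.
have -> : x - (y + q * lift (red z)) = q * (z - lift (red z)).
  by rewrite /z mulrBr mulrCA divff // mulr1 opprD addrA.
rewrite -addn1 PoszD addrA; apply: idealM; first by right; rewrite qN.
apply/red_ker; first exact: idealB.
by rewrite redB // liftK subrr.
Qed.

Lemma ball_cover n M N : exists s : seq 'cV[k]_n,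
  forall x, ball_mx M x -> exists2 y, y \in s & ball_mx N (x - y).
Proof.
have [s hs] := ideal_cover M (absz (N - M)%R).
pose vec (f : {ffun 'I_n -> 'I_(size s)}) : 'cV[k]_n := \col_i s`_(f i).
exists [seq vec f | f <- enum {: {ffun 'I_n -> 'I_(size s)}}] => x hx.
have h i := cid2 (hs _ (hx i 0)).
have lt i : (index (s2val (h i)) s < size s)%N by rewrite index_mem (s2valP (h i)).
exists (vec [ffun i => Ordinal (lt i)]); first by apply: map_f; rewrite mem_enum.
move=> i j; rewrite ord1 !mxE ffunE nth_index ?(s2valP (h i)) //.
by apply: ideal_le (s2valP' (h i)); lia.
Qed.

End FiniteCover.

Section Transversal.
Variables (T : choiceType) (x0 : T) (D : set T) (e : T -> T -> Prop).
Hypothesis e_refl : forall x, D x -> e x x.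
Hypothesis e_sym : forall x y, D x -> D y -> e x y -> e y x.
Hypothesis e_trans : forall x y z, D x -> D y -> D z -> e x y -> e y z -> e x z.

Let rep x := xget x0 [set y | D y /\ e x y].

Let repP x : D x -> D (rep x) /\ e x (rep x).
Proof. by move=> Dx; apply: (@xgetPex _ x0 [set y | D y /\ e x y]); exists x;
  split=> //; exact: e_refl. Qed.

Lemma coset_rep_sub : Defs.transversal x0 D e `<=` D.
Proof. by move=> _ [x Dx <-]; have [] := repP Dx. Qed.

Lemma coset_rep_ex x : D x -> exists2 t, Defs.transversal x0 D e t & e x t.
Proof. by move=> Dx; exists (rep x); [exists x|have [] := repP Dx]. Qed.

Lemma coset_rep_inj t t' : Defs.transversal x0 D e t ->
  Defs.transversal x0 D e t' ->
  e t t' -> t = t'.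
Proof.
move=> [x Dx <-] [x' Dx' <-]; rewrite -/(rep x) -/(rep x') => h.
have [Dr er] := repP Dx; have [Dr' er'] := repP Dx'.
have xx' : e x x'.
  by apply: e_trans (er) _ => //; apply: e_trans h _ => //; exact: e_sym.
(* Equivalent points have the same class as a set, so [xget] picks the same element. *)
congr (xget x0 _); apply/seteqP; split=> y [Dy ey]; split=> //.
  by apply: e_trans ey => //; exact: e_sym.
exact: e_trans ey.
Qed.

End Transversal.

Section Sums.
Variables (R : realType) (T : choiceType).
Local Notation C := R[i].
Implicit Types (D : set T) (s : seq T) (f g : T -> C) (z : C).

Definition sqn (z : C) : R := complex.Re z ^+ 2 + complex.Im z ^+ 2.

Lemma sqn_ge0 z : 0 <= sqn z. Proof. by rewrite addr_ge0 // sqr_ge0. Qed.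

Lemma Re_normsq z : complex.Re (`|z| ^+ 2) = sqn z.
Proof. by rewrite -add_Re2_Im2. Qed.

Lemma mul_conjc z : z * conjc z = (sqn z)%:C%C.
Proof.
case: z => a b; apply/eqP; rewrite eq_complex /sqn /=; apply/andP; split;
  apply/eqP; ring.
Qed.

Lemma conjcM z z' : conjc (z * z') = conjc z * conjc z'.
Proof. exact: rmorphM. Qed.

Lemma sqn_eq0 z : sqn z = 0 -> z = 0.
Proof.
move=> h; apply/eqP; rewrite -[z == 0]orbb -{2}(conjc_eq0 z) -mulf_eq0 mul_conjc h.
by rewrite eqxx.
Qed.

(* The conjugation in [l2_form] is that of [numClosedFieldType]. *)
Lemma l2_formE D f g : l2_form D f g = complex_sum D (fun x => f x * conjc (g x)).
Proof. by []. Qed.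

Lemma esum_seq D s (a : T -> R) : uniq s -> (forall x, x \in s -> D x) ->
  (forall x, 0 <= a x) -> (forall x, D x -> a x != 0 -> x \in s) ->
  (\esum_(x in D) (a x)%:E = (\sum_(x <- s) a x)%:E)%E.
Proof.
move=> us sD a0 supp.
have -> : (\esum_(x in D) (a x)%:E = \esum_(x in [set` s]) (a x)%:E)%E.
  rewrite [LHS]esum_mkcond [RHS]esum_mkcond; apply: eq_esum => x _.
  case: (boolP (x \in s)) => xs; first by rewrite !mem_set //; exact: sD.
  rewrite [x \in [set` s]]memNset; last exact/negP.
  case: ifPn => //; rewrite inE => Dx; congr EFin.
  by apply/eqP; apply: contraNT xs => /(supp _ Dx).
rewrite esum_fset //; last by move=> x _; rewrite lee_fin.
by rewrite fsumEFin // -fsbig_seq.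
Qed.

Lemma real_sum_seq D s (a : T -> R) : uniq s -> (forall x, x \in s -> D x) ->
  (forall x, D x -> a x != 0 -> x \in s) -> real_sum D a = \sum_(x <- s) a x.
Proof.
move=> us sD supp; rewrite /real_sum !(@esum_seq _ s) //=.
- rewrite -sumrB; apply: eq_bigr => x _; rewrite !maxEle oppr_le0.
  by case: (leP (a x) 0) => h; case: leP => h'; lra.
- by move=> x; rewrite le_max lexx orbT.
- move=> x Dx h; apply: supp => //; apply: contraNneq h => ->.
  by rewrite oppr0 maxxx.
- by move=> x; rewrite le_max lexx orbT.
- move=> x Dx h; apply: supp => //; apply: contraNneq h => ->.
  by rewrite maxxx.
Qed.

Lemma complex_sum_seq D s f : uniq s -> (forall x, x \in s -> D x) ->
  (forall x, D x -> f x != 0 -> x \in s) -> complex_sum D f = \sum_(x <- s) f x.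
Proof.
move=> us sD supp; rewrite /complex_sum !(@real_sum_seq _ s) //.
- elim: s {us sD supp} => [|x s IH]; first by rewrite !big_nil.
  rewrite !big_cons -IH; apply/eqP; rewrite eq_complex /=.
  by case: (f x) => a b /=; rewrite !eqxx.
- by move=> x Dx h; apply: supp => //; apply: contraNneq h => ->.
- by move=> x Dx h; apply: supp => //; apply: contraNneq h => ->.
Qed.

Lemma square_summable_seq D s f : (forall x, D x -> f x != 0 -> x \in s) ->
  square_summable D f.
Proof.
move=> supp; pose s' := [seq x <- undup s | `[< D x >]].
rewrite /square_summable (@esum_seq _ s') ?ltry //.
- by rewrite filter_uniq // undup_uniq.
- by move=> x; rewrite mem_filter => /andP [/asboolP].
- by move=> x; rewrite Re_normsq sqn_ge0.
- move=> x Dx h; rewrite mem_filter mem_undup supp // ?andbT; first exact/asboolP.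
  by apply: contraNneq h => ->; rewrite normr0 expr0n.
Qed.

Lemma l2_form_diag D f :
  l2_form D f f = (fine (\esum_(x in D) (sqn (f x))%:E)%E)%:C%C.
Proof.
rewrite /l2_form /complex_sum /real_sum.
have e x : f x * conjc (f x) = (sqn (f x))%:C%C by exact: mul_conjc.
have -> : (\esum_(x in D) (Num.max (complex.Re (f x * conjc (f x))) 0)%:E
    = \esum_(x in D) (sqn (f x))%:E)%E.
  by apply: eq_esum => x _; rewrite e /= max_l // sqn_ge0.
have -> : (\esum_(x in D) (Num.max (- complex.Re (f x * conjc (f x))) 0)%:E = 0)%E.
  by apply: esum1 => x _; rewrite e /= max_r // oppr_le0 sqn_ge0.
have -> : (\esum_(x in D) (Num.max (complex.Im (f x * conjc (f x))) 0)%:E = 0)%E.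
  by apply: esum1 => x _; rewrite e /= maxxx.
have -> : (\esum_(x in D) (Num.max (- complex.Im (f x * conjc (f x))) 0)%:E = 0)%E.
  by apply: esum1 => x _; rewrite e /= oppr0 maxxx.
by rewrite /= !subr0.
Qed.

Lemma square_summable_sqn D f :
  square_summable D f <-> (\esum_(x in D) (sqn (f x))%:E < +oo)%E.
Proof.
rewrite /square_summable (_ : (fun x => _) = (fun x => (sqn (f x))%:E)) //.
by apply/funext => x; rewrite Re_normsq.
Qed.

Lemma l2_form_neq0 D f x : square_summable D f -> D x -> f x != 0 ->
  l2_form D f f != 0.
Proof.
move=> /square_summable_sqn hf Dx fx; rewrite l2_form_diag.
have ge : ((sqn (f x))%:E <= \esum_(y in D) (sqn (f y))%:E)%E.
  apply: esum_ge; exists [set x]; first by split=> // _ ->.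
  by rewrite fsbig_set1.
have pos : 0 < sqn (f x).
  by rewrite lt_neqAle sqn_ge0 andbT eq_sym; apply: contraNneq fx => /sqn_eq0 ->.
apply/eqP => /(congr1 (@complex.Re R)) /= e.
have fin : (\esum_(y in D) (sqn (f y))%:E \is a fin_num)%E.
  by rewrite ge0_fin_numE //; apply: esum_ge0 => y _; rewrite lee_fin sqn_ge0.
by move: ge; rewrite -(fineK fin) e lee_fin leNgt pos.
Qed.

Lemma l2_form0 D : l2_form D (fun=> 0 : C) (fun=> 0) = 0.
Proof.
rewrite l2_form_diag esum1 //= => x _; by rewrite /sqn /= expr0n addr0.
Qed.

Lemma square_summableD D f g (a : C) : square_summable D f -> square_summable D g ->
  square_summable D (fun x => a * f x + g x).
Proof.
move=> /square_summable_sqn hf /square_summable_sqn hg; apply/square_summable_sqn.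
pose c := 2 * sqn a.
have h x : sqn (a * f x + g x) <= c * sqn (f x) + 2 * sqn (g x).
  rewrite {}/c /sqn; case: a (f x) (g x) => a1 a2 [f1 f2] [g1 g2] /=.
  (* The two squares are those of the real and imaginary parts of a f - g: this is the parallelogram
     identity with |a f - g|^2 dropped. *)
  have := sqr_ge0 (a1 * f1 - a2 * f2 - g1);
    have := sqr_ge0 (a1 * f2 + a2 * f1 - g2).
  nra.
have c0 : 0 <= c by rewrite mulr_ge0 // sqn_ge0.
have Z (b : R) (u : T -> C) : 0 <= b -> (\esum_(x in D) (sqn (u x))%:E < +oo)%E ->
    (\esum_(x in D) (b * sqn (u x))%:E < +oo)%E.
  move=> b0 hu; apply: (@le_lt_trans _ _ (b%:E * \esum_(x in D) (sqn (u x))%:E)%E).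
    apply: ge_ereal_sup => _ [X [fX XD] <-].
    under eq_fsbigr do rewrite EFinM.
    rewrite -ge0_mule_fsumr; last by move=> x; rewrite lee_fin sqn_ge0.
    by apply: lee_wpmul2l; [rewrite lee_fin|apply: ereal_sup_ubound; exists X].
  by apply: lte_mul_pinfty => //; rewrite ?lee_fin.
apply: (@le_lt_trans _ _ (\esum_(x in D) (c * sqn (f x))%:E
    + \esum_(x in D) (2 * sqn (g x))%:E)%E); last first.
  by apply: lte_add_pinfty; apply: Z.
rewrite -esumD.
- by apply: le_esum => x _; rewrite -EFinD lee_fin.
- by move=> x _; rewrite lee_fin mulr_ge0 // sqn_ge0.
- by move=> x _; rewrite lee_fin mulr_ge0 // sqn_ge0.
Qed.

Lemma dist2_l2 D f g :
  dist2 (l2_form D) f g = fine (\esum_(x in D) (sqn (f x - g x))%:E)%E.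
Proof. by rewrite /dist2 (l2_form_diag D (fun x => f x - g x)). Qed.

Lemma dist2_ge D f g x : square_summable D f -> square_summable D g -> D x ->
  sqn (f x - g x) <= dist2 (l2_form D) f g.
Proof.
move=> hf hg Dx; rewrite dist2_l2.
have : square_summable D (fun y => f y - g y).
  have := square_summableD (-1) hg hf; congr (square_summable D).
  by apply/funext => y; rewrite mulN1r addrC.
move=> /square_summable_sqn fin.
have ge : ((sqn (f x - g x))%:E <= \esum_(y in D) (sqn (f y - g y))%:E)%E.
  apply: esum_ge; exists [set x]; first by split=> // _ ->.
  by rewrite fsbig_set1.
rewrite -lee_fin fineK // ge0_fin_numE //.
by apply: esum_ge0 => y _; rewrite lee_fin sqn_ge0.
Qed.

Lemma l2_form_disjoint D f g : (forall x, D x -> f x = 0 \/ g x = 0) ->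
  l2_form D f g = 0.
Proof.
move=> h; rewrite l2_formE (@complex_sum_seq _ [::]) ?big_nil // => x Dx.
by case: (h x Dx) => ->; rewrite ?conjc0 ?mulr0 ?mul0r eqxx.
Qed.

(** A finite set [X] carries the sum of |f|^2 up to [e]; keeping the finitely many fibres of [lv]
    that meet [X] therefore loses less than [e]. *)
Lemma dist2_fibres D f (lv : T -> nat) (e : R) : square_summable D f -> 0 < e ->
  exists2 s : seq nat, uniq s &
    dist2 (l2_form D) f (fun x => if lv x \in s then f x else 0) < e.
Proof.
move=> /square_summable_sqn hf e0; pose F x : \bar R := (sqn (f x))%:E.
have F0 x : (0 <= F x)%E by rewrite lee_fin sqn_ge0.
have fin D' : D' `<=` D -> (\esum_(x in D') F x \is a fin_num)%E.
  move=> DD; rewrite ge0_fin_numE; last by apply: esum_ge0.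
  apply: le_lt_trans hf; rewrite esum_mkcond [leRHS]esum_mkcond.
  apply: le_esum => x _; case: ifPn => [/set_mem/DD/mem_set ->//|_].
  by case: ifP => // _; exact: F0.
have [y [X [finX XD] <-] hX] : exists2 y, [set \sum_(x \in X) F x | X in fsets D]%E
  y
    & (\esum_(x in D) F x - e%:E < y)%E.
  by apply: ereal_sup_gt; rewrite -/(esum D F) lteBlDr ?lteDl ?lte_fin ?fin // .
have /finite_seqP [r Xr] := finX.
pose s := undup [seq lv x | x <- r]; exists s; first exact: undup_uniq.
pose U := [set x | lv x \in s].
have XU : X `<=` D `&` U.
  move=> x Xx; split; first exact: XD.
  by rewrite /U /= mem_undup; apply: map_f; move: Xx; rewrite Xr.
have aX : (\sum_(x \in X) F x <= \esum_(x in D `&` U) F x)%E.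
  by apply: esum_ge; exists X.
have -> : dist2 (l2_form D) f (fun x => if lv x \in s then f x else 0)
    = fine (\esum_(x in D `&` ~` U) F x)%E.
  rewrite dist2_l2 esum_mkcondr; congr fine; apply: eq_esum => x _.
  case: (boolP (lv x \in s)) => h.
    rewrite memNset; last by move=> /(_ h).
    by rewrite subrr /sqn /= expr0n addr0.
  by rewrite mem_set ?subr0 // => h'; rewrite h' in h.
have fa := fin _ (@subIsetl _ D U); have fb := fin _ (@subIsetl _ D (~` U)).
have := lt_le_trans hX aX; rewrite (@esumID _ _ U) //.
rewrite -(fineK fa) -(fineK fb) -EFinN -!EFinD lte_fin; lra.
Qed.

End Sums.

(** * The lattice model *)

Section Model.
Variables (R : realType) (k : naLocalFieldType) (n : nat) (varpi : k) (lambda :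
  int).
Local Notation C := R[i].
Local Notation W := 'cV[k]_n.
Variables (psi : k -> C) (beta : W -> W -> k) (A B : set W).
Local Notation Bs := (dual_lattice beta varpi lambda B).
Local Notation G := (P_B beta A B).
Local Notation level := (level varpi lambda beta A B).
Hypothesis H : lattice_setting varpi lambda beta A B.
Hypothesis psi_char : unitary_character psi.
Hypothesis psi_cond : has_conductor varpi psi lambda.
Implicit Types (u v w a : W) (g h : 'M[k]_n) (f : W -> C).

Let bE := betaE (set_sympl H).
Let bC := betaC (set_sympl H).
Let mA := A_omod H.
Let psiI := psi_ideal H psi_cond.
Let psi_n0 := psi_neq0 psi_char.

Lemma psi_eq x y : ideal lambda (x - y) -> psi x = psi y.
Proof. by move=> /psiI h; rewrite -(subrK y x) (psiD psi_char) h mul1r. Qed.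

Lemma A0 : A 0. Proof. by have [] := mA. Qed.

Lemma A_sym u v : A (u - v) <-> A (v - u).
Proof. by rewrite -opprB; exact: omoduleNE. Qed.

Lemma A_tri u v w : A (u - v) -> A (v - w) -> A (u - w).
Proof. by move=> h1 h2; rewrite -(subrKA v); have [_ D _] := mA; exact: D. Qed.

Lemma A_double v : A (v + v) -> A v.
Proof.
have [two0 two1] := two_unit (set_char2 H).
move=> h; rewrite (_ : v = 2^-1 *: (v + v)); last first.
  by rewrite -mulr2n -scaler_nat scalerA mulVf // scale1r.
by apply: (omoduleZ mA) => //; right; rewrite navV // two1.
Qed.

Lemma cosets_rep w : exists2 t, cosets A t & A (t - w).
Proof.
apply: (@coset_rep_ex _ 0 setT (fun x y : W => A (y - x))) => //.
by move=> x _; rewrite subrr; exact: A0.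
Qed.

Lemma cosets_inj t t' : cosets A t -> cosets A t' -> A (t - t') -> t = t'.
Proof.
move=> ht ht' /A_sym; apply: coset_rep_inj ht ht' => //.
- by move=> x _; rewrite subrr; exact: A0.
- by move=> x y _ _ /A_sym.
- by move=> x y z _ _ _ h1 h2; exact: A_tri h2 h1.
Qed.

(** * Functions supported on one level *)

Lemma level_cover i N : exists s : seq W,
  forall w, level i w -> exists2 x, x \in s & ball_mx N (w - x).
Proof.
have [M hM] := chain_bounded H i; have [s hs] := ball_cover k n M N.
by exists s => w [/hM /hs].
Qed.

Lemma level_coverA i : exists s : seq W,
  forall w, level i w -> exists2 x, x \in s & A (w - x).
Proof.
have [N hN] := A_ball H; have [s hs] := level_cover i N.
by exists s => w /hs [x xs /hN]; exists x.
Qed.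

Definition equivariant f :=
  forall a w, A a -> f (a + w) = psi (2^-1 * beta w a) * f w.

Lemma equivariant_neq0 f w w' : equivariant f -> A (w - w') -> f w != 0 ->
  f w' != 0.
Proof.
by move=> ef h; rewrite -{1}(subrK w' w) ef // mulf_eq0 negb_or => /andP [].
Qed.

(** A level is bounded, so it meets finitely many cosets of [A], and square-summability is
    automatic. *)
Lemma Hspace_supp i f : equivariant f -> (forall w, f w != 0 -> level i w) ->
  Hspace psi beta A f.
Proof.
move=> ef supp; split=> //; have [s hs] := level_coverA i.
have h x := cid2 (cosets_rep x).
apply: (@square_summable_seq _ _ _ [seq s2val (h x) | x <- s]) => w cw.
move=> /supp /hs [x xs Ax]; apply/mapP; exists x => //.
by apply: cosets_inj => //; [exact: (s2valP (h x))|apply: A_tri Ax _; apply/A_sym;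
  exact: (s2valP' (h x))].
Qed.

(** The spaces E_{n,j}^+ and E_{n,j}^- indexed by level and parity; square-summability comes from
    [Hspace_supp]. At [i = 0] the even space is the line of [delta0] and the odd one is zero. *)
Definition level_space (i : nat) (s : bool) : set (W -> C) :=
  [set f | [/\ equivariant f, forall w, f w != 0 -> level i w
             & forall w, f (- w) = sgn R s * f w]].

Lemma sgn2 s : sgn R s * sgn R s = 1.
Proof. by case: s; rewrite /= ?mulr1 ?mulrNN ?mulr1. Qed.

Lemma space_Hspace i s f : level_space i s f -> Hspace psi beta A f.
Proof. by move=> [ef /(Hspace_supp ef)]. Qed.

Lemma space_sub i s : fsubspace (level_space i s).
Proof.
split.
  split=> [a w _|w|w]; by rewrite ?mulr0 ?eqxx.
move=> c f g [ef sf pf] [eg sg pg]; split=> [a w Aa|w|w].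
- by rewrite ef // eg //; ring.
- have [fw|fw] := eqVneq (f w) 0; last by move=> _; exact: sf.
  by rewrite fw mulr0 add0r; exact: sg.
- by rewrite pf pg; ring.
Qed.

Lemma equivariant_M g f : G g -> equivariant f -> equivariant (M_ g f).
Proof.
move=> hg ef a w Aa; have hg' := P_BV H hg.
rewrite /M_ mulmxDr ef; last by apply/(P_B_A H _ hg').
by rewrite (P_B_Sp hg').
Qed.

Lemma space_M i s g f : G g -> level_space i s f -> level_space i s (M_ g f).
Proof.
move=> hg [ef sf pf]; have hg' := P_BV H hg; split=> [|w|w];
  first exact: equivariant_M.
- by move=> /sf /(level_P_B H _ _ hg').
- by rewrite /M_ mulmxN pf.
Qed.

Lemma invmx_mul g h : g \in unitmx -> h \in unitmx ->
  invmx (g *m h) = invmx h *m invmx g.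
Proof.
move=> ug uh; have u : g *m h \in unitmx by rewrite unitmx_mul ug.
by rewrite -[RHS](mulmxK u) mulmxA mulmxKV // mulVmx // mul1mx.
Qed.

Lemma M_M g h f : G g -> G h -> M_ (g *m h) f = M_ g (M_ h f).
Proof.
move=> /(P_B_unit H) ug /(P_B_unit H) uh; apply/funext => w; rewrite /M_ mulmxA.
by rewrite invmx_mul.
Qed.

Lemma P_v1 v : P_v beta A B v 1%:M.
Proof. by split; [exact: P_B1|rewrite mul1mx subrr; exact: A0]. Qed.

Lemma P_vM v g h : P_v beta A B v g -> P_v beta A B v h -> P_v beta A B v (g *m h).
Proof.
move=> [hg ag] [hh ah]; split; first exact: P_BM.
apply: A_tri ag; rewrite -mulmxA -mulmxBr; exact/(P_B_A H _ hg).
Qed.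

Lemma P_vV v g : P_v beta A B v g -> P_v beta A B v (invmx g).
Proof.
move=> [hg ag]; split; first exact: (P_BV H hg).
apply/(P_B_A H _ hg); rewrite mulmxBr mulKVmx ?(P_B_unit H hg) //.
exact/A_sym.
Qed.

Lemma chi_v_neq0 v h : chi_v psi beta v h != 0. Proof. exact: psi_n0. Qed.

(** As [h v - v] lies in [A], equivariance produces the factor psi(beta(v, h v) / 2), the inverse of
    chi_v(h). This is the origin of the characters chi_v. *)
Lemma equivariant_Pv f v x h : equivariant f -> G x -> P_v beta A B v h ->
  f (x *m (h *m v)) = (chi_v psi beta v h)^-1 * f (x *m v).
Proof.
move=> ef hx [hh ah].
have -> : x *m (h *m v) = x *m (h *m v - v) + x *m v by rewrite -mulmxDr subrK.
rewrite ef; last exact/(P_B_A H _ hx).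
rewrite (P_B_Sp hx) /chi_v -(psiN H psi_char psi_cond); congr (psi _ * _).
by rewrite !bE (bC v) subr0 mulrN.
Qed.

Lemma chi_vV v h : P_v beta A B v h ->
  chi_v psi beta v (invmx h) = (chi_v psi beta v h)^-1.
Proof.
move=> [hh _]; rewrite /chi_v -(psiN H psi_char psi_cond); congr (psi _).
rewrite -(P_B_Sp hh) mulKVmx ?(P_B_unit H hh) // (bC v); ring.
Qed.

Lemma M_Pv f v h : equivariant f -> P_v beta A B v h ->
  M_ h f v = chi_v psi beta v h * f v.
Proof.
move=> ef hh; have := equivariant_Pv ef (P_B1 beta A B) (P_vV hh).
by rewrite !mul1mx /M_ chi_vV // invrK.
Qed.

Definition concentrated v f := forall w, f w != 0 -> A (w - v) \/ A (w + v).

(** If [h] fixes both v + A and w + A, then [M_ h] multiplies the value at [w] by chi_w(h), but by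
    chi_v(h) according to the hypothesis. [separation] then forces f(w) = 0 unless [w] is in the
    coset of [v] or of [-v]. *)
Lemma twisted_concentrated f v : equivariant f ->
  (forall h, P_v beta A B v h -> forall w, M_ h f w = chi_v psi beta v h * f w) ->
  concentrated v f.
Proof.
move=> ef tf w fw; apply: contrapT => nA.
have n1 : ~ A (v - w) by move=> /A_sym h; apply: nA; left.
have n2 : ~ A (v + w) by rewrite addrC => h; apply: nA; right.
have [h [hv hw]] := separation H psi_char psi_cond n1 n2; apply.
by have := tf h hv w; rewrite M_Pv // => /(mulIf fw).
Qed.

Lemma concentrated_eq i s v f f' : level_space i s f -> level_space i s f' ->
  concentrated v f -> concentrated v f' -> f v = f' v -> f = f'.
Proof.
move=> [ef _ pf] [ef' _ pf'] cf cf' e; apply/funext => w.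
have [h|h] := pselect (A (w - v)); first by rewrite -(subrK v w) ef // ef' // e.
have [h'|h'] := pselect (A (w + v)).
  have -> : w = (w + v) + - v by rewrite addrK.
  by rewrite ef // ef' // pf pf' e.
have z f0 : concentrated v f0 -> f0 w = 0.
  by move=> c; apply/eqP; apply: contrapT => /negP /c [].
by rewrite !z.
Qed.

Lemma concentrated_M v h f : P_v beta A B v h -> concentrated v f ->
  concentrated v (M_ h f).
Proof.
move=> hP cf w /cf hw; have [hh ah] := hP; have u := P_B_unit H hh.
case: hw => hw; have := hw;
  rewrite -(P_B_A H _ hh) ?mulmxBr ?mulmxDr mulKVmx // => hw'.
  by left; exact: A_tri hw' ah.
right; have := omoduleB mA hw' ah.
by rewrite opprB addrACA subrr addr0.
Qed.

(** On v + A, [psi (2^-1 * beta v w)] is the value that equivariance dictates from the value 1 at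
    [v]. *)
Definition delta v w : C := if `[< A (w - v) >] then psi (2^-1 * beta v w) else 0.

Definition bump v s w : C := delta v w + sgn R s * delta v (- w).

Lemma delta_equivariant v : equivariant (delta v).
Proof.
move=> a w Aa; rewrite /delta.
have e : A (a + w - v) <-> A (w - v) by rewrite -addrA; exact: omoduleDl.
case: (pselect (A (w - v))) => h; last first.
  by rewrite !asboolF ?mulr0 // => /e.
rewrite !asboolT ?e // bE mulrDr (psiD psi_char); congr (_ * _).
have -> : 2^-1 * beta v a = 2^-1 * beta w a - 2^-1 * beta (w - v) a by rewrite !bE;
  ring.
rewrite (psiD psi_char) (psiN H psi_char psi_cond) [psi (2^-1 * beta (w - v)
  a)]psiI ?invr1 ?mulr1 //.
by apply: ideal_half; [exact: (set_char2 H)|exact: (betaAA H h Aa)].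
Qed.

Lemma bump_space i v s : level i v -> level_space i s (bump v s).
Proof.
move=> lv; split=> [a w Aa|w|w]; rewrite /bump.
- rewrite delta_equivariant // opprD delta_equivariant; last exact/omoduleNE.
  by rewrite !bE opprK; ring.
- move=> nz.
  have [h|h] := pselect (A (w - v)).
    by rewrite -(subrK v w); apply/(level_A H _ _ h).
  have [h'|h'] := pselect (A (- w - v)).
    by rewrite -(level_N H) -(subrK v (- w)); apply/(level_A H _ _ h').
  by move: nz; rewrite /delta !asboolF // mulr0 addr0 eqxx.
- by rewrite opprK mulrDr mulrA sgn2 mul1r addrC.
Qed.

Lemma bump_concentrated v s : concentrated v (bump v s).
Proof.
move=> w; rewrite /bump /delta.
have [h|h] := pselect (A (w - v)); first by left.
have [h'|h'] := pselect (A (- w - v)).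
  by right; rewrite -(omoduleNE _ mA) opprD.
by rewrite !asboolF // mulr0 addr0 eqxx.
Qed.

(** The value at [v] is 1, except when [v] is in [A]: then the cosets of [v] and [-v] coincide and
    the value is 1 + [sgn s], hence the side condition. *)
Lemma bump_neq0 v s : (A v -> s = true) -> bump v s v != 0.
Proof.
move=> hs; rewrite /bump /delta asboolT ?subrr; last exact: A0.
rewrite bE mulr0 (psi0 H psi_cond).
have [h|h] := pselect (A (- v - v));
  last by rewrite asboolF // mulr0 addr0 oner_neq0.
have /hs -> : A v by apply: A_double; rewrite -(omoduleNE _ mA) opprD.
by rewrite asboolT // !bE oppr0 mulr0 (psi0 H psi_cond) mulr1 (_ : 1 + 1 = 2%:R) //
  pnatr_eq0.
Qed.

Lemma bump_twisted i v s h : level i v -> P_v beta A B v h ->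
  forall w, M_ h (bump v s) w = chi_v psi beta v h * bump v s w.
Proof.
move=> lv hP; have sb := bump_space s lv; have [hh _] := hP.
have c0 := chi_v_neq0 v h.
suff : M_ h (bump v s) = (fun w => chi_v psi beta v h * bump v s w + 0).
  by move=> -> w; rewrite addr0.
have [Z0 ZD] := space_sub i s.
apply: (@concentrated_eq i s v).
- exact: space_M.
- exact: ZD.
- by apply: concentrated_M => //; exact: bump_concentrated.
- move=> w; rewrite addr0 mulf_eq0 negb_or => /andP [_]; exact: bump_concentrated.
- by rewrite M_Pv ?addr0 //; case: sb.
Qed.

(** On its level, [f] is constant on cosets of K = varpi^i A, because varpi^i carries the level into
    [A]. There are finitely many such cosets, and [M_ h f] depends only on how the inverse of [h]
    moves them. *)
Lemma M_orbit_finite i f : equivariant f -> (forall w, f w != 0 -> level i w) ->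
  finite_set [set M_ h f | h in G].
Proof.
move=> ef sf; pose c := varpi ^+ i.
have c0 : c != 0 by exact: varpiX_neq0 H i.
have ic : ideal 0 c by right; rewrite (nav_varpiX H).
(* [varpi ^+ i A] is a group of periods of [f] *)
pose K : set W := [set u | A (c^-1 *: u)].
have KA u : K u -> A u.
  by move=> /(omoduleZ mA ic); rewrite scalerA divff // scale1r.
have KG g u : G g -> K (g *m u) <-> K u.
  by move=> hg; rewrite /K /= scalemxAr; exact: (P_B_A H _ hg).
have Kf w u : level i w -> K u -> f (u + w) = f w.
  move=> [cw _] Ku; rewrite ef; last exact: KA.
  rewrite psiI ?mul1r //; apply: (ideal_half (set_char2 H)).
  have -> : beta w u = beta (c *: w) (c^-1 *: u) by rewrite !bE mulrCA mulKf.
  apply: (betaAA H) => //; rewrite -(chain0 varpi lambda beta A B).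
  by apply: (chain_le H) cw; lia.
have Ksub u u' : K u -> K u' -> K (u - u').
  by rewrite /K /= scalerBr; exact: omoduleB.
have [N hN] := A_ball H.
have [s hs] : exists s : seq W, forall w, level i w ->
  exists2 x, x \in s & K (w - x).
  have [s hs] := level_cover i (i%:Z + N); exists s => w /hs [x xs bx].
  exists x => //; apply: hN => a b; rewrite mxE -(addKr i%:Z N); apply: idealM.
    by right; rewrite navV // (nav_varpiX H).
  exact: (bx a b).
pose cls w := find (fun x => `[< K (w - x) >]) s.
have clsP w w' : level i w -> cls w = cls w' -> K (w - w').
  move=> lw e; have hw : has (fun x => `[< K (w - x) >]) s.
    by have [x xs Kx] := hs w lw; apply/hasP; exists x => //; apply/asboolP.
  have hw' : has (fun x =>
    `[< K (w' - x) >]) s by rewrite has_find -[find _ s]/(cls w') -e -has_find.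
  have /asboolP := nth_find 0 hw; have /asboolP := nth_find 0 hw'.
  rewrite -/(cls w) -/(cls w') -e => h1 h2.
  by have := Ksub _ _ h2 h1; rewrite opprB subrKA.
have clsS w : (cls w < (size s).+1)%N by rewrite ltnS find_size.
(* [code h] records the class of h^-1 x for each representative [x]; the extra value [size s] is
   what [find] returns for a vector in no class. *)
pose code h : {ffun 'I_(size s) -> 'I_(size s).+1} :=
  [ffun j : 'I_(size s) => Ordinal (clsS (invmx h *m s`_j))].
have codeP h h' : G h -> G h' -> code h = code h' -> M_ h f = M_ h' f.
  move=> hh hh' e; apply/funext => w; rewrite /M_.
  have hhV := P_BV H hh; have hhV' := P_BV H hh'.
  have [lw|nl] := pselect (level i w); last first.
    have z g : G g -> f (invmx g *m w) = 0.
      move=> hg; apply/eqP;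
        apply: contrapT => /negP /sf /(level_P_B H _ _ (P_BV H hg)).
      exact: nl.
    by rewrite !z.
  have [x xs Kx] := hs w lw.
  have lx : level i x.
    by rewrite -(subrK w x); apply/(level_A H) => //; apply/A_sym; exact: KA.
  have step g : G g -> f (invmx g *m w) = f (invmx g *m x).
    move=> hg; have hgV := P_BV H hg.
    rewrite -{1}(subrK x w) mulmxDr Kf //; first exact/(level_P_B H _ _ hgV).
    exact/(KG _ _ hgV).
  rewrite !step //; have xi : (index x s < size s)%N by rewrite index_mem.
  have := congr1 (fun c : {ffun 'I_(size s) -> 'I_(size s).+1} =>
    nat_of_ord (c (Ordinal xi))) e.
  rewrite !ffunE /= nth_index // => e'.
  rewrite -(subrK (invmx h' *m x) (invmx h *m x)) Kf //.
    exact/(level_P_B H _ _ hhV').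
  by apply: clsP e'; exact/(level_P_B H _ _ hhV).
pose back c := M_ (xget 1%:M [set h | G h /\ code h = c]) f.
apply: (@sub_finite_set _ _ [set back c | c in setT]).
  move=> _ [h hh <-]; exists (code h) => //; rewrite /back.
  have [hx ex] :=
    @xgetPex _ 1%:M [set g | G g /\ code g = code h] (ex_intro _ h (conj hh erefl)).
  exact: codeP.
exact/finite_image/finite_finset.
Qed.

(** [chi_v] is the factor by which [P_v] acts on the value at [v] of an equivariant function, so it
    inherits multiplicativity from [M_]. *)
Lemma chi_vM v g h : P_v beta A B v g -> P_v beta A B v h ->
  chi_v psi beta v (g *m h) = chi_v psi beta v g * chi_v psi beta v h.
Proof.
move=> hg hh; have ed := delta_equivariant v; have [gG _] := hg; have [hG _] := hh.
have d1 : delta v v != 0.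
  by rewrite /delta asboolT ?subrr ?psi_n0 //; exact: A0.
apply: (mulIf d1); rewrite -M_Pv //; last exact: P_vM.
by rewrite M_M // M_Pv ?M_Pv ?mulrA //; exact: equivariant_M.
Qed.

Lemma sgn_neq0 s : sgn R s != 0.
Proof. by apply: contraTneq isT => e; have := sgn2 s; rewrite e mul0r => /esym/eqP;
  rewrite oner_eq0. Qed.

(* Averaging the twisted orbit of [f] under [P_v] isolates the values on the  *)
(* cosets of [v] and [-v].                                                    *)
Lemma isolate i s (F : set (W -> C)) f v : F `<=` level_space i s -> fsubspace F ->
  (forall g f', G g -> F f' -> F (M_ g f')) -> F f -> f v != 0 ->
  exists f0, [/\ F f0, f0 v != 0 & concentrated v f0].
Proof.
move=> FV [F0 FD] FM Ff fv; have [ef sf pf] := FV _ Ff.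
have FZ (c : C) f1 : F f1 -> F (fun w => c * f1 w).
  move=> h; have := FD c _ _ h F0; congr F; apply/funext => w; by rewrite addr0.
pose tau h f1 : W -> C := fun w => (chi_v psi beta v h)^-1 * M_ h f1 w.
pose S : set (W -> C) := [set tau h f | h in P_v beta A B v].
(* A twisted translate is [M_ h f] rescaled to have the value f(v) at [v], so it is determined by
   the member [M_ h f] of a finite orbit. *)
have finS : finite_set S.
  apply: (@sub_finite_set _ _ ((fun f1 : W -> C => fun w =>
    f v / f1 v * f1 w) @` [set M_ h f | h in G])).
    move=> _ [h hh <-]; exists (M_ h f); first by exists h => //; case: hh.
    apply/funext => w; rewrite M_Pv // /tau invfM; congr (_ * _).
    by rewrite mulrCA divff // mulr1.
  by apply: finite_image; exact: M_orbit_finite ef sf.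
have /finite_seqP [X0 SX] := finS.
pose X := undup X0; have uX : uniq X by exact: undup_uniq.
have XS f1 : (f1 \in X) <-> S f1 by rewrite SX mem_undup.
pose f0 w := \sum_(f1 <- X) f1 w.
have FX f1 : f1 \in X -> F f1.
  by move=> /XS [h [hh _] <-]; apply: FZ; exact: FM.
have Fsum r : (forall f1, f1 \in r -> F f1) -> F (fun w => \sum_(f1 <- r) f1 w).
  elim: r => [|f1 r IH] h.
    by have := F0; congr F; apply/funext => w; rewrite big_nil.
  have h1 : F f1 by apply: h; rewrite mem_head.
  have h2 : F (fun w => \sum_(f1 <- r) f1 w).
    by apply: IH => f2 hf2; apply: h; rewrite in_cons hf2 orbT.
  by have := FD 1 _ _ h1 h2; congr F; apply/funext => w; rewrite big_cons mul1r.
have Ff0 : F f0 by exact: Fsum.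
have [ef0 _ _] := FV _ Ff0.
exists f0; split=> //.
  (* All members of [X] take the value f(v) at [v], so f0(v) is f(v) times the size of [X], which is
     positive since [X] contains [f]. *)
  have -> : f0 v = \sum_(f1 <- X) f v.
    rewrite /f0 big_seq [RHS]big_seq; apply: eq_bigr => f1 /XS [h hh <-].
    by rewrite /tau M_Pv // mulKf // chi_v_neq0.
  rewrite big_const_seq count_predT iter_addr_0 -mulr_natr mulf_neq0 // pnatr_eq0.
  have : f \in X.
    apply/XS; exists 1%:M; first exact: P_v1.
    apply/funext => w; rewrite /tau /chi_v /M_ invmx1 !mul1mx bE mulr0.
    by rewrite (psi0 H psi_cond) invr1 mul1r.
  by move=> fX; rewrite -lt0n -has_predT; apply/hasP; exists f.
apply: twisted_concentrated => // h hh w.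
have hc := chi_v_neq0 v h; have [hG _] := hh; have u := P_B_unit H hG.
have tauS f1 : S f1 -> S (tau h f1).
  move=> [g hg <-]; exists (h *m g); first exact: P_vM.
  have [hgG _] := hg; have ug := P_B_unit H hgG.
  apply/funext => x; rewrite /tau chi_vM // M_M // invfM mulrA.
  by rewrite [(_)^-1 * (_)^-1]mulrC.
have tau_inj : injective (tau h).
  move=> f1 f2 e; apply/funext => x.
  have := congr1 (fun f3 : W -> C => f3 (h *m x)) e.
  by rewrite /tau /M_ mulKmx // => /(mulfI (invr_neq0 hc)).
(* Twisted translation by [h] permutes the finite orbit and so fixes its sum [f0]. *)
have perm : perm_eq (map (tau h) X) X.
  have ut : uniq (map (tau h) X).
    by rewrite map_inj_uniq //.
  apply: uniq_perm => //.
  apply: (uniq_min_size ut _ _).2; last by rewrite size_map.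
  by move=> _ /mapP [f1 /XS /tauS /XS h1 ->].
have e : f0 w = (chi_v psi beta v h)^-1 * M_ h f0 w.
  by rewrite {1}/f0 -(perm_big _ perm) big_map /tau -big_distrr.
by rewrite e mulVKf.
Qed.

Lemma sgn_inj : injective (sgn R).
Proof.
have two : (2%:R : C) != 0 by rewrite pnatr_eq0.
by case=> [] [] //= /eqP; rewrite ?[-1 == 1]eq_sym -subr_eq0 opprK (negPf two).
Qed.

(** * Irreducibility and inequivalence, for [M_] twisted by nonzero scalars *)

Section Action.
Variables (act : 'M[k]_n -> (W -> C) -> (W -> C)) (z : 'M[k]_n -> C).
Hypothesis actE : forall g f, G g -> Hspace psi beta A f ->
  act g f = (fun w => z g * M_ g f w).
Hypothesis z_neq0 : forall g, G g -> z g != 0.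

Let rep i s := @HRep R 'M[k]_n W (level_space i s) (Hform A) act.

Lemma space_scale i s (c : C) f : level_space i s f -> level_space i s (fun w =>
  c * f w).
Proof.
move=> hf; have [Z0 ZD] := space_sub i s; have := ZD c _ _ hf Z0.
by congr (level_space i s); apply/funext => w; rewrite addr0.
Qed.

Lemma space_act i s g f : G g -> level_space i s f -> level_space i s (act g f).
Proof.
move=> hg hf; rewrite actE //; last exact: space_Hspace hf.
by apply: space_scale; exact: space_M.
Qed.

(** A nonzero invariant subspace contains a function living on a single pair of cosets ([isolate]).
    By transitivity its translates reach every pair of the level, and finitely many of them make up
    any function of the space. *)
Lemma space_irreducible i s : nonzero_space (level_space i s) ->
  rep_irreducible G (rep i s).
Proof.
move=> nz; split=> // F FV FS _ FI; have [F0 FD] := FS.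
have FZ (c : C) f1 : F f1 -> F (fun w => c * f1 w).
  by move=> h; have := FD c _ _ h F0; congr F; apply/funext => w; rewrite addr0.
have FM g f : G g -> F f -> F (M_ g f).
  move=> hg Ff; have := FZ (z g)^-1 _ (FI g f hg Ff); congr F.
  rewrite /= actE //; last exact: space_Hspace (FV _ Ff).
  by apply/funext => w; rewrite mulKf ?z_neq0.
have [[f [Ff fn0]]|all0] := pselect (exists f, F f /\ f <> (fun=> 0)); last first.
  left; apply/seteqP; split=> [f Ff|_ ->//].
  by apply: contrapT => fn0; apply: all0; exists f.
right; have [v fv] : exists v, f v != 0.
  apply: contrapT => h; apply: fn0; apply/funext => w.
  by apply/eqP; apply: contrapT => /negP fw; apply: h; exists w.
have [f0 [Ff0 f0v cf0]] := isolate FV FS FM Ff fv.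
have [_ sf _] := FV _ Ff; have lv := sf _ fv.
(* Induction on a list of cosets covering the support of [f']: each step removes one coset. *)
have key (r : seq W) : forall f', level_space i s f' ->
    (forall w, f' w != 0 -> exists2 x, x \in r & A (w - x)) -> F f'.
  elim: r => [|x r IH] f' sf' supp.
    rewrite (_ : f' = (fun=> 0)) //; apply/funext => w.
    by apply/eqP; apply: contrapT => /negP /supp [].
  have [ef' lf' pf'] := sf'.
  have [f'x|f'x] := eqVneq (f' x) 0.
    apply: IH => // w f'w; have [x' + Ax'] := supp w f'w.
    rewrite in_cons => /orP [/eqP e|]; last by exists x'.
    by rewrite e in Ax'; have := equivariant_neq0 ef' Ax' f'w; rewrite f'x eqxx.
  have lx := lf' _ f'x; have [g hg Ag] := level_trans H lv lx.
  have ug := P_B_unit H hg.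
  pose phi := M_ g f0; have Fphi : F phi by exact: FM.
  have [ephi _ pphi] := FV _ Fphi.
  have phix : phi x != 0.
    by apply: equivariant_neq0 ephi Ag _; rewrite /phi /M_ mulKmx.
  have cphi : concentrated x phi.
    move=> w /cf0 hw; case: hw => hw; have := hw.
      rewrite -(P_B_A H _ hg) mulmxBr mulKVmx // => hw'; left; exact: A_tri hw' Ag.
    rewrite -(P_B_A H _ hg) mulmxDr mulKVmx // => hw'; right.
    by have := omoduleB mA hw' Ag; rewrite opprB addrACA subrr addr0.
  (* [c] cancels the value at [x]. By equivariance and parity [f2] then vanishes on the cosets of
     both [x] and [-x], and elsewhere it agrees with [f']. *)
  pose c := f' x / phi x; pose f2 w := - c * phi w + f' w.
  have [_ ZD] := space_sub i s.
  have sf2 : level_space i s f2 by apply: ZD => //; exact: FV.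
  have [ef2 _ pf2] := sf2.
  have f2x : f2 x = 0 by rewrite /f2 mulNr divfK // addNr.
  have -> : f' = (fun w => c * phi w + f2 w).
    by apply/funext => w; rewrite /f2 mulNr addNKr.
  apply: FD => //; apply: IH => // w f2w.
  have nA : ~ A (w - x).
    by move=> h; have := equivariant_neq0 ef2 h f2w; rewrite f2x eqxx.
  have nA' : ~ A (w + x).
    rewrite -[x]opprK => h; have := equivariant_neq0 ef2 h f2w.
    by rewrite pf2 f2x mulr0 eqxx.
  have f'w : f' w != 0.
    apply: contraNneq f2w; rewrite /f2 => ->; rewrite addr0 mulf_eq0.
    by apply/orP; right; apply: contrapT => /negP /cphi [].
  have [x' + Ax'] := supp w f'w; rewrite in_cons => /orP [/eqP e|];
    last by exists x'.
  by rewrite e in Ax'.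
apply/seteqP; split=> // f' sf'; have [r hr] := level_coverA i.
by apply: (key r) => // w fw; apply: hr; case: sf' => _ + _; apply.
Qed.

(** An intertwiner sends the bump at [v] to a function on which [P_v] still acts by chi_v, hence
    supported on the cosets of [v] and [-v]. Were this image nonzero, the levels would agree, and so
    would the parities; so it is zero, against isometry. *)
Lemma space_inequivalent i s i' s' v : level i v -> (A v -> s = true) ->
  (i, s) <> (i', s') -> ~ rep_equivalent G (rep i s) (rep i' s').
Proof.
move=> lv hs ne [T [Tlin Tiso Tim Tact]].
have Ve := bump_space s lv; set e := bump v s in Ve.
have [Z0 _] := space_sub i s.
have T0 : T (fun=> 0) = (fun=> 0).
  have := Tlin (-1) _ _ Z0 Z0; rewrite (_ : (fun x => _) = (fun=> 0)); last first.
    by apply/funext => w; rewrite mulr0 addr0.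
  by move=> ->; apply/funext => w; rewrite mulN1r addNr.
have TZ c : T (fun w => c * e w) = (fun w => c * T e w).
  rewrite (_ : (fun w => c * e w) = (fun w => c * e w + 0)).
    by rewrite (Tlin c _ _ Ve Z0) T0; apply/funext => w; rewrite addr0.
  by apply/funext => w; rewrite addr0.
have Vf : level_space i' s' (T e) by rewrite -[level_space i' s']Tim; exists e.
have [ef sf pf] := Vf.
have tw g c : G g -> (forall w, M_ g e w = c * e w) ->
  forall w, M_ g (T e) w = c * T e w.
  move=> hg Me w; have := Tact g e hg Ve; rewrite /= !actE //; last first.
  - exact: space_Hspace Ve.
  - exact: space_Hspace Vf.
  rewrite (_ : (fun w => z g * M_ g e w) = (fun w => (z g * c) * e w)); last first.
    by apply/funext => x; rewrite Me mulrA.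
  rewrite TZ => /(congr1 (fun f => f w)) /=; rewrite -mulrA.
  by move=> /(mulfI (z_neq0 hg)).
have cf : concentrated v (T e).
  apply: twisted_concentrated => // h hP w; apply: tw; first by case: hP.
  exact: (bump_twisted s lv hP).
have Te0 : T e = (fun=> 0).
  apply/funext => w; apply/eqP; apply: contrapT => /negP fw.
  have lw : level i w.
    have [h|h] := cf _ fw; first by rewrite -(subrK v w); apply/(level_A H _ _ h).
    by rewrite -(addrK v w); apply/(level_A H _ _ h)/(level_N H).
  have ii := level_inj H lw (sf _ fw).
  have ss : s <> s' by move=> ss; apply: ne; rewrite ii ss.
  (* Parity is the eigenvalue of -Id, an element of [P_B], so an intertwiner preserves it. *)
  have hN : G (- 1%:M) by apply: (P_BN H); exact: P_B1.
  have MN f1 x : M_ (- 1%:M) f1 x = f1 (- x).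
    rewrite /M_ (_ : invmx (- 1%:M) = - 1%:M) ?mulNmx ?mul1mx //.
    by rewrite -scaleN1r invmxZ ?invmx1 ?invrN1 // unitmxZ ?unitmx1 // unitfE
      oppr_eq0 oner_eq0.
  have := tw _ (sgn R s) hN _ w; rewrite MN pf => /(_ _)/(mulIf fw) E.
  have {}E : sgn R s' = sgn R s.
    by apply: E => x; rewrite MN; case: Ve => _ _ ->.
  by apply: ss; apply: sgn_inj.
have := Tiso _ _ Ve Ve; rewrite Te0 /= /Hform l2_form0 => /esym/eqP.
have [t ct At] := cosets_rep v; have [ee _ _] := Ve.
apply/negP; apply: (l2_form_neq0 (x := t)) => //.
  by have [] := space_Hspace Ve.
by apply: (equivariant_neq0 ee _ (bump_neq0 hs)); exact/A_sym.
Qed.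

End Action.

(** * Comparison with the representations induced from [Ptilde_v] *)

Section Induced.
Variables (i : nat) (v : W).
Hypotheses (i_gt0 : (0 < i)%N) (lv : level i v).
Local Notation Pt := (Ptilde_v beta A B v).
Local Notation chi := (chi_pm psi beta A B v).

Let nAv : ~ A v. Proof. exact: (level_notA H i_gt0 lv). Qed.

Lemma P_v_opp g : P_v beta A B v (- g) <-> G g /\ A (g *m v + v).
Proof.
rewrite /P_v /= mulNmx -opprD (omoduleNE _ mA); split=> -[hg h]; split=> //.
  by rewrite -(opprK g); exact: (P_BN H).
exact: (P_BN H).
Qed.

Lemma PtE g : Pt g <-> G g /\ (A (g *m v - v) \/ A (g *m v + v)).
Proof.
rewrite /Ptilde_v /= P_v_opp; split=> [[[hg h]|[hg h]]|[hg [h|h]]].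
- by split=> //; left.
- by split=> //; right.
- by left.
- by right.
Qed.

Lemma Pt_G : Pt `<=` G. Proof. by move=> g /PtE []. Qed.

(** Left cosets of [Ptilde_v] thus correspond to pairs of cosets of A, those of x v and - x v. *)
Lemma Pt_coset x y : G x -> G y ->
  Pt (invmx x *m y) <-> A (y *m v - x *m v) \/ A (y *m v + x *m v).
Proof.
move=> hx hy; rewrite PtE -(P_B_A H (invmx x *m y *m v - v) hx).
rewrite -(P_B_A H (invmx x *m y *m v + v) hx) mulmxBr mulmxDr -mulmxA.
rewrite (mulKVmx (P_B_unit H hx)); split=> [[]//|h]; split=> //.
by apply: P_BM => //; exact: (P_BV H).
Qed.

Let e x y := Pt (invmx x *m y).

Let e_refl x : G x -> e x x.
Proof. by move=> hx; apply/Pt_coset => //; left; rewrite subrr; exact: A0. Qed.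

Let e_sym x y : G x -> G y -> e x y -> e y x.
Proof.
move=> hx hy /(Pt_coset hx hy) h; apply/Pt_coset => //.
by case: h => h; [left; exact/A_sym|right; rewrite addrC].
Qed.

Let e_trans x y t : G x -> G y -> G t -> e x y -> e y t -> e x t.
Proof.
move=> hx hy ht /(Pt_coset hx hy) hxy /(Pt_coset hy ht) hyt; apply/Pt_coset => //.
case: hxy => a; case: hyt => b.
- by left; exact: A_tri b a.
- right; have := omoduleB mA b a.
  by rewrite opprB addrACA subrr addr0.
- right; have [_ D _] := mA; have := D _ _ b a.
  by rewrite addrA subrK.
- left; have := omoduleB mA b a.
  by rewrite opprD addrACA subrKA.
Qed.

Local Notation LC := (left_cosets G Pt).

Lemma LC_G : LC `<=` G. Proof. exact: (coset_rep_sub (e := e) e_refl). Qed.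

Lemma LC_rep x : G x ->
  exists2 t, LC t & A (t *m v - x *m v) \/ A (t *m v + x *m v).
Proof.
move=> hx; have [t ht /(Pt_coset hx (LC_G ht)) h] := coset_rep_ex 0 (e :=
  e) e_refl hx.
by exists t.
Qed.

Lemma LC_inj x y : LC x -> LC y -> A (x *m v - y *m v) \/ A (x *m v + y *m v) ->
  x = y.
Proof.
move=> hx hy h; apply: (coset_rep_inj (e := e) e_refl e_sym e_trans hx hy).
by apply/(Pt_coset (LC_G hx) (LC_G hy)); case: h => h; [left; exact/A_sym|right;
  rewrite addrC].
Qed.

Lemma LC_seq : exists2 r : seq 'M[k]_n, uniq r & forall x, x \in r <-> LC x.
Proof.
have [s hs] := level_coverA i.
pose b w := xget 0 [set x | LC x /\ A (x *m v - w)].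
exists [seq x <- undup [seq b w | w <- s] | `[< LC x >]].
  by rewrite filter_uniq // undup_uniq.
move=> x; rewrite mem_filter mem_undup; split=> [/andP [/asboolP]//|hx].
apply/andP; split; first exact/asboolP.
have /hs [w ws Aw] : level i (x *m v) by apply/(level_P_B H) => //; exact: LC_G.
apply/mapP; exists w => //.
have [hb hb'] : LC (b w) /\ A (b w *m v - w).
  by apply: (@xgetPex _ 0 [set x | LC x /\ A (x *m v - w)]); exists x.
by apply: LC_inj => //; left; apply: A_tri Aw _; exact/A_sym.
Qed.

Lemma chi_rule s f x h : level_space i s f -> G x -> Pt h ->
  f (x *m (h *m v)) = (chi s h)^-1 * f (x *m v).
Proof.
move=> [ef _ pf] hx hP; rewrite /chi_pm; case: (pselect (P_v beta A B v h)) => hh.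
  by rewrite asboolT // equivariant_Pv.
rewrite asboolF //; have {}hP : P_v beta A B v (- h) by case: hP.
have -> : x *m (h *m v) = - (x *m (- h *m v)) by rewrite mulNmx mulmxN opprK.
rewrite pf equivariant_Pv // invfM mulrA; congr (_ * _ * _).
by rewrite -[LHS]mulr1 -(divff (sgn_neq0 s)) mulrA sgn2 mul1r.
Qed.

Lemma chi_pmN1 s : chi s (- 1%:M) = sgn R s.
Proof.
rewrite /chi_pm asboolF; last first.
  move=> [_]; rewrite mulNmx mul1mx -opprD (omoduleNE _ mA) => /A_double.
  exact: nAv.
by rewrite opprK /chi_v mul1mx bE mulr0 (psi0 H psi_cond) mulr1.
Qed.

Lemma pair_coset f f' w w' : equivariant f -> equivariant f' -> A (w - w') ->
  f w * conjc (f' w) = f w' * conjc (f' w').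
Proof.
move=> ef ef' h; rewrite -(subrK w' w) ef // ef' // conjcM mulrACA.
rewrite mul_conjc -Re_normsq; have [_ -> _] := psi_char.
by rewrite expr1n mul1r.
Qed.

Section Equivalence.
Variables (act : 'M[k]_n -> (W -> C) -> (W -> C)) (z : 'M[k]_n -> C).
Hypothesis actE : forall g f, G g -> Hspace psi beta A f ->
  act g f = (fun w => z g * M_ g f w).
Hypothesis z_sign : forall g, G g -> z g = 1 \/ z g = -1.
Hypothesis zM : forall g h, G g -> G h -> z (g *m h) = z g * z h.

Let zz g : G g -> z g * z g = 1.
Proof. by move=> /z_sign [->|->]; rewrite ?mulrNN mulr1. Qed.

Let z_conj g : G g -> conjc (z g) = z g.
Proof. by move=> /z_sign [->|->]; rewrite ?rmorphN rmorph1. Qed.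

Let z_n0 g : G g -> z g != 0.
Proof. by move=> hg; apply: contraTneq isT => e0; have := zz hg;
  rewrite e0 mul0r => /esym/eqP; rewrite oner_eq0. Qed.

Let c2 : C := (Num.sqrt (2 : R))%:C%C.

Let c2c2 : c2 * c2 = 2.
Proof. by rewrite /c2 -rmorphM -expr2 sqr_sqrtr // rmorph_nat. Qed.

Let c2_n0 : c2 != 0.
Proof.
have two : (2%:R : C) != 0 by rewrite pnatr_eq0.
by apply: contraNneq two => e0; rewrite -c2c2 e0 mul0r.
Qed.

Let c2_conj : conjc c2 = c2. Proof. exact: conjc_real. Qed.

(* [sqrt 2] compensates for the two cosets [x v + A] and [- x v + A] of W / A *)
(* lying over each coset of [Pt].                                             *)
Let T (f : W -> C) : 'M[k]_n -> C :=
  fun x => if `[< G x >] then c2 * z x * f (x *m v) else 0.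

Let T_iso s f f' : level_space i s f -> level_space i s f' ->
  l2_form LC (T f) (T f') = Hform A f f'.
Proof.
move=> [ef lf pf] [ef' lf' pf']; have [r ur rLC] := LC_seq.
have rG x : x \in r -> G x by move=> /rLC /LC_G.
pose q w := s2val (cid2 (cosets_rep w)).
have qc w : cosets A (q w) by exact: (s2valP (cid2 (cosets_rep w))).
have qA w : A (q w - w) by exact: (s2valP' (cid2 (cosets_rep w))).
have q_eq w w' : q w = q w' -> A (w - w').
  move=> E; apply: A_tri (qA w'); rewrite -E; exact/A_sym.
pose F w := f w * conjc (f' w).
have Fq w : F (q w) = F w by apply: pair_coset.
have FN w : F (- w) = F w.
  rewrite /F pf pf' conjcM mulrACA (_ : sgn R s * _ = 1) ?mul1r //.
  by rewrite mul_conjc; case: (s);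
    rewrite /sqn /= ?expr0n ?oppr0 ?sqrrN ?expr0n ?expr1n ?addr0.
rewrite /Hform !l2_formE (complex_sum_seq ur); last 2 first.
- by move=> x /rLC.
- by move=> x xL _; apply/rLC.
(* The representatives of x v + A and - x v + A, for [x] in [r], are distinct by [LC_inj] and
   because 2 v is not in [A]; by [level_trans] they exhaust the support. *)
rewrite (@complex_sum_seq _ _ _ ([seq q (x *m v) | x <- r] ++ [seq q (- (x *m v)) |
  x <- r])).
- rewrite big_cat /= !big_map -big_split /= big_seq [RHS]big_seq.
  apply: eq_bigr => x xr; have hx := rG _ xr.
  rewrite -!/(F _) !Fq FN /T asboolT // !conjcM c2_conj z_conj //.
  transitivity ((c2 * c2) * (z x * z x) * F (x *m v)); first by rewrite /F; ring.
  by rewrite c2c2 zz // mulr1 mulr2n mulrDl mul1r.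
- rewrite cat_uniq; apply/and3P; split.
  + rewrite map_inj_in_uniq // => x y /rLC hx /rLC hy /q_eq h.
    by apply: LC_inj => //; left.
  + apply/hasPn => _ /mapP [y yr ->]; apply/mapP => -[x xr /q_eq h].
    have h' : A (x *m v + y *m v).
      by move: h; rewrite -opprD (omoduleNE _ mA) addrC.
    have E : x = y by apply: LC_inj; [exact/rLC|exact/rLC|right].
    apply: nAv; apply: A_double; rewrite E in h'.
    by rewrite -(P_B_A H _ (rG _ yr)) mulmxDr.
  + rewrite map_inj_in_uniq // => x y /rLC hx /rLC hy /q_eq.
    rewrite -opprD (omoduleNE _ mA) => h.
    by apply: LC_inj => //; left.
- by move=> w; rewrite mem_cat => /orP [] /mapP [x _ ->].
- move=> w cw; rewrite mulf_eq0 negb_or => /andP [/lf lw _].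
  have [g hg Ag] := level_trans H lv lw; have [x xL h] := LC_rep hg.
  rewrite mem_cat; apply/orP; case: h => h; [left|right]; apply/mapP; exists x;
    try exact/rLC.
    apply: cosets_inj => //; apply: A_tri (_ : A (x *m v - _)); last by apply/A_sym.
    by apply/A_sym; exact: A_tri h Ag.
  apply: cosets_inj => //; apply: A_tri (_ : A (- (x *m v) - _));
    last by apply/A_sym.
  have := omoduleB mA h Ag; rewrite opprB addrACA subrr addr0 opprK.
  by rewrite [w + _]addrC.
Qed.

Let chi' s g := z g * chi s g.

Let T_mem s f : level_space i s f -> rep_space (Ind G Pt (chi' s)) (T f).
Proof.
move=> sf; split.
- by move=> g ng; rewrite /T asboolF.
- move=> g h hg hP; have hh := Pt_G hP.
  rewrite /T !asboolT //; last exact: P_BM.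
  rewrite -mulmxA (chi_rule sf hg hP) zM // /chi' invfM.
  rewrite (_ : (z h)^-1 = z h); first by ring.
  by rewrite -[LHS]mulr1 -(zz hh) mulKf // z_n0.
- have [r ur rLC] := LC_seq; apply: (@square_summable_seq _ _ _ r) => x xL _.
  exact/rLC.
Qed.

(** The preimage [f] is built coset by coset: on x v + A, [val] extends by equivariance the value
    c2^-1 z(x) Phi(x) prescribed at x v. The covariance of [Phi] makes this independent of [x], and
    its covariance under -Id gives the parity. *)
Let T_surj s (Phi : 'M[k]_n -> C) : rep_space (Ind G Pt (chi' s)) Phi ->
  exists2 f, level_space i s f & T f = Phi.
Proof.
move=> [Phi0 PhiM _].
pose ex w := exists x, G x /\ A (w - x *m v).
pose val w x := psi (2^-1 * beta (x *m v) w) * (c2^-1 * z x * Phi x).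
pose f w : C := if pselect (ex w) is left h then val w (projT1 (cid h)) else 0.
have val_indep w x y : G x -> G y -> A (w - x *m v) -> A (w - y *m v) ->
    val w x = val w y.
  move=> hx hy ax ay; pose h := invmx x *m y; have ux := P_B_unit H hx.
  have xh : x *m h = y by rewrite mulKVmx.
  have hh : G h by apply: P_BM => //; exact: (P_BV H).
  have Axy : A (x *m v - y *m v) by apply: A_tri ay; exact/A_sym.
  have hv : P_v beta A B v h.
    split=> //; rewrite -(P_B_A H _ hx) mulmxBr mulmxA xh; exact/A_sym.
  have hP : Pt h by left.
  rewrite /val -xh PhiM // zM // /chi' /chi_pm asboolT // invfM.
  have zV : (z h)^-1 = z h by rewrite -[LHS]mulr1 -(zz hh) mulKf // z_n0.
  rewrite zV xh.
  have -> : chi_v psi beta v h = psi (2^-1 * beta (y *m v) (x *m v)).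
    by rewrite /chi_v -(P_B_Sp hx) mulmxA xh.
  have -> : psi (2^-1 * beta (x *m v) w)
      = psi (2^-1 * beta (y *m v) w) * (psi (2^-1 * beta (y *m v) (x *m v)))^-1.
    rewrite -(psiN H psi_char psi_cond) -(psiD psi_char); apply: psi_eq.
    (* The discrepancy of the phases is half a pairing of two vectors of [A], on which [psi] is
       trivial. *)
    have -> : 2^-1 * beta (x *m v) w
        - (2^-1 * beta (y *m v) w - 2^-1 * beta (y *m v) (x *m v))
        = 2^-1 * beta (x *m v - y *m v) (w - x *m v) by rewrite !bE; ring.
    by apply: (ideal_half (set_char2 H)); exact: (betaAA H).
  set P1 := psi _; set P2 := psi _.
  transitivity (P1 * P2^-1 * (c2^-1 * (z h * z h) * z x * Phi x)).
    by rewrite zz // mulr1.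
  ring.
have fE w x : G x -> A (w - x *m v) -> f w = val w x.
  move=> hx ax; rewrite /f; case: pselect => [h|]; last by case; exists x.
  by case: (cid h) => y [hy ay] /=; exact: val_indep.
have f0 w : ~ ex w -> f w = 0 by rewrite /f; case: pselect.
exists f; last first.
  apply/funext => x; rewrite /T; case: (pselect (G x)) => hx; last first.
    by rewrite asboolF // Phi0.
  rewrite asboolT // (fE _ x) //; last by rewrite subrr; exact: A0.
  rewrite /val bE mulr0 (psi0 H psi_cond) mul1r.
  transitivity ((c2 * c2^-1) * (z x * z x) * Phi x); first by ring.
  by rewrite divff // zz // !mul1r.
split.
- move=> a w Aa; case: (pselect (ex w)) => [[x [hx ax]]|ne]; last first.
    rewrite f0 ?f0 ?mulr0 // => -[x [hx ax]]; apply: ne; exists x; split=> //.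
    by move: ax; rewrite -addrA (omoduleDl _ mA Aa).
  rewrite (fE w x) // (fE _ x) //; last by rewrite -addrA (omoduleDl _ mA Aa).
  rewrite /val mulrA; congr (_ * _).
  rewrite -(psiD psi_char); apply: psi_eq.
  rewrite (_ : _ - _ = - (2^-1 * beta (w - x *m v) a)); last by rewrite !bE; ring.
  by apply: idealN; apply: (ideal_half (set_char2 H)); exact: (betaAA H).
- move=> w fw; case: (pselect (ex w)) => [[x [hx ax]]|/f0 e0];
  last by rewrite e0 eqxx in fw.
  by rewrite -(subrK (x *m v) w); apply/(level_A H _ _ ax)/(level_P_B H _ _ hx).
- move=> w; case: (pselect (ex w)) => [[x [hx ax]]|ne]; last first.
    rewrite !f0 ?mulr0 // => -[x [hx ax]]; apply: ne; exists (- x).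
    split; first exact: (P_BN H).
    by rewrite mulNmx opprK -(omoduleNE _ mA) opprD.
  have hN : G (- 1%:M) by apply: (P_BN H); exact: P_B1.
  have xN : - x = x *m (- 1%:M) by rewrite mulmxN mulmx1.
  rewrite (fE w x) // (fE _ (- x)); first last.
  + by rewrite mulNmx -opprD (omoduleNE _ mA).
  + exact: (P_BN H).
  have PtN : Pt (- 1%:M) by right; rewrite opprK; exact: P_v1.
  rewrite /val xN PhiM // zM // /chi' chi_pmN1 -xN !mulNmx !bE opprK invfM.
  have zV : (z (- 1%:M))^-1 = z (- 1%:M) by rewrite -[LHS]mulr1 -(zz hN) mulKf //
    z_n0.
  have sV : (sgn R s)^-1 = sgn R s by rewrite -[LHS]mulr1 -(sgn2 s) mulKf //
    sgn_neq0.
  rewrite zV sV; set P1 := psi _.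
  transitivity (P1 * (c2^-1 * (z x * (z (- 1%:M) * z (- 1%:M))) * (sgn R s * Phi
    x))).
    by ring.
  by rewrite zz // mulr1; ring.
Qed.

Lemma induced_equivalent s :
  rep_equivalent G (@HRep R 'M[k]_n W (level_space i s) (Hform A) act)
    (Ind G Pt (fun g => z g * chi s g)).
Proof.
exists T; split.
- move=> a f g sf sg; apply/funext => x; rewrite /T.
  by case: asboolP => _; [ring|rewrite mulr0 addr0].
- by move=> f g; exact: T_iso.
- apply/seteqP; split=> [_ [f sf <-]|Phi /T_surj [f sf <-]]; first exact: T_mem.
  by exists f.
- move=> g f hg sf /=; apply/funext => x; rewrite /T.
  have hgV := P_BV H hg; have ug := P_B_unit H hg.
  case: (pselect (G x)) => hx; last first.
    rewrite !asboolF // => hx'; apply: hx.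
    by rewrite -(mulKVmx ug x); exact: P_BM.
  rewrite !asboolT //; last exact: P_BM.
  rewrite actE //; last exact: space_Hspace sf.
  rewrite /M_ mulmxA zM //.
  have -> : z (invmx g) = z g.
    have := zM hg hgV; rewrite mulmxV // => e1.
    have z1 : z 1%:M = 1.
      have := zM (P_B1 beta A B) (P_B1 beta A B); rewrite mulmx1 => e2.
      by have := zz (P_B1 beta A B); rewrite -e2.
    by rewrite z1 -(zz hg) in e1; move: e1 => /(mulfI (z_n0 hg)) ->.
  ring.
Qed.

End Equivalence.

Lemma Pt_subgroup : matrix_subgroup Pt.
Proof.
have P1 := P_B1 beta A B.
split.
- by apply/PtE; split=> //; left; rewrite mul1mx subrr; exact: A0.
- move=> g h hg hh; have gG := Pt_G hg; have hG := Pt_G hh.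
  have gV := P_BV H gG.
  (* Transitivity of [e] along g^-1, 1, h says that g h lies in [Ptilde_v]. *)
  have h1 : e (invmx g) 1%:M by rewrite /e invmxK mulmx1.
  have h2 : e 1%:M h by rewrite /e invmx1 mul1mx.
  by have := e_trans gV P1 hG h1 h2; rewrite /e invmxK.
- move=> g hg; have gG := Pt_G hg; split; first exact: (P_B_unit H gG).
  have h2 : e 1%:M g by rewrite /e invmx1 mul1mx.
  by have := e_sym P1 gG h2; rewrite /e mulmx1.
Qed.

Lemma chi_pm_norm s g : `|chi s g| = 1.
Proof.
have [_ h _] := psi_char.
by rewrite /chi_pm /chi_v; case: ifP => _; rewrite ?normrM h //; case: s;
  rewrite /= ?normrN normr1 mulr1.
Qed.

(** Apply [chi_rule] to the bump, which is nonzero at [v]: the factors of [g] and [h] must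
    compose. *)
Lemma chi_pmM s g h : Pt g -> Pt h -> chi s (g *m h) = chi s g * chi s h.
Proof.
move=> hg hh; have sb := bump_space s lv; have P1 := P_B1 beta A B.
have [_ PM _] := Pt_subgroup; have nz : bump v s v != 0 by apply: bump_neq0 => /nAv.
apply: (invr_inj); apply: (mulIf nz); have := chi_rule sb P1 (PM _ _ hg hh).
rewrite !mul1mx => <-; rewrite -mulmxA (chi_rule sb (Pt_G hg) hh).
have := chi_rule sb P1 hg; rewrite !mul1mx => ->.
by rewrite invfM mulrA; congr (_ * _); rewrite mulrC.
Qed.

(** A small change of [g] moves g v within varpi^i A, while varpi^i v lies in [A]. Hence [Ptilde_v]
    is open in [P_B] and its characters are locally constant. *)
Lemma near_action : exists N : int, forall g g' : 'M[k]_n, ball_mx N (g' - g) ->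
  A (g' *m v - g *m v) /\ ideal lambda (2^-1 * beta (g' *m v - g *m v) v).
Proof.
have [N hN] := A_ball H; have [M hM] := ball_mx_ex v.
pose c := varpi ^+ i.
have c0 : c != 0 by exact: (varpiX_neq0 H i).
exists (i%:Z + N - M) => g g' hg.
have hb : ball_mx (i%:Z + N) ((g' - g) *m v).
  by rewrite -(subrK M (i%:Z + N)); exact: ball_mxM.
have A1 : A (c^-1 *: ((g' - g) *m v)).
  apply: hN => a b; rewrite mxE -(addKr i%:Z N); apply: idealM;
    last exact: (hb a b).
  by right; rewrite navV // (nav_varpiX H).
rewrite -mulmxBl; split.
  have ic : ideal 0 c by right; rewrite (nav_varpiX H).
  by have := omoduleZ mA ic A1; rewrite scalerA divff // scale1r.
apply: (ideal_half (set_char2 H)).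
rewrite (_ : beta _ v = beta (c^-1 *: ((g' - g) *m v)) (c *: v)); last first.
  by rewrite !bE mulrCA mulKf.
apply: (betaAA H) => //; rewrite -(chain0 varpi lambda beta A B).
by have [cv _] := lv; apply: (chain_le H) cv; lia.
Qed.

Lemma Pt_open : exists2 U : set 'M[k]_n, open U & Pt = G `&` U.
Proof.
have [N hN] := near_action.
exists [set g | A (g *m v - v) \/ A (g *m v + v)]; last first.
  by apply/seteqP; split=> g; [move=> /PtE|move=> ?; apply/PtE].
rewrite openE => g hg; apply/nbhs_ball_mx; exists N => g' /hN [h _].
case: hg => hg; [left|right]; first exact: A_tri h hg.
have [_ D _] := mA; have := D _ _ h hg.
by rewrite addrA subrK.
Qed.

Lemma chi_pm_continuous s : {within Pt, continuous (chi s : 'M[k]_n -> C^o)}.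
Proof.
have [N hN] := near_action.
have key g g' : Pt g -> Pt g' -> ball_mx N (g' - g) -> chi s g' = chi s g.
  move=> hg hg' /hN [h1 h2].
  have E : chi_v psi beta v g' = chi_v psi beta v g.
    rewrite /chi_v -(subrK (g *m v) (g' *m v)) bE mulrDr (psiD psi_char).
    by rewrite psiI // mul1r.
  have EN : chi_v psi beta v (- g') = chi_v psi beta v (- g).
    by move: E; rewrite /chi_v !mulNmx !bE !mulrN !(psiN H psi_char psi_cond) => ->.
  rewrite /chi_pm E EN.
  have -> // : `[< P_v beta A B v g' >] = `[< P_v beta A B v g >].
  have gG := Pt_G hg; have gG' := Pt_G hg'.
  apply/asboolP/asboolP => -[_ h]; split=> //.
    by apply: A_tri h; exact/A_sym.
  exact: A_tri h1 h.
apply/subspace_continuousP => g hg U /nbhs_singleton Ug.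
apply/nbhs_ball_mx; exists N => g' hb hg'.
by change (U (chi s g')); rewrite (key g g').
Qed.

Lemma induced_M_equivalent s :
  rep_equivalent G (@HRep R 'M[k]_n W (level_space i s) (Hform A) (@M_ R k n))
    (Ind G Pt (chi s)).
Proof.
have -> : chi s = (fun g => 1 * chi s g) by apply/funext => g; rewrite mul1r.
apply: (induced_equivalent (z := fun=> 1)).
- by move=> g f _ _; apply/funext => w; rewrite mul1r.
- by move=> *; left.
- by move=> *; rewrite mulr1.
Qed.

Lemma space_monomial s :
  rep_monomial G (@HRep R 'M[k]_n W (level_space i s) (Hform A) (@M_ R k n)).
Proof.
exists Pt, (chi s); split; first exact: Pt_subgroup.
- by split; [exact: Pt_G|exact: Pt_open].
- by split; [exact: chi_pmM|move=> g _;
  exact: chi_pm_norm|exact: chi_pm_continuous].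
- exact: induced_M_equivalent.
Qed.

End Induced.

(** * The line of [delta0] and the trivial representation *)

Lemma space0E f : level_space 0 true f <-> exists c : C, f = (fun w =>
  c * delta0 R A w).
Proof.
have d0 a w : A a -> delta0 R A (a + w) = delta0 R A w.
  by move=> Aa; rewrite /delta0; congr (nat_of_bool _)%:R; apply/idP/idP;
    rewrite !inE => /(omoduleDl _ mA Aa).
split=> [[ef sf pf]|[c ->]].
  exists (f 0); apply/funext => w; rewrite /delta0.
  case: (pselect (A w)) => Aw.
    by rewrite mem_set // mulr1 -[in LHS](addr0 w) ef // bE mulr0 (psi0 H psi_cond)
      mul1r.
  rewrite memNset // mulr0; apply/eqP; apply: contrapT => /negP /sf.
  by rewrite level0.
split=> [a w Aa|w|w].
- rewrite d0 // /delta0; case: (pselect (A w)) => Aw;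
  last by rewrite memNset // !mulr0.
  rewrite psiI ?mul1r //; apply: (ideal_half (set_char2 H)); exact: (betaAA H).
- rewrite level0 /delta0; case: (pselect (A w)) => // Aw.
  by rewrite memNset // mulr0 eqxx.
- rewrite mul1r /delta0; congr (_ * (nat_of_bool _)%:R).
  by apply/idP/idP; rewrite !inE (omoduleNE _ mA).
Qed.

Lemma delta0_space : level_space 0 true (delta0 R A).
Proof. by apply/space0E; exists 1; apply/funext => w; rewrite mul1r. Qed.

Lemma delta0_0 : delta0 R A 0 = 1.
Proof. by rewrite /delta0 mem_set //; exact: A0. Qed.

Lemma Hform0 f f' : level_space 0 true f -> level_space 0 true f' ->
  Hform A f f' = f 0 * conjc (f' 0).
Proof.
move=> [ef sf _] [ef' sf' _]; have [t ct At] := cosets_rep 0.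
rewrite /Hform l2_formE (@complex_sum_seq _ _ _ [:: t]) //.
- by rewrite big_seq1; apply: pair_coset.
- by move=> x; rewrite inE => /eqP ->.
- move=> x cx; rewrite mulf_eq0 negb_or => /andP [/sf + _];
  rewrite level0 inE => Ax.
  apply/eqP/cosets_inj => //; apply: (A_tri (v := 0)); rewrite ?subr0 //.
  exact/A_sym.
Qed.

Lemma trivial_equivalent (act : 'M[k]_n -> (W -> C) -> (W -> C)) (z : 'M[k]_n ->
  C) :
  (forall g f, G g -> Hspace psi beta A f -> act g f = (fun w => z g * M_ g f w)) ->
  rep_equivalent G (@HRep R 'M[k]_n W (level_space 0 true) (Hform A) act)
    (one_dim_rep z).
Proof.
move=> actE; exists (fun f _ => f 0); split=> //=.
- by move=> f g sf sg; rewrite Hform0.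
- apply/seteqP; split=> // x _; exists (fun w => x tt * delta0 R A w).
    by apply/space0E; exists (x tt).
  by apply/funext => -[]; rewrite delta0_0 mulr1.
- move=> g f hg sf; rewrite actE //; last exact: space_Hspace sf.
  by apply/funext => _; rewrite /M_ mulmx0.
Qed.

Lemma G_subgroup : matrix_subgroup G.
Proof.
split; [exact: P_B1|by move=> *; exact: P_BM|].
by move=> g hg; split; [exact: (P_B_unit H hg)|exact: (P_BV H hg)].
Qed.

(** Induce the trivial character from [G] itself: there is a single coset, and [f] corresponds to
    the function equal to f(0) on [G]. *)
Lemma trivial_monomial :
  rep_monomial G (@HRep R 'M[k]_n W (level_space 0 true) (Hform A) (@M_ R k n)).
Proof.
have [G1 GM GV] := G_subgroup.
exists G, (fun=> 1); split.
- exact: G_subgroup.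
- by split=> //; exists setT; [exact: openT|rewrite setIT].
- split=> [g h _ _|g _|]; [by rewrite mulr1|by rewrite normr1|].
  by apply: continuous_subspaceT => x; exact: cst_continuous.
have eG x y : G x -> G y -> G (invmx x *m y) by move=> /GV [_ hx]; exact: GM.
have er x : G x -> (fun x y => G (invmx x *m y)) x x by move=> hx; exact: eG.
have [t tL _] := coset_rep_ex 0 (e := fun x y => G (invmx x *m y)) er G1.
have LCG := @coset_rep_sub _ 0 _ (fun x y => G (invmx x *m y)) er.
have tG : G t by exact: LCG.
have tuniq x : left_cosets G G x -> x = t.
  move=> xL; apply: (coset_rep_inj (e := fun x y => G (invmx x *m y)) er _ _ xL tL).
  - by move=> ? ? hx hy _; exact: eG.
  - by move=> ? ? ? hx _ hz _ _; exact: eG.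
  - by apply: eG => //; exact: LCG.
exists (fun f x => if `[< G x >] then f 0 else 0); split=> /=.
- move=> a f g _ _; apply/funext => x; case: asboolP => // _.
  by rewrite mulr0 addr0.
- move=> f g sf sg; rewrite Hform0 // l2_formE (@complex_sum_seq _ _ _ [:: t]) //.
  + by rewrite big_seq1 asboolT.
  + by move=> x; rewrite inE => /eqP ->.
  + by move=> x /tuniq -> _; rewrite mem_head.
- apply/seteqP; split=> [_ [f sf <-]|Phi [Phi0 PhiM _]].
    split=> [g ng|g h hg hh|].
    + by rewrite asboolF.
    + by rewrite !asboolT ?invr1 ?mul1r //; exact: GM.
    + by apply: (@square_summable_seq _ _ _ [:: t]) => x /tuniq -> _;
      rewrite mem_head.
  exists (fun w => Phi 1%:M * delta0 R A w); first by apply/space0E;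
    exists (Phi 1%:M).
  apply/funext => x; rewrite delta0_0 mulr1; case: asboolP => hx;
    last by rewrite Phi0.
  by have := PhiM 1%:M x G1 hx; rewrite mul1mx invr1 mul1r.
- move=> g f hg sf; apply/funext => x; rewrite /M_ mulmx0.
  have [ug hgV] := GV g hg; congr (if _ then _ else _).
  apply/asboolP/asboolP => hx; first exact: GM.
  by rewrite -(mulKVmx ug x); exact: GM.
Qed.

Lemma nonzero_spaceP i s : (0 < i)%N ->
  nonzero_space (level_space i s) <-> exists w, level i w.
Proof.
move=> i0; split=> [[f [ef sf pf] fn0]|[v lv]].
  apply: contrapT => h; apply: fn0; apply/funext => w.
  by apply/eqP; apply: contrapT => /negP /sf lw; apply: h; exists w.
exists (bump v s); first exact: bump_space.
move=> /(congr1 (fun f => f v)) /eqP; apply/negP; apply: bump_neq0.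
by move=> /(level_notA H i0 lv).
Qed.

(** * Labels and the Hilbert sum *)

Definition lrank (x : label) := if x is Lpm m j _ then rank m j else 0%N.
Definition lsgn (x : label) := if x is Lpm _ _ s then s else true.

(** At (0, [j0]) the space is defined as the line of [delta0]; an equivariant function supported in
    [A] is constant there, so the uniform description covers this case too. *)
Lemma E_E m j : E_ varpi lambda psi beta A B m j =
  [set f | Hspace psi beta A f /\ forall w, f w != 0 -> level (rank m j) w].
Proof.
have [r0|] := posnP (rank m j); last first.
  move=> r0; have le := layerE H r0; rewrite -le.
  by case: m j r0 le => [|m] [].
have [-> ->] : m = 0%N /\ j = j0 by case: j r0 => //= r0; split=> //; lia.
apply/seteqP; split=> f /=; rewrite muln0.
  move=> /space0E sf; have := space_Hspace sf; by case: sf.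
move=> [hf sf]; apply/space0E; have [ef _] := hf; split=> // w; rewrite mul1r.
have half x : A x -> f x = f 0.
  by move=> Ax; rewrite -{1}(addr0 x) ef // bE mulr0 (psi0 H psi_cond) mul1r.
case: (pselect (A w)) => Aw.
  by rewrite !half // (omoduleNE _ mA).
have z x : ~ A x -> f x = 0.
  by move=> nA; apply/eqP; apply: contrapT => /negP /sf; rewrite level0.
by rewrite !z // (omoduleNE _ mA).
Qed.

Lemma label_spaceE x : valid_label x ->
  label_space varpi lambda psi beta A B x = level_space (lrank x) (lsgn x).
Proof.
case: x => [|m j s] /= vx.
  by apply/seteqP; split=> f /space0E.
rewrite /Epm E_E; apply/seteqP; split=> f /=.
  by move=> [[[ef _] sf] pf].
by move=> sf; have hf := space_Hspace sf; case: sf.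
Qed.

Lemma label_pair_inj x y : valid_label x -> valid_label y ->
  (lrank x, lsgn x) = (lrank y, lsgn y) -> x = y.
Proof.
have r0 m j s : valid_label (Lpm m j s) -> rank m j = 0%N -> False.
  by case: j => //=; lia.
case: x y => [|m j s] [|m' j' s'] //= vx vy [].
- by move=> /esym /(r0 _ _ _ vy).
- by move=> /(r0 _ _ _ vx).
- by move=> /rank_inj [-> ->] ->.
Qed.

(** The condition on [A] is the one [bump_neq0] asks for; it has content only for [L00], whose level
    is [A] and whose parity is even. *)
Lemma label_level x : valid_label x ->
  nonzero_space (level_space (lrank x) (lsgn x)) ->
  exists2 v, level (lrank x) v & (A v -> lsgn x = true).
Proof.
case: x => [|m j s] /= vx nz; first by exists 0 => //; rewrite level0; exact: A0.
have r0 : (0 < rank m j)%N by case: j vx {nz} => //=; lia.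
have [v lv] := (nonzero_spaceP s r0).1 nz; exists v => //.
by move=> /(level_notA H r0 lv).
Qed.

Lemma model_hilbert_sum : hilbert_sum (Hform A) (Hspace psi beta A)
  (fun mj : nat * layer_index => E_ varpi lambda psi beta A B mj.1 mj.2).
Proof.
split.
- move=> [m j] /=; rewrite E_E; split.
  + by move=> f [].
  + split.
      by split=> [|w]; [apply: (@Hspace_supp 0) => [a w _|w]|];
        rewrite ?mulr0 ?eqxx.
    move=> c f g [[ef _] sf] [[eg _] sg].
    have supp w : c * f w + g w != 0 -> level (rank m j) w.
      have [fw|fw] := eqVneq (f w) 0; last by move=> _; exact: sf.
      by rewrite fw mulr0 add0r; exact: sg.
    split=> //; apply: Hspace_supp supp => a w Aa; rewrite ef // eg //; ring.
  (* Closedness: an element of the space vanishes at a representative [t] off the level, so its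
     squared distance to [f] is at least |f(t)|^2. *)
  + move=> f hf lim; split=> // w fw; apply: contrapT => nl.
    have [ef ssf] := hf; have [t ct At] := cosets_rep w.
    have ft : f t != 0 by apply: equivariant_neq0 ef _ fw; exact/A_sym.
    have nlt : ~ level (rank m j) t.
      by rewrite -(subrK w t) (level_A H _ _ At).
    have pos : 0 < sqn (f t).
      by rewrite lt_neqAle sqn_ge0 andbT eq_sym;
        apply: contraNneq ft => /sqn_eq0 ->.
    have [g [[_ ssg] sg] lt] := lim _ pos.
    have gt : g t = 0 by apply/eqP; apply: contrapT => /negP /sg.
    by have := dist2_ge ssf ssg ct; rewrite gt subr0 leNgt lt.
- move=> [m j] [m' j'] ne f g /=; rewrite !E_E => -[_ sf] [_ sg].
  apply: l2_form_disjoint => w _; have [|fw] := eqVneq (f w) 0; first by left.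
  right; apply/eqP; apply: contrapT => /negP gw; apply: ne.
  by have /rank_inj [-> ->] := level_inj H (sf _ fw) (sg _ gw).
- move=> f [ef ssf] e e0.
  (* Density: the fibres of [lv] are the levels, and [f] is approximated by its restriction to
     finitely many of them. *)
  pose lv w := projT1 (cid (level_ex H w)).
  have lvP w : level (lv w) w by exact: (projT2 (cid (level_ex H w))).
  have [s us hs] := dist2_fibres lv ssf e0.
  have unr i : exists mj : nat * layer_index, rank mj.1 mj.2 = i.
    by move: i; apply: chain_ind => m;
      [exists (m, j0)|exists (m, j2)|exists (m, j1)].
  pose unrank i := projT1 (cid (unr i)).
  have unrankK i : rank (unrank i).1 (unrank i).2 = i by exact: (projT2 (cid (unr
    i))).
  pose g (mj : nat * layer_index) w :=
    if `[< level (rank mj.1 mj.2) w >] then f w else 0.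
  exists (map unrank s), g; split.
    move=> [m j]; rewrite E_E.
    have supp w : g (m, j) w != 0 -> level (rank m j) w.
      by rewrite /g; case: asboolP => //; rewrite eqxx.
    split=> //; apply: Hspace_supp supp => a w Aa; rewrite /g /=.
    have -> : `[< level (rank m j) (a + w) >] = `[< level (rank m j) w >].
      by apply/asboolP/asboolP; rewrite (level_A H).
    by case: ifP; rewrite ?mulr0 // ef.
  move: hs; congr (dist2 _ _ _ < _); apply/funext => w; rewrite big_map.
  have gE i : g (unrank i) w = if i == lv w then f w else 0.
    rewrite /g unrankK; congr (if _ then _ else _); apply/asboolP/eqP => [h|->//].
    exact: (level_inj H h (lvP w)).
  under eq_bigr do rewrite gE.
  rewrite -big_mkcond /=; case: (boolP (lv w \in s)) => h.
    by rewrite (big_rem _ h) /= eqxx big1_seq ?addr0 // => i /andP [/eqP ->];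
      rewrite mem_rem_uniq // inE eqxx.
  by rewrite big1_seq // => i /andP [/eqP -> ]; rewrite (negPf h).
Qed.

End Model.

Theorem mainTheorem6 (R : realType) (k : naLocalFieldType) (r l : nat)
    (varpi : k) (lambda : int) (psi : k -> R[i])
    (beta : 'cV[k]_(2 * r) -> 'cV[k]_(2 * r) -> k)
    (A B : set 'cV[k]_(2 * r))
    (char_k : [pchar k] =i pred0)
    (char_res : 2%N \notin [pchar (residue k)])
    (varpi_unif : uniformizer varpi)
    (psi_char : unitary_character psi)
    (psi_cond : has_conductor varpi psi lambda)
    (r_gt0 : (0 < r)%N)
    (beta_sympl : symplectic_form beta)
    (B_good : good_lattice beta varpi lambda B)
    (B_dim : quot_dim (dual_lattice beta varpi lambda B) B (2 * l))
    (A_self_dual : self_dual_lattice beta varpi lambda A)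
    (sub_BA : B `<=` A)
    (sub_AB : A `<=` dual_lattice beta varpi lambda B) :
  let G := P_B beta A B in
  let E := E_ varpi lambda psi beta A B in
  let Es := Epm varpi lambda psi beta A B in
  let V := label_space varpi lambda psi beta A B in
  let M := @M_ R k (2 * r) in
  let Mrep := subrep varpi lambda psi beta A B M in
  let Srep := subrep varpi lambda psi beta A B in
  let z := zeta R A B in
  let chi := chi_pm psi beta A B in
  let Pt := Ptilde_v beta A B in
  let D := layer varpi lambda beta A B in
  (* (i) *)
  [/\ hilbert_sum (Hform A) (Hspace psi beta A)
        (fun mj : nat * layer_index => E mj.1 mj.2),
      nonzero_space (E 0%N j0),
      forall (m : nat) (s : bool), (1 <= m)%N ->
        nonzero_space (Es m j0 s) <-> (0 < l)%N,
      forall (m : nat) (s : bool), nonzero_space (Es m j2 s) <-> (0 < l)%N &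
      forall (m : nat) (s : bool), nonzero_space (Es m j1 s) <-> (l < r)%N]
  /\
  (* (ii) *)
  [/\ forall x, valid_label x -> nonzero_space (V x) ->
        [/\ rep_invariant G M (V x), rep_irreducible G (Mrep x)
          & rep_monomial G (Mrep x)],
      forall x y, valid_label x -> valid_label y ->
        nonzero_space (V x) -> nonzero_space (V y) -> x <> y ->
        ~ rep_equivalent G (Mrep x) (Mrep y),
      rep_equivalent G (Mrep L00) (one_dim_rep (fun=> 1)) &
      forall (m : nat) (j : layer_index) (s : bool) v,
        valid_label (Lpm m j s) -> D m j v ->
        rep_equivalent G (Mrep (Lpm m j s)) (Ind G (Pt v) (chi v s))]
  /\
  (* (iii) *)
  forall S : 'M[k]_(2 * r) ->
      ('cV[k]_(2 * r) -> R[i]) -> ('cV[k]_(2 * r) -> R[i]),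
  weil_lift psi beta A B S ->
  [/\ forall x, valid_label x -> nonzero_space (V x) ->
        rep_invariant G S (V x) /\ rep_irreducible G (Srep S x),
      forall x y, valid_label x -> valid_label y ->
        nonzero_space (V x) -> nonzero_space (V y) -> x <> y ->
        ~ rep_equivalent G (Srep S x) (Srep S y),
      rep_equivalent G (Srep S L00) (one_dim_rep z) &
      forall (m : nat) (j : layer_index) (s : bool) v,
        valid_label (Lpm m j s) -> D m j v ->
        rep_equivalent G (Srep S (Lpm m j s))
          (Ind G (Pt v) (fun g => z g * chi v s g))].

Proof.
move=> G E Es V M Mrep Srep z chi Pt D.
have H : lattice_setting varpi lambda beta A B by split.
have nE x : valid_label x ->
  V x = level_space varpi lambda psi beta A B (lrank x) (lsgn x).
  exact: label_spaceE.
have posr m j s : valid_label (Lpm m j s) -> (0 < rank m j)%N by case: j => //=;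
  lia.
have rE act x : valid_label x -> subrep varpi lambda psi beta A B act x
    = @HRep R _ _ (level_space varpi lambda psi beta A B (lrank x) (lsgn x)) (Hform
      A) act.
  by move=> vx; rewrite /subrep label_spaceE.
have EsE m j s : (0 < rank m j)%N ->
    nonzero_space (Es m j s) <-> exists w, level varpi lambda beta A B (rank m j) w.
  move=> r0; have vx : valid_label (Lpm m j s) by case: j r0 => //=; lia.
  by have := nE _ vx => /= e; rewrite [Es m j s]e; exact: nonzero_spaceP.
have DE m j s v : valid_label (Lpm m j s) -> D m j v ->
    level varpi lambda beta A B (rank m j) v.
  by move=> /posr r0; rewrite /D layerE.
(* [M] is put in the form of the twisted actions, with z = 1. *)
have ME g f : G g -> Hspace psi beta A f -> M g f = (fun w => 1 * M_ g f w).
  by move=> _ _; apply/funext => w; rewrite mul1r.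
have n1 (g : 'M[k]_(2 * r)) : G g -> (1 : R[i]) != 0 by move=> _; exact: oner_neq0.
split; last split.
- split.
  + exact: (model_hilbert_sum H psi_cond).
  + exists (delta0 R A); first by exists 1; apply/funext => w; rewrite mul1r.
    move=> /(congr1 (fun f => f 0)); rewrite (delta0_0 R H) => /eqP.
    by rewrite oner_eq0.
  + move=> m s m0; rewrite EsE; last by rewrite /=; lia.
    by case: m m0 => // m _; exact: (level_nonempty_j0 H).
  + by move=> m s; rewrite EsE //; exact: (level_nonempty_j2 H).
  + move=> m s; rewrite EsE // (level_nonempty_j1 H _ B_dim).
    by rewrite ltn_pmul2l.
- split.
  + move=> x vx; rewrite nE // => nz; split.
    * move=> g f hg; exact: (space_M H).
    * rewrite /Mrep rE //;
      exact: (space_irreducible H psi_char psi_cond (z := fun=> 1) ME n1).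
    * rewrite /Mrep rE //; case: x vx nz => [|m j s] vx nz.
        exact: (trivial_monomial H psi_char psi_cond).
      have [v lv _] := label_level H psi_char psi_cond vx nz.
      exact: (space_monomial H psi_char psi_cond (posr _ _ _ vx) lv).
  + move=> x y vx vy; rewrite nE // => nz _ ne.
    rewrite /Mrep !rE //; have [v lv hs] := label_level H psi_char psi_cond vx nz.
    apply: (space_inequivalent H psi_char psi_cond (z := fun=> 1) ME n1 lv hs).
    by move=> /(label_pair_inj vx vy).
  + rewrite /Mrep rE //;
    exact: (trivial_equivalent H psi_char psi_cond (z := fun=> 1) ME).
  + move=> m j s v vx Dv; rewrite /Mrep rE //.
    exact: (induced_M_equivalent H psi_char psi_cond (posr _ _ _ vx) (DE _ _ _ _ vx
      Dv)).
- move=> S [Smet SM SE].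
  have GB g : G g -> stab beta B g by case.
  have d0 := delta0_space H psi_cond.
  have hd0 := space_Hspace H d0.
  (* [delta0] is fixed by [M_], so it is an eigenvector of [S g] with eigenvalue zeta; properties of
     [S] pass to [z]. *)
  have S0 g : G g -> S g (delta0 R A) = (fun w => z g * delta0 R A w).
    move=> hg; rewrite SE //; apply/funext => w; rewrite /M_ /delta0;
      congr (_ * (nat_of_bool _)%:R).
    by apply/idP/idP; rewrite !inE (P_B_A H _ (P_BV H hg)).
  (* [quadratic_character] takes the value 0 at 0; unitarity of [S g] on [delta0] excludes it,
     leaving only 1 and -1. *)
  have z0 g : G g -> z g != 0.
    move=> hg; have [_ [_ iso _] _] := Smet g (GB g hg).
    have sz : level_space varpi lambda psi beta A B 0 true (fun w =>
      z g * delta0 R A w).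
      by apply/(space0E H psi_cond); exists (z g).
    have := iso _ _ hd0 hd0; rewrite S0 //.
    rewrite (Hform0 H psi_char sz sz) (Hform0 H psi_char d0 d0).
    rewrite (delta0_0 R H) mulr1 => e; apply: contraTneq isT => zg.
    by move: e; rewrite zg mul0r conjc1 mulr1 => /esym/eqP; rewrite oner_eq0.
  have zs g : G g -> z g = 1 \/ z g = -1.
    move=> /z0; rewrite /z /zeta /quadratic_character.
    case: ifP => [_ /eqP //|_]; case: ifP => _ _; [by left|by right].
  (* Evaluate S(g h) [delta0] = S(g) S(h) [delta0] at 0. *)
  have zM g h : G g -> G h -> z (g *m h) = z g * z h.
    move=> hg hh; have hgh : G (g *m h) by exact: P_BM.
    have := SM g h _ (GB _ hg) (GB _ hh) hd0; rewrite (S0 _ hgh) (S0 _ hh).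
    rewrite SE //; last first.
      by apply: (space_Hspace H (s := true) (i := 0)); apply/(space0E H psi_cond);
        exists (z h).
    move=> /(congr1 (fun f => f 0)); rewrite /M_ mulmx0 (delta0_0 R H) !mulr1.
    by [].
  split.
  + move=> x vx; rewrite nE // => nz; split.
      by move=> g f hg; exact: (space_act H SE).
    rewrite /Srep rE //; exact: (space_irreducible H psi_char psi_cond SE z0).
  + move=> x y vx vy; rewrite nE // => nz _ ne.
    rewrite /Srep !rE //; have [v lv hs] := label_level H psi_char psi_cond vx nz.
    apply: (space_inequivalent H psi_char psi_cond SE z0 lv hs).
    by move=> /(label_pair_inj vx vy).
  + rewrite /Srep rE //; exact: (trivial_equivalent H psi_char psi_cond SE).
  + move=> m j s v vx Dv; rewrite /Srep rE //.
    exact: (induced_equivalent H psi_char psi_cond (posr _ _ _ vx) (DE _ _ _ _ vx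
      Dv) SE zs zM).
Qed.
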